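(* Let $\Sigma$ be a hyperelliptic compact Riemann surface of genus $g\ge 2$ and let $\xi$ be a non-singular even spin bundle on $\Sigma$. Let $P\in\Sigma$ be a non-Weierstrass point with $\deg_\epsilon P=g$ and $\widetilde P\notin\{\mathcal A_P\}$, and write $\mathcal A_P=P_1+\dots+P_g$. Then the set $\{\mathcal S_P\}$ has cardinality $2g+2$; more precisely, $$\{\mathcal S_P\}=\{P,\widetilde P\}\cup\{P_k,\widetilde{P}_k:\ k=1,\dots,g\}.$$
   Context: Let $K$ be the canonical bundle of $\Sigma$. A non-singular even spin bundle is a holomorphic line bundle $\xi$ on $\Sigma$ with $\xi^{\otimes 2}\cong K$ and $H^0(\Sigma,\xi)=0$. For every $P\in\Sigma$ there is then a unique (up to a nonzero constant) nonzero meromorphic section $\sigma_P$ of $\xi$ whose only pole is a simple pole at $P$. Its divisor is $(\sigma_P)=-P+\mathcal A_P$ with $\mathcal A_P=P_1+\dots+P_g$ an effective divisor of degree $g$ (points may repeat), $P\notin\{P_1,\dots,P_g\}$. For an effective divisor $\mathcal D$, $\{\mathcal D\}$ denotes the set of distinct points of $\mathcal D$. The $\epsilon$-degree $\deg_\epsilon P$ is the cardinality of $\{\mathcal A_P\}$. $\widetilde P$ denotes the image of $P$ under the hyperelliptic involution; the Weierstrass points are its fixed points. $\{\mathcal S_P\}\subset\Sigma$ is the smallest set containing $P$ such that $R\in\{\mathcal S_P\}$ implies $\{\mathcal A_R\}\subset\{\mathcal S_P\}$. *)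

(* Defs.v *)
From mathcomp Require Import all_boot all_order all_algebra.
From mathcomp Require Import all_classical all_reals all_analysis.
From mathcomp Require Import complex.

Set Implicit Arguments.
Unset Strict Implicit.
Unset Printing Implicit Defensive.

Import Order.TTheory GRing.Theory Num.Theory.
Import numFieldNormedType.Exports.
Local Open Scope classical_set_scope.
Local Open Scope ring_scope.

(* Packing R[i] as a numClosedFieldType makes the library's topology and
   normed-module structure available, so that [derivable f z 1] is complex
   differentiability. *)
Definition Cplx (R : realType) : numClosedFieldType := complex R.

(* [param a] is the inverse chart of [coord a]; its values outside
   [coord a @` dom a] are irrelevant. *)
Record compactRiemannSurface (R : realType) (X : topologicalType) :=
  CompactRiemannSurface {
    chart : Type ;
    dom : chart -> set X ;
    coord : chart -> X -> Cplx R ;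
    param : chart -> Cplx R -> X ;
    dom_open : forall a, open (dom a) ;
    dom_cover : forall p, exists a, dom a p ;
    coord_open : forall a, open (coord a @` dom a) ;
    coordK : forall a p, dom a p -> param a (coord a p) = p ;
    coord_continuous : forall a, {within dom a, continuous (coord a)} ;
    param_continuous :
      forall a, {within coord a @` dom a, continuous (param a)} ;
    transition_holomorphic : forall a b p, dom a p -> dom b p ->
      derivable (coord b \o param a) (coord a p) 1 ;
    surface_hausdorff : hausdorff_space X ;
    surface_connected : connected [set: X] ;
    surface_compact : compact [set: X] }.
Arguments chart {R X} S : rename.
Arguments dom {R X} S a _ : rename.
Arguments coord {R X} S a _ : rename.
Arguments param {R X} S a _ : rename.

Section Surface.
Variables (R : realType) (X : topologicalType).
Variable S : compactRiemannSurface R X.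
Local Notation C := (Cplx R).

Definition holomorphic_at (f : X -> C) (p : X) : Prop :=
  \forall q \near p, forall a, dom S a q ->
    derivable (f \o param S a) (coord S a q) 1.

(* f = (z - z(p))^n h near p, with h holomorphic and h(p) <> 0.  The identity
   is only required away from p: a meromorphic function is encoded as a
   C-valued one, whose value at a pole is irrelevant. *)
Definition has_order (f : X -> C) (p : X) (n : int) : Prop :=
  forall a, dom S a p -> exists h : X -> C,
    [/\ holomorphic_at h p, h p != 0 &
        \forall q \near p^', f q = (coord S a q - coord S a p) ^ n * h q].

Definition meromorphic_at (f : X -> C) (p : X) : Prop :=
  (exists n, has_order f p n) \/ (\forall q \near p^', f q = 0).

(* Transition functions [trans i j] of a line bundle, defined on
   [patch_dom i `&` patch_dom j]; a section is a family s with
   s_i = (trans i j) * s_j on overlaps. *)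
Record cocycle := Cocycle {
  patch : Type ;
  patch_dom : patch -> set X ;
  trans : patch -> patch -> X -> C }.
Arguments patch_dom {L} i _ : rename.
Arguments trans {L} i j _ : rename.

Definition holomorphic_line_bundle (L : cocycle) : Prop :=
  [/\ forall i, open (patch_dom (i : patch L)),
      forall p, exists i : patch L, patch_dom i p,
      forall (i j : patch L) p, patch_dom i p -> patch_dom j p ->
        holomorphic_at (trans i j) p /\ trans i j p != 0 &
      forall (i j k : patch L) p,
        patch_dom i p -> patch_dom j p -> patch_dom k p ->
        trans i k p = trans i j p * trans j k p].

Definition isomorphic (L M : cocycle) : Prop :=
  exists phi : patch M -> patch L -> X -> C,
    (forall a i p, patch_dom a p -> patch_dom i p ->
       holomorphic_at (phi a i) p /\ phi a i p != 0) /\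
    (forall a b i j p, patch_dom a p -> patch_dom b p ->
       patch_dom i p -> patch_dom j p ->
       phi b j p * trans j i p = trans b a p * phi a i p).

Definition tensor (L M : cocycle) : cocycle :=
  {| patch := (patch L * patch M)%type ;
     patch_dom := fun ij => patch_dom ij.1 `&` patch_dom ij.2 ;
     trans := fun ij kl p => trans ij.1 kl.1 p * trans ij.2 kl.2 p |}.

(* f_a dz_a = f_b dz_b, i.e. f_a = (dz_b / dz_a) f_b. *)
Definition canonical_bundle : cocycle :=
  {| patch := chart S ;
     patch_dom := dom S ;
     trans := fun a b p => derive1 (coord S b \o param S a) (coord S a p) |}.

Definition compatible (L : cocycle) (s : patch L -> X -> C) : Prop :=
  forall i j p, patch_dom i p -> patch_dom j p -> s i p = trans i j p * s j p.

Definition holomorphic_section (L : cocycle) (s : patch L -> X -> C) : Prop :=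
  compatible s /\ forall i p, patch_dom i p -> holomorphic_at (s i) p.

Definition meromorphic_section (L : cocycle) (s : patch L -> X -> C) : Prop :=
  compatible s /\ forall i p, patch_dom i p -> meromorphic_at (s i) p.

Definition section_order (L : cocycle) (s : patch L -> X -> C) (p : X)
    (n : int) : Prop :=
  forall i, patch_dom i p -> has_order (s i) p n.

(* dim H^0(K) = g. *)
Definition has_genus (g : nat) : Prop :=
  exists omega : 'I_g -> patch canonical_bundle -> X -> C,
    (forall k, holomorphic_section (omega k)) /\
    (forall s : patch canonical_bundle -> X -> C, holomorphic_section s ->
       exists! c : 'rV[C]_g, forall i p, patch_dom i p ->
         s i p = \sum_(k < g) c 0 k * omega k i p).

(* H^0(xi) = 0 makes dim H^0(xi) even, so evenness needs no extra clause. *)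
Definition nonsingular_even_spin_bundle (xi : cocycle) : Prop :=
  [/\ holomorphic_line_bundle xi,
      isomorphic (tensor xi xi) canonical_bundle &
      forall s : patch xi -> X -> C, holomorphic_section s ->
        forall i p, patch_dom i p -> s i p = 0].

Definition point_divisor (p : X) : X -> nat := fun q => (q == p : nat).

(* The projective line is the one-point compactification of C, with None as
   the point at infinity; the local coordinate at c is w - c, and at infinity
   1 / w.  The other values are irrelevant, being taken away from the centre. *)
Definition P1_coord (c w : one_point_compactification C) : C :=
  match c, w with
  | Some c, Some w => w - c
  | None, Some w => w^-1
  | _, None => 0
  end.

Definition holomorphic_to_P1 (F : X -> one_point_compactification C) : Prop :=
  continuous F /\ forall p, holomorphic_at (fun q => P1_coord (F p) (F q)) p.

(* D is the divisor of the fibre of F above c, with multiplicities. *)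
Definition fibre_divisor (F : X -> one_point_compactification C)
    (c : one_point_compactification C) (D : X -> nat) : Prop :=
  forall q,
    (F q = c -> has_order (fun r => P1_coord (F q) (F r)) q (D q)%:Z) /\
    (F q <> c -> D q = 0%N).

Definition degree_two (F : X -> one_point_compactification C) : Prop :=
  forall c, exists p q,
    fibre_divisor F c (fun r => point_divisor p r + point_divisor q r)%N.

(* The surface has a degree-two holomorphic map to the projective line, and
   inv exchanges its two sheets: the fibre through p is p + inv(p).  In
   particular the surface is hyperelliptic, once its genus is at least 2. *)
Definition hyperelliptic_involution (inv : X -> X) : Prop :=
  exists F : X -> one_point_compactification C,
    [/\ holomorphic_to_P1 F, degree_two F &
        forall p, fibre_divisor F (F p)
          (fun r => point_divisor p r + point_divisor (inv p) r)%N].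

(* Such a section is nonzero, since it has a pole at P. *)
Definition only_simple_pole (L : cocycle) (P : X) (s : patch L -> X -> C) :
    Prop :=
  [/\ meromorphic_section s, section_order s P (-1) &
      forall Q n, Q <> P -> section_order s Q n -> 0 <= n].

(* D is the effective divisor A_P: (sigma_P) = - P + A_P.  It is unique when L
   is a non-singular even spin bundle. *)
Definition zero_divisor (L : cocycle) (P : X) (D : X -> nat) : Prop :=
  exists2 s : patch L -> X -> C, only_simple_pole P s &
    forall Q, section_order s Q ((D Q)%:Z - (point_divisor P Q)%:Z).

Definition zero_set (L : cocycle) (P : X) : set X :=
  [set Q | exists2 D, zero_divisor L P D & (0 < D Q)%N].

Definition eps_degree (L : cocycle) (P : X) (n : nat) : Prop :=
  (zero_set L P #= `I_n)%card.

Definition S_set (L : cocycle) (P : X) : set X :=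
  smallest (fun M : set X => forall Q, M Q -> zero_set L Q `<=` M) [set P].

End Surface.

(* Main.v *)
Require Import Defs.
From mathcomp Require Import all_boot all_order all_algebra.
From mathcomp Require Import all_classical all_reals all_analysis.
From mathcomp Require Import complex.
From mathcomp Require Import ring lra zify.
(* Again, because [vector] shadows the field [coord]. *)
Import Defs.

(* Let x be a degree-two function with poles P and P~.  The idea is to exhibit the
   sections sigma_Q explicitly; since H^0(xi) = 0 they are determined by their
   divisors.  Dividing sigma_P by x - x(P_k) gives a section of divisor
   A_P - P_k + P~ - P~_k, which must be sigma_{P~_k}; in particular the points
   P_k, P~_k cannot cancel each other.

   A second family comes from sigma_{P~}.  As xi^2 = K, the quotient
   y = sigma_P^2 / dx is a meromorphic function, and u = (y o inv) / y has divisor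
   2 (inv A_P - P~ - A_P + P).  With N = prod_k (x - x(P_k)), the function
   N^2 (2 - u - 1/u) = - N^2 (1 - u)^2 / u is invariant under inv and has poles
   only at P and P~, hence is a polynomial in x.  Its roots have even
   multiplicity: away from the Weierstrass points because the orders of u are
   even, and at these points because u = -1 there, y having odd order.  So it is a
   square t(x)^2, and psi = N (1 - u) / t(x) satisfies psi^2 = - u.  Therefore
   psi sigma_P has divisor inv A_P - P~, that is, A_{P~} = inv A_P.  Dividing by
   x - x(P_k) again gives A_{P_k} = P + inv A_P - P~_k; if P_k were a Weierstrass
   point, this would contradict the divisor found for sigma_{P~_k}.

   Liouville's theorem is not needed on its own: a function f without poles is
   constant because (f - f(P)) sigma_P is a holomorphic section.  The local theory
   of holomorphic functions, which are only assumed complex differentiable at each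
   point, comes from Goursat's theorem and Cauchy's formula for a square. *)

Set Implicit Arguments.
Unset Strict Implicit.
Unset Printing Implicit Defensive.

Import Order.TTheory GRing.Theory Num.Theory.
Import numFieldNormedType.Exports.
Local Open Scope classical_set_scope.
Local Open Scope ring_scope.

(** * Integration of complex functions along segments *)

(** The obstacle is to conjugate sigma_P by [inv] without an isomorphism between xi and its
    pullback: only functions are composed with [inv], and the section sought is a function times
    sigma_P. Its divisor requires a square root of u up to sign. Since u (u o inv) = 1, an idea of
    Hilbert 90 type applies: (1 - u)^2 / u is invariant, so u is the square (1 - u)^2 up to an
    invariant factor, and the question becomes one about a polynomial in x, whose roots can be
    counted over the algebraically closed field C. The sign matters: where u = -1, the function 1 -
    u takes the value 2, while 1 + u would vanish to an unknown order.

    The assumption that P~ does not occur in A_P keeps the P_k away from the poles of x, so that x -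
    x(P_k) has divisor P_k + P~_k - P - P~.

    A second obstacle is that [inv] is given as a mere map of sets, known through the fibres of F.
    Its continuity, and a non-zero derivative in charts, must be extracted from these fibres before
    orders can be transported along it. *)

Section RealPrimitive.
Variable R : realType.

Lemma primitive_on (phi : R -> R) (M : R) : continuous phi ->
  exists Phi : R -> R, Phi 0 = 0 /\
    forall t : R, - M < t < M -> is_derive t 1 Phi (phi t).
Proof.
move=> cphi.
(* The lower bound is [- M] because the fundamental theorem applies strictly to its right; the
   normalisation at 0 is made afterwards. *)
pose F x := (\int[lebesgue_measure]_(t in `[- M, x]) phi t)%R.
exists (fun x => F x - F 0); split; first by rewrite subrr.
move=> t /andP[tM1 tM2].
have iphi : lebesgue_measure.-integrable `[- M, M] (EFin \o phi).
  apply: continuous_compact_integrable; first exact: segment_compact.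
  exact: continuous_subspaceT.
have [dF eF] := @continuous_FTC1_closed R phi (- M) t M tM2 iphi tM1 (cphi t).
have isF : is_derive t 1 F (phi t) by rewrite -eF derive1E; exact: derivableP.
rewrite (_ : phi t = phi t - 0); last by rewrite subr0.
exact: is_deriveB.
Qed.

Lemma is_derive_continuous (F : R -> R) (t d : R) :
  is_derive t 1 F d -> {for t, continuous F}.
Proof.
move=> [dF _]; apply: differentiable_continuous; exact/derivable1_diffP.
Qed.

Lemma primitive_unique_on (F G phi : R -> R) (M x : R) :
  (forall t : R, - M < t < M -> is_derive t 1 F (phi t)) ->
  (forall t : R, - M < t < M -> is_derive t 1 G (phi t)) ->
  F 0 = G 0 -> - M < x < M -> F x = G x.
Proof.
move=> dF dG FG0 xM.
have M0 : 0 < M by lra.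
pose D t := F t - G t.
have dD t : - M < t < M -> is_derive t 1 D 0.
  by move=> tM; rewrite -(subrr (phi t)); have := dF t tM; have := dG t tM; move=> ? ?; exact: is_deriveB.
have key a b : - M < a -> a <= b -> b < M -> D a = D b.
  move=> Ma ab bM.
  have [| |c _] := @MVT_segment R D (fun=> 0) a b ab.
  - by move=> t; rewrite in_itv /= => /andP[? ?]; apply: dD; lra.
  - apply: continuous_in_subspaceT => t; rewrite inE /= in_itv /= => /andP[? ?].
    by apply: (@is_derive_continuous D t 0); apply: dD; lra.
  by rewrite mul0r => /eqP; rewrite subr_eq0 => /eqP.
suff : D x = 0 by rewrite /D => /eqP; rewrite subr_eq0 => /eqP.
have D0 : D 0 = 0 by rewrite /D FG0 subrr.
case: (leP 0 x) => x0; rewrite -D0.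
  by rewrite (key 0 x) //; lra.
by rewrite (key x 0) //; lra.
Qed.

Lemma primitive (phi : R -> R) : continuous phi ->
  exists Phi : R -> R, Phi 0 = 0 /\ forall t : R, is_derive t 1 Phi (phi t).
Proof.
move=> cphi.
have /choice[Psi hPsi] : forall M : R, exists Phi : R -> R, Phi 0 = 0 /\
    forall t : R, - M < t < M -> is_derive t 1 Phi (phi t).
  by move=> M; exact: primitive_on.
(* The bound depends on the point. Near t, uniqueness identifies all the primitives involved with
   the single one for [M], the bound |t| + 2. *)
exists (fun x => Psi (`|x| + 1) x); split; first exact: (hPsi _).1.
move=> t.
pose M := `|t| + 2.
have tM : - M < t < M.
  by rewrite /M; have := ler_norm t; have := ler_norm (- t); rewrite normrN; lra.
have dPsi := (hPsi M).2 t tM.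
apply: near_eq_is_derive dPsi.
have : nbhs t (ball t (1 : R)); first by apply: nbhsx_ballx; exact: ltr01.
apply: filterS => x; rewrite /ball /= => tx.
have xt : `|x| < `|t| + 1.
  have : `|x| <= `|t| + `|x - t| by rewrite -[x in `|x|](subrKC t) ler_normD.
  by rewrite distrC in tx; lra.
have := normr_ge0 x; have := ler_norm x; have := ler_norm (- x).
rewrite normrN => *.
apply: (@primitive_unique_on _ _ phi (`|x| + 1)).
- by move=> s sM; apply: (hPsi M).2; rewrite /M; lra.
- by move=> s sM; apply: (hPsi _).2.
- by rewrite (hPsi _).1 (hPsi _).1.
- lra.
Qed.

Lemma derive_bound (F f : R -> R) (M s : R) :
  (forall t : R, is_derive t 1 F (f t)) ->
  (forall t, `|t| <= `|s| -> `|f t| <= M) -> `|F s - F 0| <= M * `|s|.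
Proof.
move=> dF fM.
have cF (A : set R) : {within A, continuous F}.
  by apply: continuous_subspaceT => t; exact: is_derive_continuous (dF t).
case: (leP 0 s) => s0.
  have [c] := @MVT_segment R F f 0 s s0 (fun t _ => dF t) (cF _).
  rewrite in_itv /= subr0 => /andP[c0 cs] ->.
  rewrite normrM ler_wpM2r // fM //; rewrite !ger0_norm //; lra.
have [c] := @MVT_segment R F f s 0 (ltW s0) (fun t _ => dF t) (cF _).
rewrite in_itv /= sub0r => /andP[c0 cs] e.
rewrite distrC e normrM normrN ler_wpM2r // fM // ler0_norm // ler0_norm; lra.
Qed.

Lemma derive_gt0 (F f : R -> R) (s : R) : 0 < s ->
  (forall t : R, is_derive t 1 F (f t)) -> (forall t, 0 < f t) -> F 0 < F s.
Proof.
move=> s0 dF f0.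
have cF (A : set R) : {within A, continuous F}.
  by apply: continuous_subspaceT => t; exact: is_derive_continuous (dF t).
have [c _] := @MVT_segment R F f 0 s (ltW s0) (fun t _ => dF t) (cF _).
by rewrite subr0 => e; rewrite -subr_gt0 e mulr_gt0.
Qed.

End RealPrimitive.

Section ComplexPrimitive.
Variable R : realType.
Local Notation C := (Cplx R).
Local Notation Re := (@complex.Re R).
Local Notation Im := (@complex.Im R).
Local Notation normc := (@ComplexField.Normc.normc R).
Local Notation "x %:C" := (real_complex R x : Cplx R).
Local Notation ii := (Complex 0 1 : Cplx R).

Lemma normCE (z : C) : `|z| = (normc z)%:C. Proof. by []. Qed.
Lemma ReD (z w : C) : Re (z + w) = Re z + Re w. Proof. by case: z w => ? ? []. Qed.
Lemma ImD (z w : C) : Im (z + w) = Im z + Im w. Proof. by case: z w => ? ? []. Qed.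
Lemma ReN (z : C) : Re (- z) = - Re z. Proof. by case: z. Qed.
Lemma ImN (z : C) : Im (- z) = - Im z. Proof. by case: z. Qed.
Lemma ReM (z w : C) : Re (z * w) = Re z * Re w - Im z * Im w.
Proof. by case: z w => ? ? []. Qed.
Lemma ImM (z w : C) : Im (z * w) = Re z * Im w + Im z * Re w.
Proof. by case: z w => ? ? []. Qed.
Lemma complexP (z w : C) : Re z = Re w -> Im z = Im w -> z = w.
Proof. by case: z w => ? ? [? ?] /= -> ->. Qed.

Lemma normc_ge0 (z : C) : 0 <= normc z.
Proof. by rewrite -lecR -normCE normr_ge0. Qed.
Lemma normc_triangle (z w : C) : normc (z + w) <= normc z + normc w.
Proof. by rewrite -lecR rmorphD /= -!normCE; exact: ler_normD. Qed.
Lemma normc_mul (z w : C) : normc (z * w) = normc z * normc w.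
Proof. exact: ComplexField.Normc.normcM. Qed.
Lemma normc_inv (z : C) : normc z^-1 = (normc z)^-1.
Proof. exact: ComplexField.Normc.normcV. Qed.
Lemma normc_opp (z : C) : normc (- z) = normc z.
Proof. by apply: complexI; exact: (normrN (z : C)). Qed.
Lemma normc_dist (z w : C) : normc (z - w) = normc (w - z).
Proof. by rewrite -normc_opp opprB. Qed.
Lemma normc_eq0 (z : C) : (normc z == 0) = (z == 0).
Proof.
apply/eqP/eqP => [|->]; first exact: ComplexField.Normc.eq0_normc.
exact: ComplexField.Normc.normc0.
Qed.
Lemma normc_gt0 (z : C) : z != 0 -> 0 < normc z.
Proof. by move=> z0; rewrite lt_neqAle eq_sym normc_eq0 z0 normc_ge0. Qed.
Lemma Re_le_normc (z : C) : `|Re z| <= normc z.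
Proof. by rewrite -lecR; exact: normc_ge_Re. Qed.
Lemma normc_i : normc ii = 1.
Proof. by rewrite /= expr0n expr1n add0r sqrtr1. Qed.
Lemma Im_le_normc (z : C) : `|Im z| <= normc z.
Proof.
rewrite (_ : `|Im z| = `|Re (z * ii)|).
  by apply: le_trans (Re_le_normc _) _; rewrite normc_mul normc_i mulr1.
by rewrite ReM /= mulr0 mulr1 sub0r normrN.
Qed.
Lemma normc_real (x : R) : normc x%:C = `|x|.
Proof. by rewrite /= expr0n addr0 sqrtr_sqr. Qed.
Lemma complexRI (z : C) : z = (Re z)%:C + ii * (Im z)%:C.
Proof. exact: complexE. Qed.
Lemma normc_le_ReIm (z : C) : normc z <= `|Re z| + `|Im z|.
Proof.
rewrite {1}[z]complexRI; apply: le_trans (normc_triangle _ _) _.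
by rewrite normc_mul normc_i mul1r !normc_real.
Qed.

(** In the normed structure of [Cplx R], norms and radii are themselves complex numbers. From here
    on they are replaced by real ones, which are within reach of [lra]. *)
Lemma cvgCP (T : Type) (F : set_system T) (FF : Filter F) (f : T -> C) (l : C) :
  f @ F --> l <-> forall e : R, 0 < e -> \forall x \near F, normc (l - f x) < e.
Proof.
split=> [/cvgrPdist_lt h e e0|h].
  have : 0 < e%:C by rewrite ltcR.
  by move/h; apply: filterS => x; rewrite normCE ltcR.
apply/cvgrPdist_lt => e e0.
have ee : e = (Re e)%:C by rewrite RRe_real // gtr0_real.
rewrite ee; apply: filterS (h (Re e) _) => [x|]; first by rewrite normCE ltcR.
by move: e0; rewrite ee ltcR.
Qed.

Lemma continuousCP (T : topologicalType) (f : T -> C) (p : T) :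
  {for p, continuous f} <->
  forall e : R, 0 < e -> \forall q \near p, normc (f p - f q) < e.
Proof. exact: cvgCP. Qed.

Lemma nbhs_ballC (z : C) (e : R) : 0 < e -> \forall w \near z, normc (z - w) < e.
Proof. by move=> e0; have /cvgCP := @cvg_id C (nbhs z); exact. Qed.

Lemma nbhsCP (z : C) (A : set C) :
  nbhs z A <-> exists2 e : R, 0 < e & forall w, normc (z - w) < e -> A w.
Proof.
split=> [/nbhs_ballP[e /= e0 h]|[e e0 h]].
  have ee : e = (Re e)%:C by rewrite RRe_real // gtr0_real.
  exists (Re e); first by move: e0; rewrite ee ltcR.
  by move=> w zw; apply: h; rewrite /ball /= ee normCE ltcR.
by apply: filterS (nbhs_ballC z e0).
Qed.

Lemma continuous_ReIm (T : topologicalType) (f : T -> C) : continuous f ->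
  continuous (fun t => Re (f t)) /\ continuous (fun t => Im (f t)).
Proof.
move=> cf; split=> t; apply/cvgrPdist_lt => e e0;
  have /continuousCP/(_ e e0) := cf t; apply: filterS => x; apply: le_lt_trans.
  by rewrite -ReN -ReD; exact: Re_le_normc.
by rewrite -ImN -ImD; exact: Im_le_normc.
Qed.

Lemma continuous_line (a d : C) : continuous (fun t : R => a + d * t%:C).
Proof.
move=> t; apply/continuousCP => e e0.
have [->|d0] := eqVneq d 0.
  by apply: (@filterE _ (nbhs t)) => x; rewrite !mul0r subrr ComplexField.Normc.normc0.
have := @cvg_id R^o (nbhs t).
move/cvgrPdist_lt/(_ (e / normc d)); rewrite divr_gt0 ?normc_gt0 // => /(_ isT).
apply: filterS => x.
rewrite (_ : a + d * t%:C - (a + d * x%:C) = d * (t - x)%:C); last first.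
  by rewrite rmorphB /=; ring.
by rewrite normc_mul normc_real ltr_pdivlMr ?normc_gt0 // mulrC.
Qed.

Section ContinuousOperations.
Variables (T : topologicalType) (p : T).
Implicit Types f g : T -> C.

Lemma continuous_addC f g : continuous_at p f -> continuous_at p g ->
  continuous_at p (fun x => f x + g x).
Proof. by move=> cf cg; have := continuousD cf cg. Qed.
Lemma continuous_subC f g : continuous_at p f -> continuous_at p g ->
  continuous_at p (fun x => f x - g x).
Proof. by move=> cf cg; have := continuousB cf cg. Qed.
Lemma continuous_mulC f g : continuous_at p f -> continuous_at p g ->
  continuous_at p (fun x => f x * g x).
Proof. by move=> cf cg; have := continuousM cf cg. Qed.
Lemma continuous_invC f : f p != 0 -> continuous_at p f ->
  continuous_at p (fun x => (f x)^-1).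
Proof. by move=> f0 cf; have := continuousV f0 cf. Qed.
Lemma continuous_cstC (c : C) : continuous_at p (fun=> c).
Proof. exact: cst_continuous. Qed.

End ContinuousOperations.

Definition is_prim (phi Phi : R -> C) := Phi 0 = 0 /\ forall t : R,
  is_derive t 1 (fun t => Re (Phi t)) (Re (phi t)) /\
  is_derive t 1 (fun t => Im (Phi t)) (Im (phi t)).

(** Choosing the primitive makes it a total function of the integrand, so that integrals need no
    proof of continuity as an argument; the default 0 is taken when there is no primitive on the
    whole line. *)
Definition rprim (phi : R -> R) : R -> R := xget (fun=> 0)
  [set Phi : R -> R | Phi 0 = 0 /\ forall t : R, is_derive t 1 Phi (phi t)].

Definition cprim (phi : R -> C) (s : R) : C :=
  Complex (rprim (fun t => Re (phi t)) s) (rprim (fun t => Im (phi t)) s).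

Lemma rprim_eq (phi Phi : R -> R) : Phi 0 = 0 ->
  (forall t : R, is_derive t 1 Phi (phi t)) -> rprim phi = Phi.
Proof.
move=> Phi0 dPhi; rewrite /rprim.
case: xgetP => [Psi _ [Psi0 dPsi]|/(_ Phi)]; last by case.
apply/funext => s.
apply: (@primitive_unique_on R Psi Phi phi (`|s| + 1) s) => //; first by rewrite Psi0.
by have := ler_norm s; have := ler_norm (- s); rewrite normrN; lra.
Qed.

Lemma cprim_eq (phi Phi : R -> C) : is_prim phi Phi -> cprim phi = Phi.
Proof.
move=> [Phi0 dPhi]; apply/funext => s; rewrite /cprim.
have -> : rprim (fun t => Re (phi t)) = fun t => Re (Phi t).
  by apply: rprim_eq => [|t]; [rewrite Phi0|exact: (dPhi t).1].
have -> : rprim (fun t => Im (phi t)) = fun t => Im (Phi t).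
  by apply: rprim_eq => [|t]; [rewrite Phi0|exact: (dPhi t).2].
by case: (Phi s).
Qed.

Lemma cprimP (phi : R -> C) : continuous phi -> is_prim phi (cprim phi).
Proof.
move=> /continuous_ReIm[cRe cIm].
have [F [F0 dF]] := primitive cRe; have [G [G0 dG]] := primitive cIm.
have hp : is_prim phi (fun t => Complex (F t) (G t)) by split=> //=; rewrite F0 G0.
by rewrite (cprim_eq hp).
Qed.

Lemma is_primD (phi psi Phi Psi : R -> C) : is_prim phi Phi -> is_prim psi Psi ->
  is_prim (fun t => phi t + psi t) (fun t => Phi t + Psi t).
Proof.
move=> [F0 dF] [G0 dG]; split=> [|t]; first by rewrite F0 G0 addr0.
have [? ?] := dF t; have [? ?] := dG t.
split.
  by under eq_fun do rewrite ReD; rewrite ReD; exact: is_deriveD.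
by under eq_fun do rewrite ImD; rewrite ImD; exact: is_deriveD.
Qed.

Lemma is_primZ (c : C) (phi Phi : R -> C) : is_prim phi Phi ->
  is_prim (fun t => c * phi t) (fun t => c * Phi t).
Proof.
move=> [F0 dF]; split=> [|t]; first by rewrite F0 mulr0.
have [? ?] := dF t.
split.
  under eq_fun do rewrite ReM; rewrite ReM.
  by apply: is_deriveB; exact: (@is_deriveZ _ _ _ _ _ _ _ _).
under eq_fun do rewrite ImM; rewrite ImM.
by apply: is_deriveD; exact: (@is_deriveZ _ _ _ _ _ _ _ _).
Qed.

Lemma is_prim_cst (c : C) : is_prim (fun=> c) (fun t => c * t%:C).
Proof.
rewrite (_ : (fun=> c) = fun t : R => c * 1); last first.
  by apply/funext => t; rewrite mulr1.
apply: (@is_primZ c (fun=> 1) (fun t => t%:C)); split=> [//|t]; split=> /=.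
  exact: is_derive_id.
exact: is_derive_cst.
Qed.

Lemma is_prim_id : is_prim (fun t => t%:C) (fun t => (t ^+ 2 / 2)%:C).
Proof.
split=> [|t]; first by rewrite expr0n mul0r.
split=> /=; last exact: is_derive_cst.
rewrite (_ : (fun t : R => t ^+ 2 / 2) = (2^-1 : R) \*: (fun t : R => t ^+ 2)); last first.
  by apply/funext => x /=; rewrite mulrC.
have h := is_derive_eq (is_deriveX 1 (is_derive_id t (1 : R))).
apply: is_derive_eq.
by rewrite /GRing.scale /=; field.
Qed.

Lemma is_prim_shift (phi Phi : R -> C) (s : R) : is_prim phi Phi ->
  is_prim (fun t => phi (s + t)) (fun t => Phi (s + t) - Phi s).
Proof.
have sh (f : R -> R) (t d c : R) : is_derive (s + t) 1 f d ->
    is_derive t 1 (fun t => f (s + t) - c) d.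
  move=> df; rewrite -[d]subr0; apply: is_deriveB.
  rewrite -[d]mulr1; apply: (@is_derive1_comp R f (fun t => s + t)).
  have := @is_deriveD R _ _ (fun=> s) id t 1 0 1 _ _.
  by rewrite add0r; apply.
move=> [F0 dF]; split=> [|t]; first by rewrite addr0 subrr.
have [? ?] := dF (s + t); split.
  by under eq_fun do rewrite ReD ReN; exact: (sh (fun t => Re (Phi t))).
by under eq_fun do rewrite ImD ImN; exact: (sh (fun t => Im (Phi t))).
Qed.

(** The factor 2 comes from applying the mean value inequality to the real and imaginary parts
    separately. *)
Lemma cprim_bound (phi : R -> C) (M s : R) : continuous phi ->
  (forall t, `|t| <= `|s| -> normc (phi t) <= M) ->
  normc (cprim phi s) <= 2 * M * `|s|.
Proof.
move=> /cprimP[F0 dF] bM.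
apply: le_trans (normc_le_ReIm _) _.
have h1 : `|Re (cprim phi s) - Re (cprim phi 0)| <= M * `|s|.
  apply: (@derive_bound R (fun t => Re (cprim phi t)) (fun t => Re (phi t))).
    by move=> t; have [] := dF t.
  by move=> t ts; exact: le_trans (Re_le_normc _) (bM _ ts).
have h2 : `|Im (cprim phi s) - Im (cprim phi 0)| <= M * `|s|.
  apply: (@derive_bound R (fun t => Im (cprim phi t)) (fun t => Im (phi t))).
    by move=> t; have [] := dF t.
  by move=> t ts; exact: le_trans (Im_le_normc _) (bM _ ts).
by move: h1 h2; rewrite F0 /= !subr0; lra.
Qed.

End ComplexPrimitive.

(** * Integrals along segments and around rectangles *)

Section Goursat.
Variable R : realType.
Local Notation C := (Cplx R).
Local Notation Re := (@complex.Re R).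
Local Notation Im := (@complex.Im R).
Local Notation normc := (@ComplexField.Normc.normc R).
Local Notation "x %:C" := (real_complex R x : Cplx R).
Local Notation ii := (Complex 0 1 : Cplx R).

(** Caratheodory's form of differentiability: k is the difference quotient, completed by the
    derivative at z. Chain rules and changes of chart become products of continuous functions. *)
Lemma derivableCP (f : C -> C) (z : C) :
  derivable f z 1 <->
  exists k : C -> C, {for z, continuous k} /\
    forall w, f w = f z + (w - z) * k w.
Proof.
split=> [/cvg_ex[/= l /cvgCP fl]|[k [/continuousCP kc kE]]].
  exists (fun w => if w == z then l else (w - z)^-1 * (f w - f z)); split.
    apply/continuousCP => e e0; rewrite eqxx.
    have /nbhsCP[d d0 hd] := fl e e0.
    apply: filterS (nbhs_ballC z d0) => w zw.
    case: eqVneq => [_|wz]; first by rewrite subrr ComplexField.Normc.normc0.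
    have zw' : normc (w - z) < d by rewrite normc_dist.
    have := hd (w - z); rewrite sub0r normc_opp => /(_ zw').
    by rewrite subr_eq0 => /(_ wz) /=; rewrite [X in f (X + z)]mulr1 subrK.
  move=> w; case: eqVneq => [->|wz]; first by rewrite subrr mul0r addr0.
  by rewrite mulVKf ?subr_eq0 // subrKC.
apply/cvg_ex; exists (k z); apply/cvgCP => e e0.
apply/nbhsCP.
have /nbhsCP[d d0 hd] := kc e e0.
exists d => // h; rewrite sub0r normc_opp => hd' h0.
rewrite /= [X in f (X + z)]mulr1 kE addrAC subrr add0r addrK.
rewrite [X in k z - X](_ : _ = k (h + z)); last by rewrite /GRing.scale /= mulKf.
by apply: hd; rewrite opprD addrC subrK normc_opp.
Qed.

Lemma derivable_approx (f : C -> C) (z : C) : derivable f z 1 ->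
  exists L : C, forall e : R, 0 < e -> exists2 d : R, 0 < d & forall w : C,
    normc (w - z) < d -> normc (f w - (f z + L * (w - z))) <= e * normc (w - z).
Proof.
move=> /derivableCP[k [/continuousCP kc kE]]; exists (k z) => e e0.
have /nbhsCP[d d0 hd] := kc e e0; exists d => // w wz.
rewrite kE opprD addrACA subrr add0r [k z * _]mulrC -mulrBr normc_mul mulrC.
by rewrite ler_wpM2r ?normc_ge0 // normc_dist ltW // hd // normc_dist.
Qed.

Lemma derivable_continuous_at (f : C -> C) (z : C) :
  derivable f z 1 -> continuous_at z f.
Proof. by move=> df; apply: differentiable_continuous; exact/derivable1_diffP. Qed.

(** The integral of f(z) dz from a to a + d s; the factor d is dz/dt. *)
Definition segint (f : C -> C) (a d : C) (s : R) : C :=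
  d * cprim (fun t => f (a + d * t%:C)) s.

Definition line_continuous (f : C -> C) (a d : C) := continuous (fun t : R => f (a + d * t%:C)).

Lemma continuous_line_continuous f a d : continuous f -> line_continuous f a d.
Proof.
move=> cf t; apply: (@continuous_comp _ _ _ (fun t : R => a + d * t%:C) f).
  exact: continuous_line.
exact: cf.
Qed.

Lemma segintD f g a d s : line_continuous f a d -> line_continuous g a d ->
  segint (fun z => f z + g z) a d s = segint f a d s + segint g a d s.
Proof.
move=> /cprimP hf /cprimP hg; rewrite /segint.
by rewrite (cprim_eq (is_primD hf hg)) mulrDr.
Qed.

Lemma segintZ c f a d s : line_continuous f a d ->
  segint (fun z => c * f z) a d s = c * segint f a d s.
Proof.
by move=> /cprimP hf; rewrite /segint (cprim_eq (is_primZ c hf)) mulrCA.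
Qed.

Lemma segint_add f a d s t : line_continuous f a d ->
  segint f a d (s + t) = segint f a d s + segint f (a + d * s%:C) d t.
Proof.
move=> cf; have hf := cprimP cf.
have := cprim_eq (is_prim_shift s hf).
rewrite /segint -mulrDr (_ : (fun t0 => _) = fun t0 => f (a + d * s%:C + d * t0%:C)).
  by move=> ->; rewrite subrKC.
by apply/funext => x; rewrite rmorphD mulrDr addrA.
Qed.

Lemma segint0 f a d : line_continuous f a d -> segint f a d 0 = 0.
Proof. by move=> /cprimP[h _]; rewrite /segint h mulr0. Qed.

Lemma segint_opp f a d s : line_continuous f a d ->
  segint f (a + d * s%:C) d (- s) = - segint f a d s.
Proof.
move=> cf; have := segint_add s (- s) cf; rewrite subrr segint0 // => /eqP.
by rewrite eq_sym addrC addr_eq0 => /eqP.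
Qed.

Lemma segint_bound f a d M s : line_continuous f a d -> normc d = 1 ->
  (forall t, `|t| <= `|s| -> normc (f (a + d * t%:C)) <= M) ->
  normc (segint f a d s) <= 2 * M * `|s|.
Proof.
by move=> cf d1 fM; rewrite /segint normc_mul d1 mul1r; exact: cprim_bound.
Qed.

Lemma segint_affine (c m a d : C) s :
  segint (fun z => c + m * z) a d s =
  d * ((c + m * a) * s%:C + m * d * (s ^+ 2 / 2)%:C).
Proof.
rewrite /segint.
have h := is_primD (is_prim_cst (c + m * a)) (is_primZ (m * d) (@is_prim_id R)).
have /= <- := congr1 (fun F => F s) (cprim_eq h); congr (_ * cprim _ _).
by apply/funext => t; rewrite mulrDr addrA mulrA.
Qed.

(* [s] and [t] may be negative. *)
Definition rectint (f : C -> C) (a : C) (s t : R) : C :=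
  segint f a 1 s + segint f (a + 1 * s%:C) ii t
  - segint f (a + ii * t%:C) 1 s - segint f a ii t.

Definition edge_continuous (f : C -> C) (a : C) (s t : R) :=
  [/\ line_continuous f a 1, line_continuous f (a + 1 * s%:C) ii, line_continuous f (a + ii * t%:C) 1 & line_continuous f a ii].

Lemma continuous_edge_continuous f a s t : continuous f -> edge_continuous f a s t.
Proof. by move=> cf; split; exact: continuous_line_continuous. Qed.

Lemma rectintD f g a s t : edge_continuous f a s t -> edge_continuous g a s t ->
  rectint (fun z => f z + g z) a s t = rectint f a s t + rectint g a s t.
Proof. by move=> [? ? ? ?] [? ? ? ?]; rewrite /rectint !segintD //; ring. Qed.

Lemma rectintZ c f a s t : edge_continuous f a s t ->
  rectint (fun z => c * f z) a s t = c * rectint f a s t.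
Proof. by move=> [? ? ? ?]; rewrite /rectint !segintZ //; ring. Qed.

(** The edge integrals are explicit and cancel. This removes the first-order part of f in Goursat's
    estimate. *)
Lemma rectint_affine (c m a : C) s t : rectint (fun z => c + m * z) a s t = 0.
Proof.
rewrite /rectint !segint_affine !rmorphM /= !fmorphV /= ?rmorphXn /= ?rmorphM /=.
have i2 : ii * ii = -1 by apply: complexP; rewrite /=; ring.
have h2 : (2 : R)%:C = 2 by rewrite rmorph_nat.
set I := ii in i2 *; set S := s%:C; set T := t%:C; rewrite ?h2.
by field: i2.
Qed.

Lemma rectint_bound f a M s t : edge_continuous f a s t ->
  (forall x, `|x| <= `|s| -> normc (f (a + 1 * x%:C)) <= M) ->
  (forall y, `|y| <= `|t| -> normc (f (a + 1 * s%:C + ii * y%:C)) <= M) ->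
  (forall x, `|x| <= `|s| -> normc (f (a + ii * t%:C + 1 * x%:C)) <= M) ->
  (forall y, `|y| <= `|t| -> normc (f (a + ii * y%:C)) <= M) ->
  normc (rectint f a s t) <= 4 * M * (`|s| + `|t|).
Proof.
move=> [c1 c2 c3 c4] h1 h2 h3 h4.
have n1 : normc (1 : C) = 1 by exact: ComplexField.Normc.normc1.
have ni : normc ii = 1 by exact: normc_i.
rewrite /rectint.
apply: le_trans (normc_triangle _ _) _; rewrite normc_opp.
have b4 := segint_bound c4 ni h4.
have := normc_triangle (segint f a 1 s + segint f (a + 1 * s%:C) ii t) (- segint f (a + ii * t%:C) 1 s).
have := normc_triangle (segint f a 1 s) (segint f (a + 1 * s%:C) ii t).
rewrite normc_opp.
have b1 := segint_bound c1 n1 h1.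
have b2 := segint_bound c2 ni h2.
have b3 := segint_bound c3 n1 h3.
lra.
Qed.

Lemma rectint_split f a s s' t t' : continuous f ->
  rectint f a (s + s') (t + t') =
  rectint f a s t + rectint f (a + 1 * s%:C) s' t + rectint f (a + ii * t%:C) s t'
  + rectint f (a + 1 * s%:C + ii * t%:C) s' t'.
Proof.
move=> cf; have cl := fun a d => @continuous_line_continuous f a d cf.
rewrite /rectint !segint_add // !rmorphD /= !mulrDr !addrA.
rewrite ![a + ii * t%:C + 1 * s%:C]addrAC ![a + ii * t%:C + ii * t'%:C + 1 * s%:C]addrAC.
rewrite ![a + ii * t%:C + 1 * s%:C]addrAC ?[_ + ii * t%:C + 1 * s'%:C]addrAC.
ring.
Qed.

(** Anchoring the same rectangle at a neighbouring corner reverses its orientation. The two flips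
    allow any corner to be the base point, in particular the one where the integrand may fail to be
    differentiable. *)
Lemma rectint_flipx f a s t : continuous f ->
  rectint f a s t = - rectint f (a + 1 * s%:C) (- s) t.
Proof.
move=> cf; have cl := fun a d => @continuous_line_continuous f a d cf.
rewrite /rectint (segint_opp s (cl a 1)) [a + 1 * s%:C + ii * t%:C]addrAC (segint_opp s (cl _ 1)).
by rewrite rmorphN mulrN addrK; ring.
Qed.

Lemma rectint_flipy f a s t : continuous f ->
  rectint f a s t = - rectint f (a + ii * t%:C) s (- t).
Proof.
move=> cf; have cl := fun a d => @continuous_line_continuous f a d cf.
rewrite /rectint (segint_opp t (cl a ii)) [a + ii * t%:C + 1 * s%:C]addrAC (segint_opp t (cl _ ii)).
by rewrite rmorphN mulrN addrK; ring.
Qed.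

End Goursat.

(** * Cauchy's theorem and formula *)

Section Cauchy.
Variable R : realType.
Local Notation C := (Cplx R).
Local Notation Re := (@complex.Re R).
Local Notation Im := (@complex.Im R).
Local Notation normc := (@ComplexField.Normc.normc R).
Local Notation "x %:C" := (real_complex R x : Cplx R).
Local Notation ii := (Complex 0 1 : Cplx R).

Lemma half_power_lt (e : R) : 0 < e -> exists n, (2^-1) ^+ n < e :> R.
Proof.
move=> e0; exists (Num.bound e^-1).
rewrite exprVn invf_plt ?posrE ?exprn_gt0 //.
exact: (@upper_nthrootP R).
Qed.

Lemma nested_halves (u : nat -> R) :
  (forall n, u n <= u n.+1 /\ u n.+1 + (2^-1) ^+ n.+1 <= u n + (2^-1) ^+ n) ->
  exists x, forall n, u n <= x <= u n + (2^-1) ^+ n.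
Proof.
move=> hu.
have un n k : u n <= u (n + k)%N /\ u (n + k)%N + (2^-1) ^+ (n + k) <= u n + (2^-1) ^+ n.
  elim: k => [|k [h1 h2]]; first by rewrite addn0.
  have [h3 h4] := hu (n + k)%N.
  by rewrite addnS; split; [exact: le_trans h3|exact: le_trans h2].
have ub n m : u m <= u n + (2^-1) ^+ n.
  have p k : 0 <= (2^-1) ^+ k :> R by rewrite exprn_ge0.
  case: (leqP n m) => [/subnKC <-|/ltnW /subnKC <-].
    by have [_] := un n (m - n)%N; have := p (n + (m - n))%N; lra.
  by have [h _] := un m (n - m)%N; have := p (m + (n - m))%N; lra.
exists (sup (range u)) => n; apply/andP; split.
  apply: ub_le_sup; last by exists n.
  by exists (u 0%N + (2^-1) ^+ 0) => _ [m _ <-].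
apply: ge_sup; first by exists (u 0%N), 0%N.
by move=> _ [m _ <-].
Qed.

(** The bisection is done once for parameters in the unit square, (u, v) being a corner and d the
    side, so that rectangles of any shape and orientation are covered. *)
Lemma quartering (P : R -> R -> R -> Prop) : P 0 0 1 ->
  (forall u v d, 0 < d -> P u v d -> exists i j : bool,
     P (u + i%:R * (d / 2)) (v + j%:R * (d / 2)) (d / 2)) ->
  exists x y, [/\ 0 <= x <= 1, 0 <= y <= 1 &
    forall e, 0 < e -> exists u v d,
      [/\ 0 < d < e, P u v d, u <= x <= u + d & v <= y <= v + d]].
Proof.
move=> P0 Pstep.
have /choice[st hst] : forall q : R * R * R, exists ij : bool * bool,
    0 < q.2 -> P q.1.1 q.1.2 q.2 ->
    P (q.1.1 + ij.1%:R * (q.2 / 2)) (q.1.2 + ij.2%:R * (q.2 / 2)) (q.2 / 2).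
  move=> [[u v] d] /=.
  have [d0|] := boolP (0 < d); last by exists (false, false).
  have [p|] := pselect (P u v d); last by exists (false, false).
  by have [i [j h]] := Pstep _ _ _ d0 p; exists (i, j).
pose next (q : R * R * R) := (q.1.1 + (st q).1%:R * (q.2 / 2),
  q.1.2 + (st q).2%:R * (q.2 / 2), q.2 / 2).
pose q n := iter n next (0, 0, 1).
have qS n : q n.+1 = next (q n) by [].
have qd n : (q n).2 = (2^-1) ^+ n.
  by elim: n => [|n IH] //; rewrite qS /= IH exprSr.
have qpos n : 0 < (q n).2 by rewrite qd exprn_gt0.
have qP n : P (q n).1.1 (q n).1.2 (q n).2.
  by elim: n => [//|n IH]; rewrite qS; exact: hst.
have b01 (b : bool) (d : R) : 0 < d -> 0 <= b%:R * (d / 2) /\ b%:R * (d / 2) + d / 2 <= d.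
  by case: b => /= d0; rewrite ?mul1r ?mul0r; split; lra.
have [x hx] : exists x, forall n, (q n).1.1 <= x <= (q n).1.1 + (2^-1) ^+ n.
  apply: nested_halves => n; rewrite -!qd qS /=.
  by have [] := b01 (st (q n)).1 _ (qpos n); split; lra.
have [y hy] : exists y, forall n, (q n).1.2 <= y <= (q n).1.2 + (2^-1) ^+ n.
  apply: nested_halves => n; rewrite -!qd qS /=.
  by have [] := b01 (st (q n)).2 _ (qpos n); split; lra.
exists x, y; split.
- by have := hx 0%N; rewrite /= expr0 add0r.
- by have := hy 0%N; rewrite /= expr0 add0r.
move=> e /half_power_lt[n ne]; exists (q n).1.1, (q n).1.2, (q n).2.
by rewrite !qd; split=> //; [rewrite exprn_gt0|rewrite -qd; exact: qP].
Qed.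

Lemma rectint_mod_affine (f g : C -> C) (c m a : C) (s t : R) :
  (forall w : C, f w = g w + (c + m * w)) -> continuous g ->
  rectint f a s t = rectint g a s t.
Proof.
move=> fE cg.
have cm : continuous (fun w : C => c + m * w).
  move=> w; apply: continuous_addC; first exact: continuous_cstC.
  by apply: continuous_mulC; [exact: continuous_cstC|exact: cvg_id].
rewrite (_ : f = fun w : C => g w + (c + m * w)); last exact/funext.
have := @rectintD R g (fun w => c + m * w) a s t
  (continuous_edge_continuous _ _ _ cg) (continuous_edge_continuous _ _ _ cm).
by rewrite (rectint_affine c m) addr0.
Qed.

Lemma goursat (f : C -> C) (a : C) (s t : R) : continuous f ->
  (forall u v : R, 0 <= u <= 1 -> 0 <= v <= 1 ->
     derivable f (a + 1 * (s * u)%:C + ii * (t * v)%:C) 1) ->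
  rectint f a s t = 0.
Proof.
move=> cf df.
pose pt (u v : R) : C := a + 1 * (s * u)%:C + ii * (t * v)%:C.
pose J u v d := rectint f (pt u v) (s * d) (t * d).
(* Among the four quarters of a square of side d, at least one carries a quarter of the integral, in
   norm; the ratio to d^2 thus never decreases. *)
pose P u v d := normc (rectint f a s t) * d ^+ 2 <= normc (J u v d).
have Jsplit u v d : J u v d = J u v (d / 2) + J (u + d / 2) v (d / 2)
    + J u (v + d / 2) (d / 2) + J (u + d / 2) (v + d / 2) (d / 2).
  rewrite {1}/J.
  have -> : s * d = s * (d / 2) + s * (d / 2) by field.
  have -> : t * d = t * (d / 2) + t * (d / 2) by field.
  rewrite rectint_split // /J.
  have e1 : pt u v + 1 * (s * (d / 2))%:C = pt (u + d / 2) v.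
    by rewrite /pt mulrDr rmorphD /=; ring.
  have e2 u' : pt u' v + ii * (t * (d / 2))%:C = pt u' (v + d / 2).
    by rewrite /pt [t * (v + _)]mulrDr rmorphD /=; ring.
  by rewrite e1 !e2.
have [| |x [y [x01 y01 hxy]]] := @quartering P.
- by rewrite /P /J /pt expr1n !mulr1 !mulr0 !addr0.
- move=> u v d d0; rewrite /P Jsplit => h.
  set N := normc (rectint f a s t) in h *.
  have : exists i j : bool,
      N * (d / 2) ^+ 2 <= normc (J (u + i%:R * (d / 2)) (v + j%:R * (d / 2)) (d / 2)).
    have [h1|h1] := leP (N * (d / 2) ^+ 2) (normc (J u v (d / 2))).
      by exists false, false; rewrite !mul0r !addr0.
    have [h2|h2] := leP (N * (d / 2) ^+ 2) (normc (J (u + d / 2) v (d / 2))).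
      by exists true, false; rewrite !mul0r !addr0 mul1r.
    have [h3|h3] := leP (N * (d / 2) ^+ 2) (normc (J u (v + d / 2) (d / 2))).
      by exists false, true; rewrite !mul0r !addr0 mul1r.
    have [h4|h4] := leP (N * (d / 2) ^+ 2) (normc (J (u + d / 2) (v + d / 2) (d / 2))).
      by exists true, true; rewrite !mul1r.
    exfalso.
    have := normc_triangle (J u v (d / 2) + J (u + d / 2) v (d / 2)
      + J u (v + d / 2) (d / 2)) (J (u + d / 2) (v + d / 2) (d / 2)).
    have := normc_triangle (J u v (d / 2) + J (u + d / 2) v (d / 2)) (J u (v + d / 2) (d / 2)).
    have := normc_triangle (J u v (d / 2)) (J (u + d / 2) v (d / 2)).
    have e : N * d ^+ 2 = N * (d / 2) ^+ 2 * 4 by field.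
    lra.
  by [].
apply/eqP; rewrite -normc_eq0 eq_le normc_ge0 andbT.
have [L hL] := derivable_approx (df x y x01 y01).
pose z0 := pt x y; rewrite -/(pt x y) -/z0 in hL.
set D := `|s| + `|t|.
have D0 : 0 <= D by rewrite addr_ge0.
apply/ler_addgt0Pr => e e0; rewrite add0r.
(* On a piece of side d the remainder is at most e' * 2 d D, and [rectint_bound] multiplies this by
   4 d D: in all 8 e' D^2 d^2. Taking D + 1 avoids a division by zero. *)
pose e' := e / (8 * (D + 1) ^+ 2).
have e'0 : 0 < e' by rewrite divr_gt0 // mulr_gt0 // exprn_gt0 // ltr_wpDl.
have [r r0 hr] := hL e' e'0.
have [|u [v [d [/andP[d0 dr] Pd xu yv]]]] := hxy (r / (2 * (D + 1))).
  by rewrite divr_gt0 // mulr_gt0 // ltr_wpDl.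
have dD : 2 * (d * D) < r.
  apply: le_lt_trans (_ : d * (2 * (D + 1)) < r); last by rewrite -ltr_pdivlMr // mulr_gt0 // ltr_wpDl.
  nra.
pose g (w : C) : C := f w - (f z0 + L * (w - z0)).
have gE : forall w : C, f w = g w + ((f z0 - L * z0) + L * w) by move=> w; rewrite /g; ring.
have caff (c : C) : continuous (fun w : C => c + L * w).
  move=> w; apply: continuous_addC; first exact: continuous_cstC.
  by apply: continuous_mulC; [exact: continuous_cstC|exact: cvg_id].
have cg : continuous g.
  have -> : g = fun w : C => f w - ((f z0 - L * z0) + L * w).
    by apply/funext => w; rewrite gE addrK.
  by move=> w; apply: continuous_subC; [exact: cf|exact: caff].
have JE : J u v d = rectint g (pt u v) (s * d) (t * d).
  exact: rectint_mod_affine gE cg.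
have bg p q : `|p| <= `|s * d| -> `|q| <= `|t * d| ->
    normc (g (pt u v + 1 * p%:C + ii * q%:C)) <= e' * (2 * (d * D)).
  move=> hp hq.
  have hn : normc (pt u v + 1 * p%:C + ii * q%:C - z0) <= 2 * (d * D).
    have -> : pt u v + 1 * p%:C + ii * q%:C - z0
        = 1 * (s * (u - x) + p)%:C + ii * (t * (v - y) + q)%:C.
      by rewrite /z0 /pt !rmorphD /= !rmorphM /= !rmorphB /=; ring.
    apply: le_trans (normc_triangle _ _) _.
    rewrite !normc_mul normc_i ComplexField.Normc.normc1 !normc_real !mul1r.
    have a1 : `|s * (u - x) + p| <= 2 * (d * `|s|).
      apply: le_trans (ler_normD _ _) _; move: hp; rewrite !normrM (gtr0_norm d0).
      have : `|u - x| <= d by rewrite ler_norml; lra.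
      have := normr_ge0 s; nra.
    have a2 : `|t * (v - y) + q| <= 2 * (d * `|t|).
      apply: le_trans (ler_normD _ _) _; move: hq; rewrite !normrM (gtr0_norm d0).
      have : `|v - y| <= d by rewrite ler_norml; lra.
      have := normr_ge0 t; nra.
    rewrite /D; lra.
  apply: le_trans (hr _ _) _; first exact: le_lt_trans hn _.
  by rewrite ler_wpM2l // ltW.
have [n0s n0t] : `|0 : R| <= `|s * d| /\ `|0 : R| <= `|t * d| by rewrite normr0.
have rc0 : ii * (0 : R)%:C = 0 by rewrite rmorph0 mulr0.
have rc1 : 1 * (0 : R)%:C = 0 :> C by rewrite rmorph0 mulr0.
have hJ : normc (J u v d) <= 4 * (e' * (2 * (d * D))) * (`|s * d| + `|t * d|).
  rewrite JE; apply: rectint_bound.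
  - exact: continuous_edge_continuous.
  - by move=> p hp; have := bg p 0 hp n0t; rewrite rc0 addr0.
  - by move=> q hq; exact: bg.
  - by move=> p hp; rewrite addrAC; exact: bg.
  - by move=> q hq; have := bg 0 q n0s hq; rewrite rc1 addr0.
move: Pd; rewrite /P => /le_trans/(_ hJ).
rewrite !normrM (gtr0_norm d0) -mulrDl -/D => hfin.
have h1 : normc (rectint f a s t) * d ^+ 2 <= (8 * D ^+ 2 * e') * d ^+ 2.
  by apply: le_trans hfin _; rewrite le_eqVlt; apply/orP; left; apply/eqP; ring.
rewrite ler_pM2r ?exprn_gt0 // in h1.
apply: le_trans h1 _.
rewrite /e' mulrA ler_pdivrMr ?mulr_gt0 ?exprn_gt0 ?ltr_wpDl //.
rewrite mulrC ler_wpM2l ?(ltW e0) // ler_wpM2l // lerXn2r ?nnegrE //; lra.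
Qed.

End Cauchy.

Section CauchyFormula.
Variable R : realType.
Local Notation C := (Cplx R).
Local Notation Re := (@complex.Re R).
Local Notation Im := (@complex.Im R).
Local Notation normc := (@ComplexField.Normc.normc R).
Local Notation "x %:C" := (real_complex R x : Cplx R).
Local Notation ii := (Complex 0 1 : Cplx R).

Section DerivableOperations.
Variables (f g : C -> C) (z : C).
Hypotheses (df : derivable f z 1) (dg : derivable g z 1).

Lemma derivable_addC : derivable (fun z : C => f z + g z) z 1.
Proof. by have := derivableD df dg. Qed.
Lemma derivable_subC : derivable (fun z : C => f z - g z) z 1.
Proof. by have := derivableB df dg. Qed.
Lemma derivable_mulC : derivable (fun z : C => f z * g z) z 1.
Proof. by have := derivableM df dg. Qed.
Lemma derivable_invC : f z != 0 -> derivable (fun z : C => (f z)^-1) z 1.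
Proof. by move=> f0; have := derivableV f0 df. Qed.

End DerivableOperations.

Lemma derivable_cstC (c z : C) : derivable (fun=> c) z 1.
Proof. exact: derivable_cst. Qed.

Lemma continuous_normc_le (g : C -> C) (a : C) : continuous_at a g ->
  exists2 d : R, 0 < d & forall w : C, normc (w - a) < d -> normc (g w) <= normc (g a) + 1.
Proof.
move=> /continuousCP/(_ 1 ltr01)/nbhsCP[d d0 hd]; exists d => // w wa.
have := hd w; rewrite normc_dist => /(_ wa) h.
have := normc_triangle (g a) (g w - g a); rewrite subrKC.
by rewrite (normc_dist (g w)); lra.
Qed.

(** Three quarters of the rectangle avoid the corner a and contribute nothing, so the integral
    equals that over the quarter at a, and so on. As g is bounded near a, these integrals tend to 0
    with the perimeter. *)
Lemma goursat_corner (g : C -> C) (a : C) (s t : R) : continuous g ->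
  (forall u v : R, 0 <= u <= 1 -> 0 <= v <= 1 -> 0 < u \/ 0 < v ->
     derivable g (a + 1 * (s * u)%:C + ii * (t * v)%:C) 1) ->
  rectint g a s t = 0.
Proof.
move=> cg dg.
have shrink n : rectint g a s t = rectint g a (s * 2^-1 ^+ n) (t * 2^-1 ^+ n).
  elim: n => [|n ->]; first by rewrite !mulr1.
  set d := 2^-1 ^+ n.
  have d01 : 0 < d <= 1 by rewrite exprn_gt0 //= exprn_ile1 //; lra.
  have half r : r * d = r * (d / 2) + r * (d / 2) by field.
  have z1 (i j : bool) : i || j ->
      rectint g (a + 1 * (s * (i%:R * (d / 2)))%:C + ii * (t * (j%:R * (d / 2)))%:C)
        (s * (d / 2)) (t * (d / 2)) = 0.
    move=> ij; apply: goursat; first exact: cg.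
    move=> u v u01 v01.
    rewrite (_ : _ + ii * _ = a + 1 * (s * (d / 2 * (i%:R + u)))%:C
        + ii * (t * (d / 2 * (j%:R + v)))%:C); last first.
      by rewrite !mulrDr !rmorphD /= !rmorphM /=; ring.
    by apply: dg; move: ij; case: i; case: j => //= _; (try split); nra.
  rewrite exprSr -/d [X in rectint g a X]half [X in rectint g a _ X]half rectint_split //.
  have e10 : rectint g (a + 1 * (s * (d / 2))%:C) (s * (d / 2)) (t * (d / 2)) = 0.
    by have := z1 true false isT; rewrite /= !mul0r !mulr0 !mul1r !addr0.
  have e01 : rectint g (a + ii * (t * (d / 2))%:C) (s * (d / 2)) (t * (d / 2)) = 0.
    by have := z1 false true isT; rewrite /= !mul0r !mulr0 !mul1r !addr0.
  have e11 : rectint g (a + 1 * (s * (d / 2))%:C + ii * (t * (d / 2))%:C)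
      (s * (d / 2)) (t * (d / 2)) = 0.
    by have := z1 true true isT; rewrite /= !mul1r.
  rewrite e10 e01 e11.
  by rewrite !addr0.
apply/eqP; rewrite -normc_eq0 eq_le normc_ge0 andbT.
have [r r0 hr] := continuous_normc_le (cg a).
set M := normc (g a) + 1 in hr.
have M1 : 1 <= M by rewrite lerDr normc_ge0.
set D := `|s| + `|t|.
have D0 : 0 <= D by rewrite addr_ge0.
apply/ler_addgt0Pr => e e0; rewrite add0r.
have [|n hn] := @half_power_lt R (Num.min (r / (D + 1)) (e / (4 * M * (D + 1)))).
  by rewrite lt_min !divr_gt0 ?mulr_gt0 //; lra.
set d := 2^-1 ^+ n in hn; have d0 : 0 < d by rewrite exprn_gt0.
move: hn; rewrite lt_min !ltr_pdivlMr ?mulr_gt0 //; [|lra..]; move=> /andP[n1 n2].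
have bs : `|s * d| = `|s| * d by rewrite normrM (gtr0_norm d0).
have bt : `|t * d| = `|t| * d by rewrite normrM (gtr0_norm d0).
have ns := normr_ge0 s; have nt := normr_ge0 t.
have bg (p q : R) : `|p| <= `|s * d| -> `|q| <= `|t * d| ->
    normc (g (a + 1 * p%:C + ii * q%:C)) <= M.
  rewrite bs bt => hp hq; apply: hr.
  rewrite (_ : _ - a = 1 * p%:C + ii * q%:C); last by ring.
  apply: le_lt_trans (normc_triangle _ _) _.
  rewrite !normc_mul normc_i ComplexField.Normc.normc1 !normc_real !mul1r.
  by apply: le_lt_trans n1; rewrite /D; nra.
have [n0s n0t] : `|0 : R| <= `|s * d| /\ `|0 : R| <= `|t * d| by rewrite normr0.
have rc0 : ii * (0 : R)%:C = 0 by rewrite rmorph0 mulr0.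
have rc1 : 1 * (0 : R)%:C = 0 :> C by rewrite rmorph0 mulr0.
have hJ : normc (rectint g a s t) <= 4 * M * (`|s * d| + `|t * d|).
  rewrite (shrink n); apply: rectint_bound.
  - exact: continuous_edge_continuous.
  - by move=> p hp; have := bg p 0 hp n0t; rewrite rc0 addr0.
  - by move=> q hq; exact: bg.
  - by move=> p hp; rewrite addrAC; exact: bg.
  - by move=> q hq; have := bg 0 q n0s hq; rewrite rc1 addr0.
apply: le_trans hJ _; rewrite bs bt; apply/ltW; apply: le_lt_trans n2.
rewrite /D in D0 *; nra.
Qed.

Local Notation a0 := (Complex (-1) (-1) : C).

(** The counterclockwise integral around the square of vertices 1 + i, -1 + i, -1 - i, 1 - i. *)
Definition sqint (f : C -> C) : C := rectint f a0 2 2.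

(** The whole lines that carry the edges, since primitives along an edge are defined on all of R. *)
Definition onedge (z : C) := [\/ Re z = 1, Re z = -1, Im z = 1 | Im z = -1].

Lemma edge1 t : onedge (a0 + 1 * t%:C).
Proof. by apply: Or44; rewrite ImD mul1r /= addr0. Qed.
Lemma edge2 t : onedge (a0 + 1 * (2 : R)%:C + ii * t%:C).
Proof. by apply: Or41; rewrite !ReD mul1r ReM /=; ring. Qed.
Lemma edge3 t : onedge (a0 + ii * (2 : R)%:C + 1 * t%:C).
Proof. by apply: Or43; rewrite !ImD mul1r ImM /=; ring. Qed.
Lemma edge4 t : onedge (a0 + ii * t%:C).
Proof. by apply: Or42; rewrite !ReD ReM /=; ring. Qed.

Lemma sqint_ext (f g : C -> C) : (forall z, onedge z -> f z = g z) -> sqint f = sqint g.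
Proof.
move=> fg; rewrite /sqint /rectint /segint.
congr (_ + _ - _ - _); congr (_ * cprim _ _); apply/funext => t; apply: fg.
- exact: edge1.
- exact: edge2.
- exact: edge3.
- exact: edge4.
Qed.

Lemma edge_continuous_at (f : C -> C) : (forall z, onedge z -> continuous_at z f) -> edge_continuous f a0 2 2.
Proof.
have L a d t : continuous_at (a + d * t%:C) f ->
    continuous_at t (fun t : R => f (a + d * t%:C)).
  move=> cf; apply: (@continuous_comp _ _ _ (fun t : R => a + d * t%:C) f).
    exact: continuous_line.
  exact: cf.
by move=> cf; split=> t; apply: L; apply: cf;
  [exact: edge1|exact: edge2|exact: edge3|exact: edge4].
Qed.

Definition in_square (r : R) (z : C) := `|Re z| < r /\ `|Im z| < r.

Lemma onedge_neq z w : onedge z -> in_square 1 w -> z - w != 0.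
Proof.
move=> ez [rw iw]; rewrite subr_eq0; apply/eqP => zw; move: ez; rewrite zw.
move: rw iw; rewrite !ltr_norml => /andP[? ?] /andP[? ?].
by case; lra.
Qed.

Lemma derivableCP_near (f : C -> C) (z : C) (k : C -> C) :
  continuous_at z k -> (\forall w \near z, f w = f z + (w - z) * k w) ->
  is_derive z 1 f (k z).
Proof.
move=> kc kE.
have : (h^-1 *: (f (h *: 1 + z) - f z) : C) @[h --> 0^'] --> k z.
  apply/cvgCP => e e0; apply/nbhsCP.
  move: kc => /continuousCP/(_ e e0)/(filterI kE)/nbhsCP[d d0 hd].
  exists d => // h; rewrite sub0r normc_opp => hh h0.
  have [|h1 h2] := hd (h + z); first by rewrite opprD addrC subrK normc_opp.
  rewrite [X in f (X + z)]mulr1 h1 addrK addrAC subrr add0r.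
  by rewrite [X in k z - X](_ : _ = k (h + z)) // /GRing.scale /= mulKf.
move=> h; split; first by apply/cvg_ex; exists (k z).
exact: cvg_lim.
Qed.

(** The factor that is classically 2 pi i is kept as an integral depending on w; [kernel_neq0] will
    allow division by it. *)
Lemma cauchy_formula (f : C -> C) (w : C) : continuous f ->
  (forall z, in_square 2 z -> derivable f z 1) -> in_square 1 w ->
  sqint (fun z => f z * (z - w)^-1) = f w * sqint (fun z => (z - w)^-1).
Proof.
move=> cf df w1.
have w2 : in_square 2 w by case: w1 => h1 h2; split; lra.
have /derivableCP[k [kc kE]] := df w w2.
have kE' z : z != w -> k z = (f z - f w) * (z - w)^-1.
  by move=> zw; rewrite kE addrAC subrr add0r mulrC mulKf ?subr_eq0.
have knear z : z != w -> {near z, (fun z => (f z - f w) * (z - w)^-1) =1 k}.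
  move=> zw; have /nbhsCP : exists2 e : R, 0 < e & forall y, normc (z - y) < e -> y != w.
    exists (normc (z - w)); first by rewrite normc_gt0 // subr_eq0.
    by move=> y zy; apply/eqP => yw; move: zy; rewrite yw ltxx.
  by apply: filterS => y yw; rewrite kE'.
have dinv z : z != w -> derivable (fun z : C => (z - w)^-1) z 1.
  move=> zw; apply: (@derivable_invC (fun z => z - w)); last by rewrite subr_eq0.
  by apply: derivable_subC; [exact: derivable_id|exact: derivable_cstC].
have dk z : in_square 2 z -> z != w -> derivable k z 1.
  move=> z2 zw; apply: near_eq_derivable (knear z zw) _.
  apply: derivable_mulC; last exact: dinv.
  by apply: derivable_subC; [exact: df|exact: derivable_cstC].
have ck : continuous k.
  move=> z; have [->//|zw] := eqVneq z w.
  have /continuousCP h : continuous_at z (fun z => (f z - f w) * (z - w)^-1).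
    apply: continuous_mulC; last exact: derivable_continuous_at (dinv z zw).
    by apply: continuous_subC; [exact: cf|exact: continuous_cstC].
  apply/continuousCP => e e0; apply: filterS (filterI (knear z zw) (h e e0)) => y [<-].
  by rewrite -(nbhs_singleton (knear z zw)).
have e1 : edge_continuous (fun z => (z - w)^-1) a0 2 2.
  apply: edge_continuous_at => z ez; apply: derivable_continuous_at; apply: dinv.
  by rewrite -subr_eq0; exact: onedge_neq.
(* The horizontal and vertical lines through w cut the square into four rectangles with w as a
   common corner. The difference quotient k is continuous everywhere and differentiable inside off
   w, so [goursat_corner] applies to each. *)
have bk : sqint k = 0.
  case: w w1 w2 kc kE kE' knear dinv dk e1 => u v [/= u1 v1] w2 kc kE kE' knear dinv dk e1.
  move: u1 v1; rewrite !ltr_norml => /andP[u1 u2] /andP[v1 v2].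
  have corner s t : s \in [:: 1 - u; - (1 + u)] -> t \in [:: 1 - v; - (1 + v)] ->
      rectint k (Complex u v) s t = 0.
    rewrite !inE => hs ht; apply: goursat_corner; first exact: ck.
    move=> p q p01 q01 pq.
    have Ez : (Complex u v : C) + 1 * (s * p)%:C + ii * (t * q)%:C
        = Complex (u + s * p) (v + t * q).
      by apply: complexP; rewrite !(ReD, ImD, ReM, ImM) /=; ring.
    rewrite Ez; apply: dk.
      by split; rewrite /= ltr_norml; case/orP: hs => /eqP hs; case/orP: ht => /eqP ht;
        rewrite ?hs ?ht; nra.
    apply/eqP => -[/eqP]; rewrite -subr_eq0 addrAC subrr add0r mulf_eq0 => h1.
    move=> /eqP; rewrite -subr_eq0 addrAC subrr add0r mulf_eq0 => h2.
    have p0 : p = 0.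
      by case/orP: h1 => /eqP h1 //; case/orP: hs => /eqP hs; lra.
    have q0 : q = 0.
      by case/orP: h2 => /eqP h2 //; case/orP: ht => /eqP ht; lra.
    by move: pq; rewrite p0 q0; case; rewrite ltxx.
  have E1 : a0 + 1 * (1 + u)%:C + ii * (1 + v)%:C = Complex u v.
    by apply: complexP; rewrite !(ReD, ImD, ReM, ImM) /=; ring.
  rewrite /sqint (_ : (2 : R) = (1 + u) + (1 - u)); last by ring.
  rewrite [X in rectint _ _ _ X](_ : _ = (1 + v) + (1 - v)); last by ring.
  rewrite rectint_split // E1.
  rewrite [rectint k a0 _ _]rectint_flipx // [rectint k (a0 + _) _ _]rectint_flipy // [rectint k (a0 + 1 * _) _ _]rectint_flipy //.
  rewrite [rectint k (a0 + ii * _) _ _]rectint_flipx // [a0 + ii * _ + _]addrAC E1.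
  by rewrite !corner ?inE ?eqxx ?orbT // !oppr0 !addr0.
rewrite (sqint_ext (g := fun z => k z + f w * (z - w)^-1)); last first.
  move=> z ez; rewrite kE'; last by rewrite -subr_eq0; exact: onedge_neq.
  by rewrite -mulrDl subrK.
have e2 : edge_continuous (fun z => f w * (z - w)^-1) a0 2 2.
  apply: edge_continuous_at => z ez; apply: continuous_mulC; first exact: continuous_cstC.
  apply: derivable_continuous_at; apply: dinv.
  by rewrite -subr_eq0; exact: onedge_neq.
have := rectintD (continuous_edge_continuous _ _ _ ck) e2; rewrite -/(sqint k) bk add0r => h.
by rewrite {1}/sqint h (rectintZ (f w) e1).
Qed.

End CauchyFormula.

(** * The Cauchy kernel and divided differences *)

Section CauchyKernel.
Variable R : realType.
Local Notation C := (Cplx R).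
Local Notation Re := (@complex.Re R).
Local Notation Im := (@complex.Im R).
Local Notation normc := (@ComplexField.Normc.normc R).
Local Notation "x %:C" := (real_complex R x : Cplx R).
Local Notation ii := (Complex 0 1 : Cplx R).
Local Notation a0 := (Complex (-1) (-1) : C).

Lemma segint_Im_gt0 (c : C) (f : C -> C) (a d : C) (s : R) : 0 < s -> line_continuous f a d ->
  (forall t : R, 0 < Im (c * d * f (a + d * t%:C))) -> 0 < Im (c * segint f a d s).
Proof.
move=> s0 /cprimP hf h; rewrite /segint mulrA.
have [h0 dh] := is_primZ (c * d) hf.
have := @derive_gt0 R (fun t => Im (c * d * cprim (fun t => f (a + d * t%:C)) t))
  (fun t => Im (c * d * f (a + d * t%:C))) s s0 (fun t => (dh t).2) h.
by rewrite h0.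
Qed.

Lemma inv_ReIm (z : C) : z != 0 -> exists2 n : R, 0 < n &
  Re z^-1 = Re z * n /\ Im z^-1 = - Im z * n.
Proof.
case: z => x y z0; exists (x ^+ 2 + y ^+ 2)^-1; last first.
  by split=> //=; rewrite mulNr.
rewrite invr_gt0 lt_neqAle addr_ge0 ?sqr_ge0 // andbT eq_sym.
rewrite paddr_eq0 ?sqr_ge0 // !sqrf_eq0; apply: contraNN z0 => /andP[/eqP -> /eqP ->].
by [].
Qed.

(** The argument of z - w increases along each of the four edges: each contributes a positive
    imaginary part. *)
Lemma kernel_neq0 (w : C) : in_square 1 w -> sqint (fun z : C => (z - w)^-1) != 0.
Proof.
move=> w1; have [] := w1; rewrite !ltr_norml => /andP[w2 w3] /andP[w4 w5].
have [c1 c2 c3 c4] : edge_continuous (fun z : C => (z - w)^-1) a0 2 2.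
  apply: edge_continuous_at => z ez; apply: derivable_continuous_at.
  apply: (@derivable_invC R (fun z : C => z - w)); last exact: onedge_neq.
  by apply: derivable_subC; [exact: derivable_id|exact: derivable_cstC].
have i1 : 0 < Im (1 * segint (fun z : C => (z - w)^-1) a0 1 2).
  apply: segint_Im_gt0 => // t.
  have [n n0 [_ e]] := inv_ReIm (onedge_neq (edge1 t) w1).
  rewrite !mul1r in e *; rewrite e mulr_gt0 // !(ImD, ImN) /=; lra.
have i2 : 0 < Im (1 * segint (fun z : C => (z - w)^-1) (a0 + 1 * (2 : R)%:C) ii 2).
  apply: segint_Im_gt0 => // t.
  have [n n0 [e _]] := inv_ReIm (onedge_neq (edge2 t) w1).
  rewrite !mul1r in e *; rewrite ImM e /= mul0r add0r mul1r mulr_gt0 // !(ReD, ReN, ReM) /=; lra.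
have i3 : 0 < Im (- 1 * segint (fun z : C => (z - w)^-1) (a0 + ii * (2 : R)%:C) 1 2).
  apply: segint_Im_gt0 => // t.
  have [n n0 [_ e]] := inv_ReIm (onedge_neq (edge3 t) w1).
  rewrite mulr1 mulN1r !mul1r in e *; rewrite ImN e mulNr opprK mulr_gt0 // !(ImD, ImN, ImM) /=; lra.
have i4 : 0 < Im (- 1 * segint (fun z : C => (z - w)^-1) a0 ii 2).
  apply: segint_Im_gt0 => // t.
  have [n n0 [e _]] := inv_ReIm (onedge_neq (edge4 t) w1).
  rewrite -mulrA mulN1r ImN ImM e /= mul0r add0r mul1r -mulNr mulr_gt0 //.
  by rewrite !(ReD, ReN, ReM) /=; lra.
apply/eqP => b0; have : 0 < Im (sqint (fun z : C => (z - w)^-1)).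
  rewrite /sqint /rectint !ImD !ImN.
  by move: i1 i2 i3 i4; rewrite !mul1r !mulN1r !ImN; lra.
by rewrite b0 ltxx.
Qed.

(** The parameter runs over [-2, 2] instead of [0, 2] to match the symmetric bounds in
    [rectint_bound]. *)
Definition boundary_point (z : C) := exists2 t : R, `|t| <= 2 &
  [\/ z = a0 + 1 * t%:C, z = a0 + 1 * (2 : R)%:C + ii * t%:C,
      z = a0 + ii * (2 : R)%:C + 1 * t%:C | z = a0 + ii * t%:C].

Lemma boundary_point_onedge z : boundary_point z -> onedge z.
Proof.
by move=> [t _ []] ->; [exact: edge1|exact: edge2|exact: edge3|exact: edge4].
Qed.

Lemma line_bounded (f : C -> C) a d : line_continuous f a d ->
  exists B : R, forall t, `|t| <= 2 -> normc (f (a + d * t%:C)) <= B.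
Proof.
move=> cf.
have cn : {within `[-2, 2], continuous (fun t : R => normc (f (a + d * t%:C)))}.
  apply: continuous_subspaceT => t; apply/cvgrPdist_lt => e e0.
  have /continuousCP/(_ e e0) := cf t; apply: filterS => x; apply: le_lt_trans.
  set u := f _; set v := f _; rewrite ler_norml.
  have := normc_triangle u (v - u); have := normc_triangle v (u - v).
  by rewrite !subrKC (normc_dist v); lra.
have [|c _ hc] := @EVT_max R _ (-2) 2 _ cn; first by lra.
by exists (normc (f (a + d * c%:C))) => t; rewrite ler_norml => t2; apply: hc; rewrite in_itv.
Qed.

Lemma boundary_point_bounded (f : C -> C) : edge_continuous f a0 2 2 ->
  exists B : R, forall z, boundary_point z -> normc (f z) <= B.
Proof.
move=> [/line_bounded[B1 h1] /line_bounded[B2 h2] /line_bounded[B3 h3] /line_bounded[B4 h4]].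
exists (`|B1| + `|B2| + `|B3| + `|B4|) => z [t t2 []] ->;
  [have := h1 t t2|have := h2 t t2|have := h3 t t2|have := h4 t t2];
  have := normr_ge0 B1; have := normr_ge0 B2; have := normr_ge0 B3; have := normr_ge0 B4;
  have := ler_norm B1; have := ler_norm B2; have := ler_norm B3; have := ler_norm B4; lra.
Qed.

Lemma sqint_bound (f : C -> C) (B : R) : edge_continuous f a0 2 2 ->
  (forall z, boundary_point z -> normc (f z) <= B) -> normc (sqint f) <= 16 * B.
Proof.
move=> ef h; rewrite (_ : 16 * B = 4 * B * (`|2| + `|2|)); last first.
  by rewrite ger0_norm //; ring.
have n2 : `|2 : R| = 2 by rewrite ger0_norm.
by apply: rectint_bound => // t; rewrite n2 => t2; apply: h; exists t => //;
  [apply: Or41|apply: Or42|apply: Or43|apply: Or44].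
Qed.

(** For holomorphic f, this is 2 pi i times the divided difference of f at the points of [ws]; a
    repeated point stands for a derivative. *)
Definition cauchyint (f : C -> C) (ws : seq C) : C :=
  sqint (fun z : C => f z * \prod_(w <- ws) (z - w)^-1).

(** The smaller square stays at distance at least 1/2 from the four lines, which bounds each factor
    of the kernel by 2. *)
Definition all_in_square (ws : seq C) := forall w, w \in ws -> in_square (2^-1) w.

Lemma in_squareW (r r' : R) (z : C) : r <= r' -> in_square r z -> in_square r' z.
Proof. by move=> rr' [h1 h2]; split; exact: lt_le_trans rr'. Qed.

Lemma in_square_half (z : C) : in_square (2^-1) z -> in_square 1 z.
Proof. by apply: in_squareW; lra. Qed.

Lemma all_in_square_cons (w : C) (ws : seq C) : all_in_square (w :: ws) <-> in_square (2^-1) w /\ all_in_square ws.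
Proof.
split=> [h|[h1 h2] x]; last by rewrite inE => /orP[/eqP ->|/h2].
by split=> [|x xs]; apply: h; rewrite inE ?eqxx // xs orbT.
Qed.

Lemma prod_continuous (ws : seq C) (z : C) : onedge z -> all_in_square ws ->
  continuous_at z (fun z : C => \prod_(w <- ws) (z - w)^-1).
Proof.
move=> ez; elim: ws => [|w ws IH] h.
  by under eq_fun do rewrite big_nil; exact: continuous_cstC.
move: h => /all_in_square_cons[hw hws].
rewrite (_ : (fun y : C => _) = fun y : C => (y - w)^-1 * \prod_(v <- ws) (y - v)^-1); last first.
  by apply/funext => y; rewrite big_cons.
apply: (@continuous_mulC R C z (fun y => (y - w)^-1)); last exact: IH.
apply: derivable_continuous_at.
apply: (@derivable_invC R (fun z : C => z - w)); last exact: onedge_neq ez (in_square_half hw).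
by apply: derivable_subC; [exact: derivable_id|exact: derivable_cstC].
Qed.

Lemma cauchyint_edge_continuous (f : C -> C) (ws : seq C) : (forall z, onedge z -> continuous_at z f) -> all_in_square ws ->
  edge_continuous (fun z : C => f z * \prod_(w <- ws) (z - w)^-1) a0 2 2.
Proof.
move=> cf aws; apply: edge_continuous_at => z ez; apply: continuous_mulC; first exact: cf.
exact: prod_continuous.
Qed.

Lemma prod_bound (ws : seq C) (z : C) : onedge z -> all_in_square ws ->
  normc (\prod_(w <- ws) (z - w)^-1) <= 2 ^+ size ws.
Proof.
move=> ez; elim: ws => [|w ws IH] h.
  by rewrite big_nil expr0 ComplexField.Normc.normc1.
move: h => /all_in_square_cons[[hw1 hw2] hws]; rewrite big_cons normc_mul exprS.
apply: ler_pM; rewrite ?normc_ge0 //; last exact: IH.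
have h : 2^-1 <= normc (z - w).
  have := Re_le_normc (z - w); have := Im_le_normc (z - w).
  rewrite ReD ImD ReN ImN !ler_norml => /andP[? ?] /andP[? ?].
  by move: hw1 hw2; rewrite !ltr_norml => /andP[? ?] /andP[? ?]; case: ez => ez; lra.
have n0 : 0 < normc (z - w) by lra.
by rewrite normc_inv invf_ple ?posrE.
Qed.

Lemma cauchyint_bound (f : C -> C) n : (forall z, onedge z -> continuous_at z f) ->
  exists2 M : R, 0 < M & forall ws, size ws = n -> all_in_square ws -> normc (cauchyint f ws) <= M.
Proof.
move=> cf; have [B hB] := boundary_point_bounded (edge_continuous_at cf).
exists (16 * ((`|B| + 1) * 2 ^+ n)).
  by rewrite !mulr_gt0 ?exprn_gt0 // ltr_wpDl.
move=> ws <- aws; apply: sqint_bound; first exact: cauchyint_edge_continuous.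
move=> z bz; rewrite normc_mul; apply: ler_pM; rewrite ?normc_ge0 //.
  by have := hB z bz; have := ler_norm B; lra.
by apply: prod_bound => //; exact: boundary_point_onedge.
Qed.

(** The resolvent identity 1/(z - w) - 1/(z - w') = (w - w') / ((z - w)(z - w')). It turns
    differentiation under the integral sign into algebra together with the uniform bound
    [cauchyint_bound]. *)
Lemma cauchyint_diff (f : C -> C) (w w' : C) (ws : seq C) : (forall z, onedge z -> continuous_at z f) ->
  in_square (2^-1) w -> in_square (2^-1) w' -> all_in_square ws ->
  cauchyint f (w :: ws) - cauchyint f (w' :: ws) = (w - w') * cauchyint f (w :: w' :: ws).
Proof.
move=> cf hw hw' hws.
have ac v vs : in_square (2^-1) v -> all_in_square vs -> all_in_square (v :: vs) by move=> *; exact/all_in_square_cons.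
have e1 := cauchyint_edge_continuous cf (ac _ _ hw' hws).
have e2 := cauchyint_edge_continuous cf (ac _ _ hw (ac _ _ hw' hws)).
have e3 : edge_continuous (fun z : C => (w - w') * (f z * \prod_(v <- [:: w, w' & ws]) (z - v)^-1)) a0 2 2.
  apply: edge_continuous_at => z ez; apply: continuous_mulC; first exact: continuous_cstC.
  apply: continuous_mulC; first exact: cf.
  by apply: prod_continuous => //; apply: (ac) => //; apply: (ac).
have h (z : C) : onedge z -> f z * \prod_(v <- w :: ws) (z - v)^-1 =
    f z * \prod_(v <- w' :: ws) (z - v)^-1
    + (w - w') * (f z * \prod_(v <- [:: w, w' & ws]) (z - v)^-1).
  move=> ez; rewrite !big_cons.
  have := onedge_neq ez (in_square_half hw); have := onedge_neq ez (in_square_half hw').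
  by move=> h h'; field; rewrite h h'.
have := sqint_ext h; rewrite -/(cauchyint f (w :: ws)) => ->.
by rewrite /sqint (rectintD e1 e3) (rectintZ (w - w') e2) addrAC subrr add0r.
Qed.

Lemma cauchyint_swap (f : C -> C) (w w' : C) (ws : seq C) :
  cauchyint f [:: w, w' & ws] = cauchyint f [:: w', w & ws].
Proof. by congr sqint; apply/funext => z; rewrite !big_cons; ring. Qed.

Lemma cauchyint_rot (f : C -> C) (w w' w'' : C) : cauchyint f [:: w; w'; w''] = cauchyint f [:: w; w''; w'].
Proof. by congr sqint; apply/funext => z; rewrite !big_cons; ring. Qed.

Lemma in_square_open (r : R) (z : C) : in_square r z -> \forall w \near z, in_square r w.
Proof.
move=> [h1 h2]; apply/nbhsCP; exists (Num.min (r - `|Re z|) (r - `|Im z|)).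
  by rewrite lt_min !subr_gt0 h1.
move=> w; rewrite lt_min => /andP[w1 w2]; split.
  have := Re_le_normc (z - w); rewrite ReD ReN => h.
  have : `|Re w| <= `|Re z| + `|Re w - Re z| by rewrite -[X in `|X|](subrKC (Re z)) ler_normD.
  by rewrite (distrC (Re w)); lra.
have := Im_le_normc (z - w); rewrite ImD ImN => h.
have : `|Im w| <= `|Im z| + `|Im w - Im z| by rewrite -[X in `|X|](subrKC (Im z)) ler_normD.
by rewrite (distrC (Im w)); lra.
Qed.

Lemma lipschitz_continuous_at (k : C -> C) z (M : R) : 0 < M ->
  (\forall w \near z, normc (k z - k w) <= M * normc (z - w)) -> continuous_at z k.
Proof.
move=> M0 hk; apply/continuousCP => e e0.
have /(nbhs_ballC z) he : 0 < e / M by rewrite divr_gt0.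
apply: filterS (filterI hk he) => w [h1 h2]; apply: le_lt_trans h1 _.
by rewrite mulrC -ltr_pdivlMr.
Qed.

Lemma cauchyint_continuous (f : C -> C) (ws : seq C) (w' : C) : (forall z, onedge z -> continuous_at z f) ->
  all_in_square ws -> in_square (2^-1) w' -> continuous_at w' (fun w : C => cauchyint f (w :: ws)).
Proof.
move=> cf aws hw'.
have [M M0 hM] := cauchyint_bound (size ws).+2 cf.
apply: (lipschitz_continuous_at M0); apply: filterS (in_square_open hw') => w hw.
rewrite (cauchyint_diff cf) // normc_mul mulrC ler_wpM2r ?normc_ge0 // hM //.
by apply/all_in_square_cons; split => //; apply/all_in_square_cons.
Qed.

Lemma cauchyint_derivable (f : C -> C) (ws : seq C) (w' : C) : (forall z, onedge z -> continuous_at z f) ->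
  all_in_square ws -> in_square (2^-1) w' -> derivable (fun w : C => cauchyint f (w :: ws)) w' 1.
Proof.
move=> cf aws hw'.
have [] // := @derivableCP_near R (fun w : C => cauchyint f (w :: ws)) w' (fun w : C => cauchyint f (w :: w' :: ws)).
  by apply: cauchyint_continuous => //; apply/all_in_square_cons.
apply: filterS (in_square_open hw') => w hw.
by rewrite -cauchyint_diff // subrKC.
Qed.

(** The integral with a double point represents f', so this gives the differentiability of f'. The
    increment telescopes through the mixed pair w, w'. *)
Lemma cauchyint_derivable2 (f : C -> C) (w' : C) : (forall z, onedge z -> continuous_at z f) ->
  in_square (2^-1) w' -> derivable (fun w : C => cauchyint f [:: w; w]) w' 1.
Proof.
move=> cf hw'.
have a1 v : in_square (2^-1) v -> all_in_square [:: v] by move=> hv; apply/all_in_square_cons; split.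
have a2 v u : in_square (2^-1) v -> in_square (2^-1) u -> all_in_square [:: v; u].
  by move=> hv hu; apply/all_in_square_cons; split=> //; exact: a1.
have [] // := @derivableCP_near R (fun w : C => cauchyint f [:: w; w]) w'
    (fun w : C => cauchyint f [:: w; w; w'] + cauchyint f [:: w; w'; w']).
  apply: continuous_addC; last by apply: cauchyint_continuous => //; exact: a2.
  have [M M0 hM] := cauchyint_bound 4 cf.
  apply: (@lipschitz_continuous_at _ _ (M + M)); first by rewrite addr_gt0.
  apply: filterS (in_square_open hw') => w hw.
  have -> : cauchyint f [:: w'; w'; w'] - cauchyint f [:: w; w; w']
      = (w' - w) * (cauchyint f [:: w'; w; w'; w'] + cauchyint f [:: w'; w; w; w']).
    rewrite mulrDr -!cauchyint_diff //; try exact: a2.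
    by rewrite (cauchyint_swap f w w'); ring.
  rewrite normc_mul mulrC ler_wpM2r ?normc_ge0 //.
  apply: le_trans (normc_triangle _ _) _.
  by apply: lerD; apply: hM => //; do 2 (apply/all_in_square_cons; split => //); exact: a2.
apply: filterS (in_square_open hw') => w hw.
rewrite mulrDr cauchyint_rot -!cauchyint_diff //; try exact: a1.
rewrite (cauchyint_swap f w' w).
by ring.
Qed.

End CauchyKernel.

(** * Holomorphic functions on a disc: division, derivative, Lipschitz bound *)

Section LocalTheory.
Variable R : realType.
Local Notation C := (Cplx R).
Local Notation Re := (@complex.Re R).
Local Notation Im := (@complex.Im R).
Local Notation normc := (@ComplexField.Normc.normc R).
Local Notation "x %:C" := (real_complex R x : Cplx R).
Local Notation ii := (Complex 0 1 : Cplx R).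

Section UnitScale.
Variable f : C -> C.
Hypothesis cf : continuous f.
Hypothesis df : forall z : C, in_square 2 z -> derivable f z 1.

Let K (w : C) := cauchyint (fun=> 1) [:: w].

Let cf' (z : C) : onedge z -> continuous_at z f.
Proof. by move=> _; exact: cf. Qed.

Let c1 (z : C) : onedge z -> continuous_at z (fun=> 1 : C).
Proof. by move=> _; exact: continuous_cstC. Qed.

Let a1 (v : C) : in_square (2^-1) v -> all_in_square [:: v].
Proof. by move=> hv; apply/all_in_square_cons; split. Qed.

Let KE (w : C) : K w = sqint (fun z => (z - w)^-1).
Proof. by congr sqint; apply/funext => z; rewrite big_seq1 mul1r. Qed.

Let K0 (w : C) : in_square (2^-1) w -> K w != 0.
Proof. by move=> hw; rewrite KE kernel_neq0 //; exact: in_square_half. Qed.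

Let cauchy (w : C) : in_square (2^-1) w -> cauchyint f [:: w] = f w * K w.
Proof.
move=> hw; rewrite KE -cauchy_formula //; last exact: in_square_half.
by congr sqint; apply/funext => z; rewrite big_seq1.
Qed.

(** Since [K] is not known to be constant, its variation is subtracted: f(w) K(w) - f(w') K(w') -
    f(w') (K(w) - K(w')) equals (f(w) - f(w')) K(w). *)
Let incr (w w' : C) : in_square (2^-1) w -> in_square (2^-1) w' ->
  f w = f w' + (w - w') *
    ((cauchyint f [:: w; w'] - f w' * cauchyint (fun=> 1) [:: w; w']) * (K w)^-1).
Proof.
move=> hw hw'.
have an : all_in_square ([::] : seq C) by [].
have d1 := cauchyint_diff cf' hw hw' an; have d2 := cauchyint_diff c1 hw hw' an.
have E : (w - w') * (cauchyint f [:: w; w'] - f w' * cauchyint (fun=> 1) [:: w; w'])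
    = (f w - f w') * K w.
  rewrite mulrBr -d1 mulrCA -d2 !cauchy // -/(K w) -/(K w'); ring.
by rewrite mulrA E mulfK ?K0 // subrKC.
Qed.

Let dK (w : C) : in_square (2^-1) w -> derivable K w 1.
Proof. by move=> hw; apply: (@cauchyint_derivable R (fun=> 1) [::] w c1 _ hw). Qed.

Let insq0 : in_square (2^-1) (0 : C).
Proof. by split; rewrite /= normr0; lra. Qed.

Lemma unit_division : exists h : C -> C, forall w : C, in_square (2^-1) w ->
  derivable h w 1 /\ f w = f 0 + w * h w.
Proof.
exists (fun w => (cauchyint f [:: w; 0] - f 0 * cauchyint (fun=> 1) [:: w; 0]) * (K w)^-1).
move=> w hw; split; last by rewrite {1}(incr hw insq0) subr0.
apply: derivable_mulC; last by apply: derivable_invC; [exact: dK|exact: K0].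
apply: derivable_subC; first exact: (@cauchyint_derivable R f [:: 0] w cf' (a1 insq0) hw).
apply: derivable_mulC; first exact: derivable_cstC.
exact: (@cauchyint_derivable R (fun=> 1) [:: 0] w c1 (a1 insq0) hw).
Qed.

Lemma unit_derivative (w : C) : in_square (2^-1) w -> derivable (f^`())%classic w 1.
Proof.
pose G (w : C) := (cauchyint f [:: w; w] - f w * cauchyint (fun=> 1) [:: w; w]) * (K w)^-1.
have dG (v : C) : in_square (2^-1) v -> is_derive v 1 f (G v).
  move=> hv.
  pose k (w : C) := (cauchyint f [:: w; v] - f v * cauchyint (fun=> 1) [:: w; v]) * (K w)^-1.
  have ck : continuous_at v k.
    have h1 : continuous_at v (fun w => cauchyint f [:: w; v]).
      exact: (@cauchyint_continuous R f [:: v] v cf' (a1 hv) hv).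
    have h2 : continuous_at v (fun w => cauchyint (fun=> 1) [:: w; v]).
      exact: (@cauchyint_continuous R (fun=> 1) [:: v] v c1 (a1 hv) hv).
    have h3 : continuous_at v (fun w => (K w)^-1).
      by apply: continuous_invC; [exact: K0|exact: derivable_continuous_at (dK hv)].
    have h4 := continuous_mulC (@continuous_cstC R C v (f v)) h2.
    exact: (continuous_mulC (continuous_subC h1 h4) h3).
  rewrite -/(k v); apply: (derivableCP_near ck).
  by apply: filterS (in_square_open hv) => u hu; exact: incr.
move=> hw.
have : derivable G w 1.
  apply: derivable_mulC; last by apply: derivable_invC; [exact: dK|exact: K0].
  apply: derivable_subC; first exact: (cauchyint_derivable2 cf' hw).
  apply: derivable_mulC; last exact: (cauchyint_derivable2 c1 hw).
  by have [] := dG w hw.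
apply: near_eq_derivable; apply: filterS (in_square_open hw) => v hv.
by have [_ <-] := dG v hv; rewrite derive1E.
Qed.

Lemma unit_lipschitz : exists2 d : R, 0 < d & exists L : R, forall w w' : C,
  normc w < d -> normc w' < d -> normc (f w - f w') <= L * normc (w - w').
Proof.
have kK : 0 < normc (K 0) by rewrite normc_gt0 // K0.
have /continuousCP/(_ (normc (K 0) / 2)) := derivable_continuous_at (dK insq0).
rewrite divr_gt0 // => /(_ isT) nK.
have /continuousCP/(_ 1 ltr01) nf : continuous_at (0 : C) f by exact: cf.
have /nbhsCP[d d0 hd] : \forall w \near (0 : C), [/\ in_square (2^-1) w,
    normc (K 0 - K w) < normc (K 0) / 2 & normc (f 0 - f w) < 1].
  by apply: filterS (filterI (in_square_open insq0) (filterI nK nf)) => w [? []].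
have [M1 M10 h1] := cauchyint_bound 2 cf'; have [M2 M20 h2] := cauchyint_bound 2 c1.
exists d => //.
exists ((M1 + (normc (f 0) + 1) * M2) * (2 / normc (K 0))) => w w' wd wd'.
have [|hw hK _] := hd w; first by rewrite sub0r normc_opp.
have [|hw' _ hf] := hd w'; first by rewrite sub0r normc_opp.
rewrite (incr hw hw') addrAC subrr add0r !normc_mul mulrC ler_wpM2r ?normc_ge0 //.
have aw : all_in_square [:: w; w'] by apply/all_in_square_cons; split=> //; exact: a1.
apply: ler_pM; rewrite ?normc_ge0 //.
  apply: le_trans (normc_triangle _ _) _; rewrite normc_opp normc_mul.
  apply: lerD; first exact: h1.
  apply: ler_pM; rewrite ?normc_ge0 //; last exact: h2.
  have := normc_triangle (f 0) (f w' - f 0); rewrite subrKC (normc_dist (f w')); lra.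
rewrite normc_inv -[leRHS]invrK invf_div lef_pV2 ?posrE ?divr_gt0 ?normc_gt0 ?K0 //.
have := normc_triangle (K w) (K 0 - K w); rewrite subrKC; lra.
Qed.

End UnitScale.

Lemma derivable_caratheodory (f : C -> C) (z : C) : derivable f z 1 ->
  exists k : C -> C, [/\ continuous_at z k, k z = (f^`())%classic z &
    forall w : C, f w = f z + (w - z) * k w].
Proof.
move=> /derivableCP[k [kc kE]]; exists k; split=> //.
have kE' : \forall w \near z, f w = f z + (w - z) * k w by exact: (@filterE _ (nbhs z)).
by have [_ <-] := derivableCP_near kc kE'; rewrite derive1E.
Qed.

Lemma is_derive_comp_affine (f : C -> C) (m b z : C) : derivable f (m * z + b) 1 ->
  is_derive z 1 (fun z : C => f (m * z + b)) (m * (f^`())%classic (m * z + b)).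
Proof.
move=> /derivable_caratheodory[k [kc <- kE]].
apply: (@derivableCP_near R _ z (fun w => m * k (m * w + b))).
  apply: continuous_mulC; first exact: continuous_cstC.
  apply: (@continuous_comp _ _ _ (fun w : C => m * w + b) k); last exact: kc.
  apply: continuous_addC; last exact: continuous_cstC.
  by apply: continuous_mulC; [exact: continuous_cstC|exact: cvg_id].
by apply: (@filterE _ (nbhs z)) => w; rewrite kE; ring.
Qed.

(** Applied to both coordinates, this retracts the plane onto a closed square. Composing with it
    extends a function given on a disc to a continuous one on C, as integration along whole lines
    requires. *)
Definition clamp (x : R) : R := if x < -2 then -2 else if 2 < x then 2 else x.

Lemma clamp_cases (x : R) : [\/ x < -2 /\ clamp x = -2, 2 < x /\ clamp x = 2
  | -2 <= x <= 2 /\ clamp x = x].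
Proof.
rewrite /clamp; case: ltP => h1; first exact: Or31.
by case: ltP => h2; [exact: Or32|apply: Or33; split=> //; lra].
Qed.

Lemma clamp_lip (x y : R) : `|clamp x - clamp y| <= `|x - y|.
Proof.
have := ler_norm (x - y); have := ler_norm (- (x - y)); rewrite normrN ler_norml => ? ?.
by case: (clamp_cases x) => -[? ->]; case: (clamp_cases y) => -[? ->]; lra.
Qed.

Lemma clamp_id (x : R) : `|x| < 2 -> clamp x = x.
Proof. by rewrite ltr_norml => /andP[? ?]; case: (clamp_cases x) => -[? ->]; lra. Qed.

Lemma clamp_le (x : R) : `|clamp x| <= 2.
Proof. by rewrite ler_norml; case: (clamp_cases x) => -[? ->]; lra. Qed.

Definition cclamp (z : C) : C := Complex (clamp (Re z)) (clamp (Im z)).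

Lemma cclamp_continuous : continuous cclamp.
Proof.
move=> z; apply: (@lipschitz_continuous_at R cclamp z 2) => //.
apply: (@filterE _ (nbhs z)) => w; apply: le_trans (normc_le_ReIm _) _.
rewrite !(ReD, ImD, ReN, ImN) /=.
have := clamp_lip (Re z) (Re w); have := clamp_lip (Im z) (Im w).
have := Re_le_normc (z - w); have := Im_le_normc (z - w).
rewrite !(ReD, ImD, ReN, ImN); lra.
Qed.

Section Local.
Variables (f : C -> C) (z0 : C) (r : R).
Hypothesis r0 : 0 < r.
Hypothesis df : forall z : C, normc (z - z0) < r -> derivable f z 1.

(** The square of half-side 2 lies in the disc of radius 4, by |z| <= |Re z| + |Im z|, and 4 r / 5 <
    r. The inner half-side 1/2 then gives the radius r / 10 of the results. *)
Let c : C := (r / 5)%:C.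
Let c0 : c != 0.
Proof. by rewrite -normc_eq0 normc_real gt_eqF // normr_gt0 gt_eqF // divr_gt0. Qed.
Let nc : normc c = r / 5.
Proof. by rewrite normc_real gtr0_norm // divr_gt0. Qed.

Let F (w : C) := f (c * cclamp w + z0).

Let dF' (w : C) : derivable f (c * cclamp w + z0) 1.
Proof.
apply: df; rewrite addrK normc_mul nc.
have h1 : `|Re (cclamp w)| <= 2 by exact: clamp_le.
have h2 : `|Im (cclamp w)| <= 2 by exact: clamp_le.
have h4 : normc (cclamp w) <= 4 by have := normc_le_ReIm (cclamp w); lra.
have r5 : 0 <= r / 5 by rewrite divr_ge0 // ltW.
by have := ler_wpM2l r5 h4; have := r0; lra.
Qed.

Let cF : continuous F.
Proof.
move=> w; apply: (@continuous_comp _ _ _ (fun w : C => c * cclamp w + z0) f).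
  apply: continuous_addC; last exact: continuous_cstC.
  by apply: continuous_mulC; [exact: continuous_cstC|exact: cclamp_continuous].
by have := derivable_continuous_at (@dF' w).
Qed.

Let cclampE (w : C) : in_square 2 w -> cclamp w = w.
Proof. by move=> [h1 h2]; rewrite /cclamp !clamp_id //; case: w {h1 h2}. Qed.

Let FE (w : C) : in_square 2 w -> F w = f (c * w + z0).
Proof. by move=> hw; rewrite /F cclampE. Qed.

Let dF (w : C) : in_square 2 w -> derivable F w 1.
Proof.
move=> hw.
have dfw : derivable f (c * w + z0) 1 by have := @dF' w; rewrite cclampE.
have [d _] := is_derive_comp_affine dfw.
apply: near_eq_derivable d.
by apply: filterS (in_square_open hw) => v hv; rewrite FE.
Qed.

Let toF (z : C) : normc (z - z0) < r / 10 -> in_square (2^-1) (c^-1 * z - c^-1 * z0).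
Proof.
move=> h; rewrite -mulrBr.
have hn : normc (c^-1 * (z - z0)) < 2^-1.
  rewrite normc_mul normc_inv nc invf_div mulrC mulrA ltr_pdivrMr //.
  by apply: lt_le_trans (_ : r / 10 * 5 <= _); [rewrite ltr_pM2r|lra].
by split; apply: le_lt_trans hn; [exact: Re_le_normc|exact: Im_le_normc].
Qed.

Let fE (z : C) : normc (z - z0) < r / 10 -> f z = F (c^-1 * z - c^-1 * z0).
Proof.
move=> h; rewrite FE; last by apply: in_squareW (toF h); lra.
by rewrite mulrBr !mulVKf // subrK.
Qed.

Let FE0 : F 0 = f z0.
Proof. by rewrite FE ?mulr0 ?add0r //; split; rewrite /= normr0. Qed.

Let dballW (z : C) : normc (z - z0) < r / 10 -> \forall w \near z, normc (w - z0) < r / 10.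
Proof.
move=> h; apply/nbhsCP; exists (r / 10 - normc (z - z0)); first by rewrite subr_gt0.
move=> w; rewrite normc_dist ltrBrDr; apply: le_lt_trans.
by have := normc_triangle (w - z) (z - z0); rewrite addrA subrK.
Qed.

Lemma local_division : exists h : C -> C, forall z : C, normc (z - z0) < r / 10 ->
  derivable h z 1 /\ f z = f z0 + (z - z0) * h z.
Proof.
have [h hh] := unit_division cF dF.
exists (fun z => c^-1 * h (c^-1 * z - c^-1 * z0)) => z hz.
have [d E] := hh _ (toF hz); split; last by rewrite fE // E FE0; ring.
apply: derivable_mulC; first exact: derivable_cstC.
by have [] := is_derive_comp_affine d.
Qed.

Lemma local_derivative (z : C) : normc (z - z0) < r / 10 -> derivable (f^`())%classic z 1.
Proof.
move=> hz.
have dFz (v : C) : normc (v - z0) < r / 10 ->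
    (f^`())%classic v = c^-1 * (F^`())%classic (c^-1 * v - c^-1 * z0).
  move=> hv; have hv2 : in_square 2 (c^-1 * v - c^-1 * z0) by apply: in_squareW (toF hv); lra.
  have [_ <-] := is_derive_comp_affine (dF hv2).
  rewrite derive1E; apply: near_eq_derive.
  by apply: filterS (dballW hv) => u hu; rewrite fE.
have : derivable (fun v => c^-1 * (F^`())%classic (c^-1 * v - c^-1 * z0)) z 1.
  apply: derivable_mulC; first exact: derivable_cstC.
  by have [] := is_derive_comp_affine (unit_derivative cF dF (toF hz)).
apply: near_eq_derivable; apply: filterS (dballW hz) => u hu.
by rewrite dFz.
Qed.

Lemma local_lipschitz : exists2 d : R, 0 < d & exists L : R, forall w w' : C,
  normc (w - z0) < d -> normc (w' - z0) < d -> normc (f w - f w') <= L * normc (w - w').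
Proof.
have [d d0 [L hL]] := unit_lipschitz cF dF.
exists (Num.min (r / 10) (d * (r / 5))).
  by rewrite lt_min !mulr_gt0 ?divr_gt0 // ?mulr_gt0.
exists (L * (r / 5)^-1) => w w'; rewrite !lt_min => /andP[w1 w2] /andP[w1' w2'].
rewrite fE // [f w']fE //; apply: le_trans (hL _ _ _ _) _.
- by rewrite -mulrBr normc_mul normc_inv nc mulrC ltr_pdivrMr ?divr_gt0.
- by rewrite -mulrBr normc_mul normc_inv nc mulrC ltr_pdivrMr ?divr_gt0.
rewrite (_ : _ - _ - _ = c^-1 * (w - w')); last by ring.
by rewrite normc_mul normc_inv nc mulrA.
Qed.

End Local.
End LocalTheory.

(** * Holomorphic functions on a surface *)

Section SurfaceCalculus.
Variables (R : realType) (X : topologicalType) (S : compactRiemannSurface R X).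
Local Notation C := (Cplx R).
Local Notation normc := (@ComplexField.Normc.normc R).
Local Notation "x %:C" := (real_complex R x : Cplx R).
Local Notation hol := (holomorphic_at S).

Lemma near_dom a p : dom S a p -> \forall q \near p, dom S a q.
Proof. by move=> ap; apply: open_nbhs_nbhs; split=> //; exact: dom_open. Qed.

Lemma coord_continuous_at a p : dom S a p -> continuous_at p (coord S a).
Proof.
move=> ap; have := @coord_continuous R X S a.
by rewrite continuous_open_subspace; [apply; rewrite inE|exact: dom_open].
Qed.

Lemma near_image a p : dom S a p ->
  \forall z \near coord S a p, dom S a (param S a z) /\ coord S a (param S a z) = z.
Proof.
move=> ap; have : nbhs (coord S a p) (coord S a @` dom S a).
  by apply: open_nbhs_nbhs; split; [exact: coord_open|exists p].
by apply: filterS => z [q aq <-]; rewrite coordK.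
Qed.

Lemma param_continuous_at a p : dom S a p -> continuous_at (coord S a p) (param S a).
Proof.
move=> ap; have := @param_continuous R X S a.
rewrite continuous_open_subspace; last exact: coord_open.
by apply; rewrite inE; exists p.
Qed.

Lemma near_param a p (P : set X) : dom S a p -> (\forall q \near p, P q) ->
  \forall z \near coord S a p, P (param S a z).
Proof.
by move=> ap hP; have := param_continuous_at ap; rewrite /continuous_at coordK //; exact.
Qed.

Lemma near_coord a p (P : set C) : dom S a p -> (\forall z \near coord S a p, P z) ->
  \forall q \near p, P (coord S a q).
Proof. by move=> ap hP; have := coord_continuous_at ap; exact. Qed.

Lemma coord_inj a p q : dom S a p -> dom S a q -> coord S a p = coord S a q -> p = q.
Proof. by move=> ap aq e; rewrite -(coordK ap) -(coordK aq) e. Qed.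

(** Points of a surface are not isolated. Hence identities off p determine continuous functions at
    p, and orders are unique. *)
Lemma dnbhs_ex (p : X) (P : set X) : (\forall q \near p^', P q) -> exists2 q, q != p & P q.
Proof.
move=> hP; have [a ap] := dom_cover S p.
have hP' : \forall q \near p, q != p -> P q by [].
have /nbhsCP[e e0 he] : \forall z \near coord S a p,
    (param S a z != p -> P (param S a z)) /\
    (dom S a (param S a z) /\ coord S a (param S a z) = z).
  exact: filterI (near_param ap hP') (near_image ap).
have [|h1 [h2 h3]] := he (coord S a p + (e / 2)%:C).
  by rewrite opprD addrA subrr add0r normc_opp normc_real gtr0_norm; lra.
have pp : param S a (coord S a p + (e / 2)%:C) != p.
  apply/eqP => h; move: h3; rewrite h => /eqP; rewrite eq_sym addrC -subr_eq0 addrK.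
  by rewrite -normc_eq0 normc_real gt_eqF // gtr0_norm; lra.
by exists (param S a (coord S a p + (e / 2)%:C)) => //; exact: h1.
Qed.

Lemma near_neq (p q : X) : q != p -> \forall r \near q, r != p.
Proof.
move=> qp; have /accessible_closed_set1 := hausdorff_accessible (@surface_hausdorff R X S).
move=> /(_ p) cp; apply: open_nbhs_nbhs; split; last exact: qp.
have E : ~` [set p] = [set r | r != p] by apply/seteqP; split=> r /= /eqP.
by have := closed_openC cp; rewrite E.
Qed.

Lemma dnbhs_near (p : X) (P : set X) : (\forall q \near p^', P q) ->
  \forall q \near p^', \forall r \near q, P r.
Proof.
move=> hP; have : \forall q \near p, \forall r \near q, r != p -> P r.
  exact: near_join.
apply: filterS => q hq qp; apply: filterS (filterI hq (near_neq qp)) => r [h1 h2].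
exact: h1.
Qed.

Definition cdiff (f : X -> C) (p : X) := forall a, dom S a p ->
  derivable (f \o param S a) (coord S a p) 1.

(** One chart suffices, because k is a function on the surface: changing the chart only multiplies
    it by a continuous factor. *)
Lemma cdiffP a (f : X -> C) p : dom S a p ->
  cdiff f p <-> exists k : X -> C, continuous_at p k /\
    \forall q \near p, f q = f p + (coord S a q - coord S a p) * k q.
Proof.
move=> ap; split=> [/(_ a ap)/derivableCP[k [kc kE]]|[k [kc kE]] b bp].
  exists (k \o coord S a); split.
    by apply: continuous_comp; [exact: coord_continuous_at|exact: kc].
  apply: filterS (near_dom ap) => q aq.
  by have := kE (coord S a q); rewrite /= !coordK.
have /derivableCP[l [lcoord lE]] := @transition_holomorphic R X S b a p bp ap.
have ck : continuous_at (coord S b p) (fun w => l w * k (param S b w)).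
  apply: continuous_mulC; first exact: lcoord.
  apply: (@continuous_comp _ _ _ (param S b) k); first exact: param_continuous_at.
  by rewrite (coordK bp); exact: kc.
have [] // := @derivableCP_near R (f \o param S b) (coord S b p) _ ck.
apply: filterS (near_param bp kE) => w; rewrite /= coordK // => ->.
by have := lE w; rewrite /= coordK // => ->; ring.
Qed.

Lemma cdiff_continuous f p : cdiff f p -> continuous_at p f.
Proof.
have [a ap] := dom_cover S p; move=> /(cdiffP _ ap)[k [kc kE]].
have : continuous_at p (fun q => f p + (coord S a q - coord S a p) * k q).
  apply: continuous_addC; first exact: continuous_cstC.
  apply: continuous_mulC; last exact: kc.
  by apply: continuous_subC; [exact: coord_continuous_at|exact: continuous_cstC].
move=> /continuousCP h; apply/continuousCP => e e0.
apply: filterS (filterI kE (h e e0)) => q [<-].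
by rewrite subrr mul0r addr0.
Qed.

Lemma cdiff_eq f g p : (\forall q \near p, f q = g q) -> cdiff f p -> cdiff g p.
Proof.
move=> fg cf a ap; apply: near_eq_derivable (cf a ap).
exact: (near_param ap fg).
Qed.

Lemma hol_eq f g p : (\forall q \near p, f q = g q) -> hol f p -> hol g p.
Proof.
move=> /near_join fg hf; apply: filterS (filterI fg hf) => q [h1 h2].
exact: cdiff_eq h1 h2.
Qed.

Lemma hol_continuous f p : hol f p -> continuous_at p f.
Proof. by move=> /nbhs_singleton/cdiff_continuous. Qed.

Lemma hol_near f p : hol f p -> \forall q \near p, hol f q.
Proof. exact: near_join. Qed.

Lemma hol_cst (c : C) p : hol (fun=> c) p.
Proof.
apply: (@filterE _ (nbhs p)) => q a aq; exact: (@derivable_cstC R c (coord S a q)).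
Qed.

Lemma hol_add f g p : hol f p -> hol g p -> hol (fun q => f q + g q) p.
Proof.
move=> hf hg; apply: filterS (filterI hf hg) => q [h1 h2] a aq.
exact: (@derivable_addC R (f \o param S a) (g \o param S a) _ (h1 a aq) (h2 a aq)).
Qed.

Lemma hol_sub f g p : hol f p -> hol g p -> hol (fun q => f q - g q) p.
Proof.
move=> hf hg; apply: filterS (filterI hf hg) => q [h1 h2] a aq.
exact: (@derivable_subC R (f \o param S a) (g \o param S a) _ (h1 a aq) (h2 a aq)).
Qed.

Lemma hol_mul f g p : hol f p -> hol g p -> hol (fun q => f q * g q) p.
Proof.
move=> hf hg; apply: filterS (filterI hf hg) => q [h1 h2] a aq.
exact: (@derivable_mulC R (f \o param S a) (g \o param S a) _ (h1 a aq) (h2 a aq)).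
Qed.

Lemma continuous_neq0 (f : X -> C) p : continuous_at p f -> f p != 0 ->
  \forall q \near p, f q != 0.
Proof.
move=> /continuousCP cf f0; have /cf : 0 < normc (f p) by rewrite normc_gt0.
by apply: filterS => q; apply: contraTneq => ->; rewrite subr0 ltxx.
Qed.

Lemma hol_inv f p : hol f p -> f p != 0 -> hol (fun q => (f q)^-1) p.
Proof.
move=> hf f0; have fn := continuous_neq0 (hol_continuous hf) f0.
apply: filterS (filterI hf fn) => q [h1 h2] a aq.
by apply: (@derivable_invC R (f \o param S a) _ (h1 a aq)); rewrite /= coordK.
Qed.

Lemma hol_expn f p n : hol f p -> hol (fun q => f q ^+ n) p.
Proof.
move=> hf; elim: n => [|n IH]; first exact: hol_cst.
apply: hol_eq (hol_mul hf IH); apply: (@filterE _ (nbhs p)) => q.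
by rewrite exprS.
Qed.

Lemma hol_exprz f p (n : int) : hol f p -> f p != 0 -> hol (fun q => f q ^ n) p.
Proof.
move=> hf f0; case: n => n; first exact: hol_expn.
by apply: hol_inv; [exact: hol_expn|rewrite expf_neq0].
Qed.

Lemma hol_coord a p : dom S a p -> hol (coord S a) p.
Proof.
by move=> ap; apply: filterS (near_dom ap) => q aq b bq; exact: transition_holomorphic.
Qed.

Lemma hol_ball a f p : dom S a p -> hol f p ->
  exists2 r : R, 0 < r & forall z : C, normc (z - coord S a p) < r ->
    [/\ derivable (f \o param S a) z 1, dom S a (param S a z) &
        coord S a (param S a z) = z].
Proof.
move=> ap hf.
have /nbhsCP[r r0 hr] : \forall z \near coord S a p, cdiff f (param S a z) /\
    (dom S a (param S a z) /\ coord S a (param S a z) = z).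
  exact: filterI (near_param ap hf) (near_image ap).
exists r => // z zr; have [|h1 [h2 h3]] := hr z; first by rewrite normc_dist.
by split=> //; have := h1 a h2; rewrite h3.
Qed.

Lemma ball_hol a (phi : C -> C) p r : dom S a p -> 0 < r ->
  (forall z : C, normc (z - coord S a p) < r -> derivable phi z 1) ->
  hol (phi \o coord S a) p.
Proof.
move=> ap r0 dphi.
have nb : \forall z \near coord S a p, normc (z - coord S a p) < r.
  by apply: filterS (nbhs_ballC (coord S a p) r0) => z; rewrite normc_dist.
apply: filterS (filterI (near_dom ap) (near_coord ap nb)) => q [aq qr].
apply/(cdiffP _ aq).
have /derivableCP[k [kc kE]] := dphi _ qr.
exists (k \o coord S a); split.
  by apply: continuous_comp; [exact: coord_continuous_at|exact: kc].
by apply: (@filterE _ (nbhs q)) => s; rewrite /= kE.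
Qed.

(** This removable singularity statement takes the place of power series: iterated, it exhibits the
    order of a function. *)
Lemma hol_division a f p : dom S a p -> hol f p -> exists2 h : X -> C, hol h p &
  \forall q \near p, f q = f p + (coord S a q - coord S a p) * h q.
Proof.
move=> ap hf; have [r r0 hr] := hol_ball ap hf.
have [|h hh] := @local_division R (f \o param S a) (coord S a p) r r0.
  by move=> z /hr[].
have r10 : 0 < r / 10 by rewrite divr_gt0.
exists (h \o coord S a); first by apply: (ball_hol ap r10) => z /hh[].
have nb : \forall z \near coord S a p, normc (z - coord S a p) < r / 10.
  by apply: filterS (nbhs_ballC (coord S a p) r10) => z; rewrite normc_dist.
apply: filterS (filterI (near_dom ap) (near_coord ap nb)) => q [aq /hh[_]].
by rewrite /= !coordK.
Qed.

(** The coefficient df / dz_a of the differential of f. *)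
Definition dchart a (f : X -> C) (q : X) : C := (f \o param S a)^`()%classic (coord S a q).

Lemma hol_dchart a f p : dom S a p -> hol f p -> hol (dchart a f) p.
Proof.
move=> ap hf; have [r r0 hr] := hol_ball ap hf.
have r10 : 0 < r / 10 by rewrite divr_gt0.
apply: (ball_hol ap r10); apply: (local_derivative r0).
by move=> z /hr[].
Qed.

(** Both points vary, unlike in the definition of the derivative; this serves to compare two points
    of the same fibre near p. *)
Lemma hol_lipschitz a f p : dom S a p -> hol f p -> exists L : R,
  exists2 A : set X, nbhs p A & forall q r, A q -> A r ->
    normc (f q - f r) <= L * normc (coord S a q - coord S a r).
Proof.
move=> ap hf; have [r r0 hr] := hol_ball ap hf.
have [|d d0 [L hL]] := @local_lipschitz R (f \o param S a) (coord S a p) r r0.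
  by move=> z /hr[].
have nb : \forall z \near coord S a p, normc (z - coord S a p) < d.
  by apply: filterS (nbhs_ballC (coord S a p) d0) => z; rewrite normc_dist.
exists L; exists (fun q => dom S a q /\ normc (coord S a q - coord S a p) < d).
  exact: filterI (near_dom ap) (near_coord ap nb).
move=> q s [aq qd] [as' sd]; have := hL _ _ qd sd.
by rewrite /= !coordK.
Qed.

Lemma dchartP a f q (k : X -> C) : dom S a q -> continuous_at q k ->
  (\forall r \near q, f r = f q + (coord S a r - coord S a q) * k r) ->
  dchart a f q = k q.
Proof.
move=> aq kc kE.
have ck : continuous_at (coord S a q) (k \o param S a).
  by apply: continuous_comp; [exact: param_continuous_at|rewrite (coordK aq); exact: kc].
have E : \forall w \near coord S a q, (f \o param S a) w = (f \o param S a) (coord S a q)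
    + (w - coord S a q) * (k \o param S a) w.
  apply: filterS (filterI (near_param aq kE) (near_image aq)) => w [].
  by rewrite /= (coordK aq) => -> [_ ->].
have [_] := derivableCP_near ck E.
by rewrite /dchart derive1E /= (coordK aq).
Qed.

Lemma cdiff_caratheodory a f q : dom S a q -> cdiff f q ->
  exists k : X -> C, [/\ continuous_at q k, dchart a f q = k q &
    \forall r \near q, f r = f q + (coord S a r - coord S a q) * k r].
Proof.
move=> aq /(cdiffP _ aq)[k [kc kE]]; exists k; split=> //.
exact: dchartP.
Qed.

End SurfaceCalculus.

(** * Orders *)

Section Orders.
Variables (R : realType) (X : topologicalType) (S : compactRiemannSurface R X).
Local Notation C := (Cplx R).
Local Notation normc := (@ComplexField.Normc.normc R).
Local Notation hol := (holomorphic_at S).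
Local Notation ord := (has_order S).

Definition chart_at (p : X) : chart S := projT1 (cid (dom_cover S p)).

Lemma chart_atP p : dom S (chart_at p) p.
Proof. exact: (projT2 (cid (dom_cover S p))). Qed.

Definition lcoord (p q : X) : C := coord S (chart_at p) q - coord S (chart_at p) p.

Lemma lcoordE p q : lcoord p q = coord S (chart_at p) q - coord S (chart_at p) p.
Proof. by []. Qed.

Lemma hol_lcoord p : hol (lcoord p) p.
Proof. by apply: hol_sub; [exact: hol_coord (chart_atP p)|exact: hol_cst]. Qed.

Lemma lcoordpp p : lcoord p p = 0. Proof. exact: subrr. Qed.

Lemma near_dnbhs (p : X) (P : set X) : (\forall q \near p, P q) -> \forall q \near p^', P q.
Proof. exact: nbhs_dnbhs. Qed.

Lemma dnbhs_neq (p : X) : \forall q \near p^', q != p.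
Proof. exact: nbhs_dnbhs_neq. Qed.

Lemma coord_sub_neq0 a p : dom S a p ->
  \forall q \near p^', coord S a q - coord S a p != 0.
Proof.
move=> ap; apply: filterS (filterI (dnbhs_neq p) (near_dnbhs (near_dom ap))) => q [qp aq].
by rewrite subr_eq0; apply: contraNneq qp => e; apply/eqP; exact: coord_inj e.
Qed.

Lemma lcoord_neq0 p : \forall q \near p^', lcoord p q != 0.
Proof. exact: coord_sub_neq0 (chart_atP p). Qed.

Lemma continuous_dnbhs_eq0 (u : X -> C) p : continuous_at p u ->
  (\forall q \near p^', u q = 0) -> u p = 0.
Proof.
move=> cu u0; apply/eqP; apply: contraT => up.
have [q _ [h1 h2]] := dnbhs_ex S (filterI (near_dnbhs (continuous_neq0 cu up)) u0).
by move: h1; rewrite h2 eqxx.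
Qed.

Lemma continuous_dnbhs_eq (u v : X -> C) p : continuous_at p u -> continuous_at p v ->
  (\forall q \near p^', u q = v q) -> u p = v p.
Proof.
move=> cu cv uv; apply/eqP; rewrite -subr_eq0; apply/eqP.
apply: (@continuous_dnbhs_eq0 (fun q => u q - v q)); first exact: continuous_subC.
by apply: filterS uv => q ->; rewrite subrr.
Qed.

Lemma chart_change a b p : dom S a p -> dom S b p -> exists k : X -> C,
  [/\ hol k p, k p != 0 & \forall q \near p,
    coord S a q - coord S a p = (coord S b q - coord S b p) * k q].
Proof.
move=> ap bp.
have [k hk kE] := hol_division bp (hol_coord ap).
have [l hl lE] := hol_division ap (hol_coord bp).
have kE' : \forall q \near p, coord S a q - coord S a p = (coord S b q - coord S b p) * k q.
  by apply: filterS kE => q ->; rewrite addrAC subrr add0r.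
exists k; split=> //.
have : k p * l p = 1.
  apply: (@continuous_dnbhs_eq (fun q => k q * l q) (fun=> 1)).
  - exact: (hol_continuous (hol_mul hk hl)).
  - exact: (@continuous_cstC R X p 1).
  apply: filterS (filterI (coord_sub_neq0 ap) (near_dnbhs (filterI kE' lE))) => q [nz [e1 e2]].
  apply: (mulfI nz); rewrite mulr1 [RHS]e1 e2.
  by rewrite [X in _ = X * _]addrAC subrr add0r; ring.
by move=> e; apply/eqP => k0; move: e; rewrite k0 mul0r => /eqP; rewrite eq_sym oner_eq0.
Qed.

(** Order at least n, in a fixed chart. Unlike [has_order], it admits functions that vanish near p
    and is therefore stable under sums. *)
Definition ordge (f : X -> C) (p : X) (n : int) := exists2 h : X -> C, hol h p &
  \forall q \near p^', f q = lcoord p q ^ n * h q.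

Lemma ordP f p n : ord f p n <-> exists h : X -> C,
  [/\ hol h p, h p != 0 & \forall q \near p^', f q = lcoord p q ^ n * h q].
Proof.
split=> [/(_ _ (chart_atP p))//|[h [hh h0 hE]] a ap].
have [k [hk k0 kE]] := chart_change (chart_atP p) ap.
exists (fun q => k q ^ n * h q); split.
- exact: hol_mul (hol_exprz n hk k0) hh.
- by rewrite mulf_neq0 // expfz_neq0.
apply: filterS (filterI hE (near_dnbhs kE)) => q [-> e].
by rewrite /lcoord e expfzMl mulrA.
Qed.

Lemma ord_ordge f p n : ord f p n -> ordge f p n.
Proof. by move=> /ordP[h [? _ ?]]; exists h. Qed.

Lemma ordge_eq f g p n : (\forall q \near p^', f q = g q) -> ordge f p n -> ordge g p n.
Proof.
move=> fg [h hh hE]; exists h => //.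
by apply: filterS (filterI fg hE) => q [<-].
Qed.

Lemma ord_eq f g p n : (\forall q \near p^', f q = g q) -> ord f p n -> ord g p n.
Proof.
move=> fg /ordP[h [hh h0 hE]]; apply/ordP; exists h; split=> //.
by apply: filterS (filterI fg hE) => q [<-].
Qed.

Lemma ordge_le f p m n : m <= n -> ordge f p n -> ordge f p m.
Proof.
move=> mn [h hh hE]; exists (fun q => lcoord p q ^ (n - m) * h q).
  rewrite -subr_ge0 in mn; rewrite -(gez0_abs mn).
  exact: hol_mul (hol_expn _ (hol_lcoord p)) hh.
apply: filterS (filterI (lcoord_neq0 p) hE) => q [nz ->].
by rewrite mulrA -expfzDr // subrKC.
Qed.

Lemma ordge_step f p n : ordge f p n -> ord f p n \/ ordge f p (n + 1).
Proof.
move=> [h hh hE]; have [h0|h0] := eqVneq (h p) 0; last first.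
  by left; apply/ordP; exists h.
right; have [k hk kE] := hol_division (chart_atP p) hh; exists k => //.
apply: filterS (filterI (lcoord_neq0 p) (filterI hE (near_dnbhs kE))) => q [nz [-> ->]].
by rewrite h0 add0r -lcoordE expfzDr // expr1z mulrA.
Qed.

Lemma ordge_add f g p n : ordge f p n -> ordge g p n -> ordge (fun q => f q + g q) p n.
Proof.
move=> [h hh hE] [k hk kE]; exists (fun q => h q + k q); first exact: hol_add.
by apply: filterS (filterI hE kE) => q [-> ->]; rewrite mulrDr.
Qed.

Lemma ordge_sub f g p n : ordge f p n -> ordge g p n -> ordge (fun q => f q - g q) p n.
Proof.
move=> [h hh hE] [k hk kE]; exists (fun q => h q - k q); first exact: hol_sub.
by apply: filterS (filterI hE kE) => q [-> ->]; rewrite mulrBr.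
Qed.

Lemma ordge_mul f g p m n : ordge f p m -> ordge g p n ->
  ordge (fun q => f q * g q) p (m + n).
Proof.
move=> [h hh hE] [k hk kE]; exists (fun q => h q * k q); first exact: hol_mul.
apply: filterS (filterI (lcoord_neq0 p) (filterI hE kE)) => q [nz [-> ->]].
by rewrite expfzDr // mulrACA.
Qed.

Lemma hol_ordge f p : hol f p -> ordge f p 0.
Proof.
by move=> hf; exists f => //; apply: (@filterE _ p^') => q; rewrite expr0z mul1r.
Qed.

Lemma hol_ord f p : hol f p -> f p != 0 -> ord f p 0.
Proof.
move=> hf f0; apply/ordP; exists f; split=> //.
by apply: (@filterE _ p^') => q; rewrite expr0z mul1r.
Qed.

Lemma ord_mul f g p m n : ord f p m -> ord g p n -> ord (fun q => f q * g q) p (m + n).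
Proof.
move=> /ordP[h [hh h0 hE]] /ordP[k [hk k0 kE]]; apply/ordP.
exists (fun q => h q * k q); split; [exact: hol_mul hh hk|exact: mulf_neq0|].
apply: filterS (filterI (lcoord_neq0 p) (filterI hE kE)) => q [nz [-> ->]].
by rewrite expfzDr // mulrACA.
Qed.

Lemma ord_inv f p n : ord f p n -> ord (fun q => (f q)^-1) p (- n).
Proof.
move=> /ordP[h [hh h0 hE]]; apply/ordP; exists (fun q => (h q)^-1); split.
- exact: hol_inv hh h0.
- by rewrite invr_eq0.
by apply: filterS hE => q ->; rewrite invfM invr_expz.
Qed.

Lemma ord_expn f p n k : ord f p n -> ord (fun q => f q ^+ k) p (n *+ k).
Proof.
move=> hf; elim: k => [|k IH].
  by apply: hol_ord; [exact: hol_cst|rewrite oner_eq0].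
rewrite mulrS; apply: ord_eq (ord_mul hf IH).
by apply: (@filterE _ p^') => q; rewrite exprS.
Qed.

Lemma ord_neq0 f p n : ord f p n -> \forall q \near p^', f q != 0.
Proof.
move=> /ordP[h [hh h0 hE]].
have hn := near_dnbhs (continuous_neq0 (hol_continuous hh) h0).
apply: filterS (filterI (lcoord_neq0 p) (filterI hE hn)) => q [nz [-> hq]].
by rewrite mulf_neq0 // expfz_neq0.
Qed.

Lemma ordge_ord_le f p m n : ordge f p m -> ord f p n -> m <= n.
Proof.
move=> fm fn; rewrite leNgt; apply/negP => nm.
have nm' : n + 1 <= m by rewrite addrC lez1D.
have [k hk kE] := ordge_le nm' fm.
move: fn => /ordP[h [hh h0 hE]]; move/eqP: h0; apply.
have -> : 0 = lcoord p p * k p by rewrite lcoordpp mul0r.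
apply: (@continuous_dnbhs_eq h (fun q => lcoord p q * k q)).
- exact: hol_continuous hh.
- exact: hol_continuous (hol_mul (hol_lcoord p) hk).
apply: filterS (filterI (lcoord_neq0 p) (filterI hE kE)) => q [nz [-> e]].
by apply: (mulfI (expfz_neq0 n nz)); rewrite e expfzDr // expr1z mulrA.
Qed.

Lemma ord_uniq f p m n : ord f p m -> ord f p n -> m = n.
Proof.
move=> fm fn; apply/eqP; rewrite eq_le.
by rewrite (ordge_ord_le (ord_ordge fm) fn) (ordge_ord_le (ord_ordge fn) fm).
Qed.

(** The lower bound n excludes wild choices of sign in a square root of f^2. It is raised until it
    is attained, which must happen since 2 n never exceeds m. *)
Lemma ord_sqrt f p n m : ordge f p n -> ord (fun q => f q * f q) p m ->
  exists2 k, ord f p k & m = k + k.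
Proof.
move=> fn fm.
have [j] := ubnP (absz (m - (n + n))%R); elim: j n fn => // j IH n fn jn.
have [f_n|fn1] := ordge_step fn.
  by exists n => //; exact: ord_uniq fm (ord_mul f_n f_n).
apply: (IH _ fn1).
have le2 := ordge_ord_le (ordge_mul fn1 fn1) fm.
lia.
Qed.

Lemma is_derive_exprz (c z : C) (n : int) : z != c ->
  is_derive z 1 (fun w : C => (w - c) ^ n) (n%:~R * (z - c) ^ (n - 1)).
Proof.
move=> zc; have nz : z - c != 0 by rewrite subr_eq0.
have dn (k : nat) : is_derive z 1 (fun w : C => (w - c) ^+ k) (k%:R * (z - c) ^+ k.-1).
  elim: k => [|k IH].
    by rewrite mul0r; under eq_fun do rewrite expr0; exact: is_derive_cst.
  have d1 : is_derive z 1 (fun w : C => w - c) 1.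
    have := @is_deriveB _ _ _ (id : C -> C) (fun=> c) z 1 1 0 _ _.
    by rewrite subr0; apply.
  have h := @is_deriveM _ _ (fun w : C => w - c) (fun w : C => (w - c) ^+ k) z 1 _ _ d1 IH.
  rewrite (_ : (fun w : C => (w - c) ^+ k.+1) = (fun w : C => w - c) * (fun w : C => (w - c) ^+ k)); last first.
    by apply/funext => w; rewrite exprS.
  apply: (is_derive_eq h); rewrite /GRing.scale /=.
  case: k {IH h} => [|k]; first by rewrite mul0r mulr0 expr0; ring.
  by rewrite /= !exprS -[k.+2%:R]natr1; ring.
case: n => n.
  apply: (is_derive_eq (dn n)).
  case: n {dn} => [|n]; first by rewrite !mul0r.
  by rewrite intS addrAC subrr add0r.
rewrite NegzE; have [d e] := dn n.+1.
have h' : is_derive z 1 (fun w : C => ((w - c) ^+ n.+1)^-1)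
    (- ((z - c) ^+ n.+1) ^- 2 *: (n.+1%:R * (z - c) ^+ n)).
  have nzn := expf_neq0 n.+1 nz.
  split; first exact: derivableV d.
  by rewrite (@deriveV _ _ (fun w : C => (w - c) ^+ n.+1)) // e.
rewrite (_ : (fun w : C => (w - c) ^ (- n.+1%:Z)) = (fun y => ((y - c) ^+ n.+1)^-1)); last first.
  by apply/funext => w; rewrite -exprnN.
apply: (is_derive_eq h'); rewrite /GRing.scale /=.
rewrite (_ : - n.+1%:Z - 1 = - n.+2%:Z); last by lia.
rewrite -exprnN mulrNz -pmulrn !exprS.
by have wn : (z - c) ^+ n != 0 by [exact: expf_neq0]; field; rewrite nz wn.
Qed.

End Orders.

(** * Differentials in charts and pullbacks *)

Section Derivatives.
Variables (R : realType) (X : topologicalType) (S : compactRiemannSurface R X).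
Local Notation C := (Cplx R).
Local Notation normc := (@ComplexField.Normc.normc R).
Local Notation hol := (holomorphic_at S).
Local Notation ord := (has_order S).

Lemma dchart_eq a f g p : dom S a p -> (\forall q \near p, f q = g q) ->
  dchart a f p = dchart a g p.
Proof.
move=> ap fg; rewrite /dchart !derive1E; apply: near_eq_derive.
exact: (near_param ap fg).
Qed.

Lemma is_dchart a f p : dom S a p -> cdiff S f p ->
  is_derive (coord S a p) 1 (f \o param S a) (dchart a f p).
Proof. by move=> ap cf; rewrite /dchart derive1E; exact/derivableP/cf. Qed.

Lemma dchart_chain a b f p : dom S a p -> dom S b p -> cdiff S f p ->
  dchart a f p = (coord S b \o param S a)^`()%classic (coord S a p) * dchart b f p.
Proof.
move=> ap bp cf.
have [k [kc -> kE]] := cdiff_caratheodory bp cf.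
have [l [lc' lv lE]] := cdiff_caratheodory ap (nbhs_singleton (hol_coord bp)).
rewrite -/(dchart a (coord S b) p) lv.
have lkE : \forall q \near p, f q = f p + (coord S a q - coord S a p) * (l q * k q).
  apply: filterS (filterI kE lE) => q [-> ->].
  by rewrite addrAC subrr add0r mulrA.
exact: (dchartP ap (continuous_mulC lc' kc) lkE).
Qed.

(** For f = t^n h the derivative is t^(n-1) (n h + t h'), and n h does not vanish at p. *)
Lemma ord_dchart a f p n : dom S a p -> ord f p n -> n != 0 -> ord (dchart a f) p (n - 1).
Proof.
move=> ap fn n0; have [h [hh h0 hE]] := fn a ap.
pose t q := coord S a q - coord S a p.
have hdh := hol_dchart ap hh.
have ht : hol t p by apply: hol_sub; [exact: hol_coord ap|exact: hol_cst].
have hm : hol (fun q => n%:~R * h q + t q * dchart a h q) p.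
  apply: hol_add; last exact: hol_mul ht hdh.
  by apply: hol_mul hh; exact: hol_cst.
have m0 : n%:~R * h p + t p * dchart a h p != 0.
  by rewrite /t subrr mul0r addr0 mulf_neq0 // intr_eq0.
have tn : ord t p 1.
  have [k [hk k0 kE]] := chart_change ap (chart_atP S p).
  apply/ordP; exists k; split; [exact: hk|exact: k0|].
  by apply: filterS (near_dnbhs kE) => q; rewrite expr1z.
have tn1 : ord (fun q => t q ^ (n - 1)) p (n - 1).
  move: tn => /ordP[k [hk k0 kE]]; apply/ordP; exists (fun q => k q ^ (n - 1)); split.
  - exact: hol_exprz hk k0.
  - by rewrite expfz_neq0.
  by apply: filterS kE => q ->; rewrite expr1z expfzMl.
have := ord_mul tn1 (hol_ord hm m0); rewrite addr0; apply: ord_eq.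
have nr : \forall q \near p^', (\forall r \near q, f r = t r ^ n * h r) by exact: (dnbhs_near S hE).
apply: filterS (filterI nr (filterI (coord_sub_neq0 ap)
  (near_dnbhs (filterI (near_dom ap) (hol_near hh))))) => q [qE [tq [aq hq]]].
rewrite (dchart_eq aq qE); symmetry.
have nz : coord S a q != coord S a p by rewrite -subr_eq0.
have d1 := is_derive_exprz n nz.
have d2 := is_dchart aq (nbhs_singleton hq).
have [_ d3] := @is_deriveM _ _ (fun w : C => (w - coord S a p) ^ n) (h \o param S a) _ 1 _ _ d1 d2.
have -> : dchart a (fun r => t r ^ n * h r) q =
    'D_1 ((fun w : C => (w - coord S a p) ^ n) * (h \o param S a)) (coord S a q).
  rewrite /dchart derive1E; apply: near_eq_derive.
  by apply: filterS (near_image aq) => w [_ e]; rewrite /= /t e.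
rewrite d3 /GRing.scale /= (coordK aq) -/(t q).
have -> : t q ^ n = t q ^ (n - 1) * t q.
  by have := expfzDr (n - 1) 1 tq; rewrite subrK expr1z.
ring.
Qed.

Section Pullback.
Variable phi : X -> X.
Hypothesis phiP : forall p a b, dom S a p -> dom S b (phi p) -> exists k : X -> C,
  [/\ continuous_at p k, k p != 0 &
  \forall q \near p, coord S b (phi q) - coord S b (phi p)
    = (coord S a q - coord S a p) * k q].
Hypothesis phi_continuous : forall p, continuous_at p phi.

Lemma cdiff_comp f p : cdiff S f (phi p) -> cdiff S (f \o phi) p.
Proof.
have [a ap] := dom_cover S p; have [b bp] := dom_cover S (phi p).
have [l [lc' _ lE]] := phiP ap bp.
move=> /(cdiffP _ bp)[k [kc kE]]; apply/(cdiffP _ ap).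
have ck : continuous_at p (k \o phi).
  by apply: continuous_comp; [exact: phi_continuous|exact: kc].
exists (fun q => l q * k (phi q)); split; first exact: (continuous_mulC lc' ck).
have kE' : \forall q \near p, f (phi q) = f (phi p)
    + (coord S b (phi q) - coord S b (phi p)) * k (phi q).
  exact: (@phi_continuous p _ kE).
by apply: filterS (filterI kE' lE) => q [/= -> ->]; rewrite mulrA.
Qed.

Lemma hol_comp f p : hol f (phi p) -> hol (f \o phi) p.
Proof.
move=> hf; have hf' : \forall q \near p, cdiff S f (phi q).
  exact: (@phi_continuous p _ hf).
by apply: filterS hf' => q; exact: cdiff_comp.
Qed.

Lemma phi_dnbhs p (P : set X) : (\forall q \near (phi p)^', P q) ->
  \forall q \near p^', P (phi q).
Proof.
move=> hP; have [a ap] := dom_cover S p; have [b bp] := dom_cover S (phi p).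
have [k [kc k0 kE]] := phiP ap bp.
have hP' : \forall q \near p, phi q != phi p -> P (phi q).
  exact: (@phi_continuous p _ hP).
apply: filterS (filterI (coord_sub_neq0 ap) (near_dnbhs (filterI hP'
  (filterI kE (continuous_neq0 kc k0))))) => q [tq [/= h [e kq]]].
apply: h; apply/eqP => e'; move: e; rewrite e' subrr => /eqP.
by rewrite eq_sym mulf_eq0 (negPf tq) (negPf kq).
Qed.

(** The factor k in [phiP] is only continuous. Dividing the pulled back coordinate by the coordinate
    gives a holomorphic factor, which takes the same non-zero value at p by continuity. *)
Lemma lcoord_comp p : exists l : X -> C, [/\ hol l p, l p != 0 &
  \forall q \near p, lcoord S (phi p) (phi q) = lcoord S p q * l q].
Proof.
have bp := chart_atP S (phi p).
have [l hl lE] := hol_division (chart_atP S p) (hol_comp (hol_coord bp)).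
have [k [kc k0 kE]] := phiP (chart_atP S p) bp.
have lk : l p = k p.
  apply: (continuous_dnbhs_eq S (hol_continuous hl) kc).
  apply: filterS (filterI (lcoord_neq0 S p) (near_dnbhs (filterI lE kE))) => q [nz [/= e1 e2]].
  by apply: (mulfI nz); rewrite lcoordE -e2 e1 addrAC subrr add0r.
exists l; split; [exact: hl|by rewrite lk|].
by apply: filterS lE => q /= e; rewrite !lcoordE e addrAC subrr add0r.
Qed.

Lemma ordge_comp f p n : ordge S f (phi p) n -> ordge S (f \o phi) p n.
Proof.
move=> [h hh hE]; have [l [hl l0 lE]] := lcoord_comp p.
exists (fun q => l q ^ n * h (phi q)).
  exact: hol_mul (hol_exprz n hl l0) (hol_comp hh).
apply: filterS (filterI (phi_dnbhs hE) (near_dnbhs lE)) => q [/= -> ->].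
by rewrite expfzMl mulrA.
Qed.

Lemma ord_comp f p n : ord f (phi p) n -> ord (f \o phi) p n.
Proof.
move=> /ordP[h [hh h0 hE]]; have [l [hl l0 lE]] := lcoord_comp p.
apply/ordP; exists (fun q => l q ^ n * h (phi q)); split.
- exact: hol_mul (hol_exprz n hl l0) (hol_comp hh).
- by rewrite mulf_neq0 // expfz_neq0.
apply: filterS (filterI (phi_dnbhs hE) (near_dnbhs lE)) => q [/= -> ->].
by rewrite expfzMl mulrA.
Qed.

End Pullback.
End Derivatives.

(** * The hyperelliptic involution *)

Section HyperellipticInvolution.
Variables (R : realType) (X : topologicalType) (S : compactRiemannSurface R X).
Local Notation C := (Cplx R).
Local Notation normc := (@ComplexField.Normc.normc R).
Local Notation hol := (holomorphic_at S).
Local Notation ord := (has_order S).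

Variables (inv : X -> X) (F : X -> one_point_compactification C).
Hypothesis hF : holomorphic_to_P1 S F.
Hypothesis hfib : forall p, fibre_divisor S F (F p)
  (fun r => point_divisor p r + point_divisor (inv p) r)%N.

Let G (c : one_point_compactification C) (q : X) : C := P1_coord c (F q).

(** The multiplicity of F at p: 2 at the Weierstrass points and 1 elsewhere. *)
Definition ramification (p : X) : int := ((inv p == p)%:Z + 1).
Local Notation ramif := ramification.

Lemma P1_coord_self (c : one_point_compactification C) : P1_coord c c = 0.
Proof. by case: c => //= c; rewrite subrr. Qed.

Lemma G_hol p : hol (G (F p)) p.
Proof. by have [_] := hF; exact. Qed.

Lemma G_ord p : ord (G (F p)) p (ramif p).
Proof.
have [h _] := hfib p p; have := h erefl.
by rewrite /point_divisor eqxx /ramification eq_sym PoszD addrC.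
Qed.

Arguments G_ord : clear implicits.

Lemma F_inv p : F (inv p) = F p.
Proof.
apply/eqP; apply: contraT => /eqP h; have [_ /(_ h)] := hfib p (inv p).
by rewrite /point_divisor eqxx addn1.
Qed.

Lemma F_fibre p q : F q = F p -> q = p \/ q = inv p.
Proof.
move=> qp; have [/(_ qp) h _] := hfib p q.
have [->|nqp] := eqVneq q p; first by left.
have [->|nqi] := eqVneq q (inv p); first by right.
move: h; rewrite /point_divisor (negPf nqp) (negPf nqi).
move=> /ordP[h [hh h0 hE]].
have : h q = G (F q) q.
  apply: (continuous_dnbhs_eq S (hol_continuous hh) (hol_continuous (G_hol q))).
  by apply: filterS hE => r; rewrite expr0z mul1r => <-.
by rewrite /G P1_coord_self => e; move: h0; rewrite e eqxx.
Qed.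

(** If inv(inv p) = inv p, the fibre through inv p has multiplicity 2 there; the divisor p + inv p
    of the same fibre then forces p = inv p. *)
Lemma invK : involutive inv.
Proof.
move=> p; have Fii : F (inv (inv p)) = F p by rewrite !F_inv.
have [//|e] := F_fibre Fii.
have [h1 _] := hfib (inv p) (inv p); have [h2 _] := hfib p (inv p).
have := ord_uniq (h1 erefl) (h2 (F_inv p)).
rewrite /point_divisor e !eqxx; case: eqP => [ip _|//].
by rewrite ip.
Qed.

Lemma ramif_inv p : ramif (inv p) = ramif p.
Proof. by rewrite /ramification invK eq_sym. Qed.

(* Any coordinate of the projective line centred at [F p0] can be used at the
   points close to [p0]. *)
Lemma G_ord_near p0 : \forall p \near p0,
  hol (G (F p0)) p /\ ord (fun r => G (F p0) r - G (F p0) p) p (ramif p).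
Proof.
have nz : \forall p \near p0^', G (F p0) p != 0 := ord_neq0 (G_ord p0).
have : \forall p \near p0, p != p0 -> G (F p0) p != 0 /\
    (\forall r \near p, G (F p0) r != 0).
  exact: (filterI nz (dnbhs_near S nz)).
move=> h; apply: filterS (filterI h (hol_near (G_hol p0))) => p [hp gp]; split=> //.
have [->|pp0] := eqVneq p p0.
  apply: ord_eq (G_ord p0); apply: (@filterE _ p0^') => r.
  by rewrite /G P1_coord_self subr0.
have [gp0 gr] := hp pp0.
move: gp gp0 gr (G_ord p); rewrite /G.
case: (F p0) => [c|]; case: (F p) => [w|] /= gp gp0 gr op.
- apply: ord_eq op; apply: near_dnbhs; apply: filterS gr => r /=.
  by case: (F r) => [v|] //=; [move=> _; ring|rewrite eqxx].
- by rewrite eqxx in gp0.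
- have o2 : ord (fun r => - (P1_coord None (F r) * w^-1)) p 0.
    apply: hol_ord.
      apply: hol_eq (hol_sub (hol_cst S 0 p) (hol_mul gp (hol_cst S w^-1 p))).
      by apply: (@filterE _ (nbhs p)) => r; rewrite sub0r.
    rewrite oppr_eq0 mulf_neq0 //.
    by have := nbhs_singleton gr.
  have := ord_mul op o2; rewrite addr0; apply: ord_eq.
  apply: near_dnbhs; apply: filterS gr => r /=.
  case: (F r) => [v|] //=; last by rewrite eqxx.
  rewrite !invr_eq0 => v0; have w0 : w != 0 by rewrite -invr_eq0.
  by field; rewrite v0 w0.
- by rewrite eqxx in gp0.
Qed.

Lemma F_near_Some p c : F p = Some c -> forall e : R, 0 < e ->
  \forall q \near p, exists2 w, F q = Some w & normc (w - c) < e.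
Proof.
move=> Fp e e0; have [cF _] := hF.
have nb : nbhs (F p) (Some @` [set w : C | normc (w - c) < e]).
  rewrite Fp; apply: one_point_compactification_some_nbhs.
  by apply: filterS (nbhs_ballC c e0) => w; rewrite normc_dist.
have h : \forall q \near p, (Some @` [set w : C | normc (w - c) < e]) (F q).
  exact: (cF p _ nb).
by apply: filterS h => q [w we <-]; exists w.
Qed.

Lemma F_near_None p : F p = None -> forall M : R, 0 < M ->
  \forall q \near p, forall w, F q = Some w -> M < normc w.
Proof.
move=> Fp M M0.
have M'0 : 0 < M^-1 by rewrite invr_gt0.
have /continuousCP/(_ _ M'0) := hol_continuous (G_hol p).
have nz : \forall q \near p, q != p -> G (F p) q != 0 := ord_neq0 (G_ord p).
move=> h; apply: filterS (filterI nz h) => q [].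
rewrite /G Fp => hq; rewrite /= sub0r normc_opp => hM w Fq.
have qp : q != p by apply/eqP => qp; move: Fq; rewrite qp Fp.
have := hq qp; rewrite Fq /= in hM *; rewrite invr_eq0 => w0.
by move: hM; rewrite normc_inv ltf_pV2 ?posrE ?normc_gt0.
Qed.

Lemma F_separated p q : F p <> F q ->
  \forall q' \near q & p' \near p, F p' <> F q'.
Proof.
have SN p1 q1 c : F p1 = Some c -> F q1 = None ->
    exists2 A : set X, nbhs p1 A & exists2 B : set X, nbhs q1 B &
      forall p' q', A p' -> B q' -> F p' <> F q'.
  move=> Fp Fq; have M0 : 0 < normc c + 1 by rewrite ltr_wpDl // normc_ge0.
  eexists; first exact: (F_near_Some Fp ltr01).
  eexists; first exact: (F_near_None Fq M0).
  move=> p' q' /= [w -> wc] h e; have := h _ (esym e).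
  have := normc_triangle c (w - c); rewrite subrKC; lra.
suff : F p <> F q -> exists2 A : set X, nbhs p A & exists2 B : set X, nbhs q B &
      forall p' q', A p' -> B q' -> F p' <> F q'.
  move=> h /h[A pA [B qB AB]]; exists (B, A) => //= -[q' p'] [/= h1 h2].
  exact: AB.
case Fp: (F p) => [c|]; case Fq: (F q) => [d|] // cd.
- have cd0 : c - d != 0 by rewrite subr_eq0; apply: contra_notN cd => /eqP ->.
  have e0 : 0 < normc (c - d) / 2 by rewrite divr_gt0 // normc_gt0.
  eexists; first exact: (F_near_Some Fp e0).
  eexists; first exact: (F_near_Some Fq e0).
  move=> p' q' /= [w -> wc] [v -> vd] [wv].
  rewrite wv (normc_dist v c) in wc.
  have := normc_triangle (c - v) (v - d); rewrite addrA subrK; lra.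
- exact: SN Fp Fq.
have [A pA [B qB AB]] := SN _ _ _ Fq Fp.
by exists B => //; exists A => // p' q' Bp Aq e; exact: (AB _ _ Aq Bp (esym e)).
Qed.

(** Outside the interiors of U and V lies a compact set on which F avoids F(p). By compactness it
    also avoids F(q) for q near p, whereas F(inv q) = F(q). *)
Lemma inv_near_fibre p (U V : set X) : nbhs p U -> nbhs (inv p) V ->
  \forall q \near p, U (inv q) \/ V (inv q).
Proof.
move=> pU pV.
pose K := ~` (U^° `|` V^°).
have cK : compact K.
  apply: (@subclosed_compact _ K setT) => //; last exact: surface_compact S.
  by apply: open_closedC; apply: openU; exact: open_interior.
have sep : forall x, K x -> \forall x' \near x & i \near p, F i <> F x'.
  move=> x Kx; apply: F_separated => e; apply: Kx.
  by have [->|->] := F_fibre (esym e); [left; exact: pU|right; exact: pV].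
move: cK => /compact_near_coveringP /(_ _ (nbhs p) (fun i x => F i <> F x) _ sep).
apply: filterS => q hq; apply: contrapT => /not_orP[h1 h2].
apply: (hq (inv q)); last by rewrite F_inv.
by move=> [/interior_subset|/interior_subset].
Qed.

(** Weierstrass points are zeros of the differential of [G (F p0)], and this differential has a
    finite order at p0. *)
Lemma near_unramified p0 : \forall p \near p0^', inv p <> p.
Proof.
have ap := chart_atP S p0; set a := chart_at S p0 in ap.
have r0 : ramif p0 != 0 by rewrite /ramification; lia.
have nz := ord_neq0 (ord_dchart ap (G_ord p0) r0).
apply: filterS (filterI nz (near_dnbhs (filterI (near_dom ap) (G_ord_near p0)))).
move=> p [dp [ap' [hp op]]] ip.
have r2 : ramif p = 2 by rewrite /ramification ip eqxx.
have r20 : ramif p != 0 by rewrite r2.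
have := ord_dchart ap' op r20; rewrite r2.
have hd := hol_dchart ap' (hol_sub hp (hol_cst S (G (F p0) p) p)).
have d0 : dchart a (fun r => G (F p0) r - G (F p0) p) p != 0.
  have [k [kc kp kE]] := cdiff_caratheodory ap' (nbhs_singleton hp).
  have -> : dchart a (fun r => G (F p0) r - G (F p0) p) p = k p; last by rewrite -kp.
  by apply: (dchartP ap' kc); apply: filterS kE => r ->; rewrite subrr add0r addrAC subrr add0r.
by move=> /(ord_uniq (hol_ord hd d0)).
Qed.

(** With G = t h and h(p0) non-zero, G(p) = G(q) gives (t(p) - t(q)) h(p) = - t(q) (h(p) - h(q)). By
    the Lipschitz bound, the right-hand side is too small near p0 unless t(p) = t(q). *)
Lemma G_injective_near p0 : inv p0 <> p0 -> exists2 A : set X, nbhs p0 A &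
  forall p q, A p -> A q -> G (F p0) p = G (F p0) q -> p = q.
Proof.
move=> ip0; have ap := chart_atP S p0; set a := chart_at S p0 in ap.
have [h [hh h0 hE]] := G_ord p0 a ap.
have hE' : \forall p \near p0, G (F p0) p = (coord S a p - coord S a p0) * h p.
  have hE0 : \forall p \near p0, p != p0 ->
      G (F p0) p = (coord S a p - coord S a p0) ^ ramif p0 * h p by exact: hE.
  apply: filterS hE0 => p; have [->|pp0 /(_ isT) ->] := eqVneq p p0.
    by rewrite subrr mul0r /G P1_coord_self.
  by rewrite /ramification; case: eqP => // _; rewrite add0r expr1z.
have [L [B pB hL]] := hol_lipschitz ap hh.
have nh0 : 0 < normc (h p0) by rewrite normc_gt0.
have e0 : 0 < normc (h p0) / 2 by rewrite divr_gt0.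
have /continuousCP/(_ _ e0) ch := hol_continuous hh.
have /continuousCP/(_ (normc (h p0) / (2 * (`|L| + 1)))) := coord_continuous_at ap.
rewrite divr_gt0 ?mulr_gt0 ?ltr_wpDl // => /(_ isT) cc.
exists [set p | [/\ G (F p0) p = (coord S a p - coord S a p0) * h p, B p,
  dom S a p, normc (h p0 - h p) < normc (h p0) / 2 &
  normc (coord S a p0 - coord S a p) < normc (h p0) / (2 * (`|L| + 1))]].
  apply: filterS (filterI hE' (filterI pB (filterI (near_dom ap) (filterI ch cc)))).
  by move=> p [? [? [? []]]].
move=> p q [gp Bp dp hp tp] [gq Bq dq hq tq]; rewrite gp gq => e.
apply: (coord_inj dp dq); apply/eqP; rewrite -subr_eq0 -normc_eq0.
have E : (coord S a p - coord S a q) * h p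
    = (coord S a p0 - coord S a q) * (h p - h q).
  have -> : (coord S a p0 - coord S a q) * (h p - h q) =
    (coord S a q - coord S a p0) * h q - (coord S a q - coord S a p0) * h p by ring.
  by rewrite -e; ring.
have n1 : normc (coord S a p - coord S a q) * normc (h p)
    <= normc (coord S a p0 - coord S a q) * (`|L| * normc (coord S a p - coord S a q)).
  rewrite -normc_mul E normc_mul ler_wpM2l ?normc_ge0 //.
  apply: le_trans (hL _ _ Bp Bq) _; rewrite ler_wpM2r ?normc_ge0 //.
  exact: ler_norm.
have n2 : normc (h p0) / 2 < normc (h p).
  have := normc_triangle (h p) (h p0 - h p); rewrite subrKC; lra.
have n3 : normc (coord S a p0 - coord S a q) * `|L| <= normc (h p0) / 2.
  move: tq; rewrite ltr_pdivlMr ?mulr_gt0 ?ltr_wpDl //.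
  have := normc_ge0 (coord S a p0 - coord S a q); have := normr_ge0 L; nra.
rewrite eq_le normc_ge0 andbT leNgt; apply/negP => d0.
have : normc (coord S a p - coord S a q) * normc (h p) <=
   normc (coord S a p - coord S a q) * (normc (h p0) / 2).
  apply: le_trans n1 _; rewrite [leLHS]mulrA [leLHS]mulrC.
  by rewrite (ler_pM2l d0).
by rewrite ler_pM2l // leNgt n2.
Qed.

(** Away from the Weierstrass points, inv q is near p or near inv p. The first is impossible: [G]
    would take the same value at the points q and inv q near p, so that they coincide. *)
Lemma inv_continuous p : continuous_at p inv.
Proof.
move=> V pV.
have [ip|ip] := eqVneq (inv p) p.
  have pV' : nbhs p V by rewrite -ip.
  by apply: filterS (inv_near_fibre pV' pV) => q [].
have [A pA hA] := G_injective_near (elimN eqP ip).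
apply: filterS (filterI pA (filterI (inv_near_fibre pA pV) (near_unramified p))).
move=> q [Aq [[Aiq|//] uq]]; exfalso.
have e : inv q = q by apply: hA => //; rewrite /G F_inv.
have [qp|qp] := eqVneq q p; last exact: (uq qp e).
by move: ip; rewrite -qp e eqxx.
Qed.

Lemma inv_near p (P : set X) : nbhs (inv p) P -> \forall q \near p, P (inv q).
Proof. by move=> hP; exact: (@inv_continuous p _ hP). Qed.

Lemma G_expand p a : dom S a p -> exists h : X -> C, [/\ hol h p, h p != 0 &
  \forall q \near p, G (F p) q = (coord S a q - coord S a p) ^ ramif p * h q].
Proof.
move=> ap; have [h [hh h0 hE]] := G_ord p a ap; exists h; split=> [|//|]; first exact: hh.
have hE0 : \forall q \near p, q != p ->
    G (F p) q = (coord S a q - coord S a p) ^ ramif p * h q by exact: hE.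
apply: filterS hE0 => q; have [->|qp /(_ isT)//] := eqVneq q p.
have r0 : ramif p != 0 by rewrite /ramification; lia.
by rewrite subrr /G P1_coord_self exp0rz (negPf r0) mul0r.
Qed.

Lemma G_expand_inv p b : dom S b (inv p) -> exists h : X -> C,
  [/\ continuous_at p (h \o inv), h (inv p) != 0 & \forall q \near p,
   G (F p) q = (coord S b (inv q) - coord S b (inv p)) ^ ramif p * h (inv q)].
Proof.
move=> bp; have [h [hh h0 hE]] := G_expand bp; exists h; split=> [|//|].
  by apply: continuous_comp; [exact: inv_continuous|exact: hol_continuous hh].
apply: filterS (inv_near hE) => q.
by rewrite /G !F_inv ramif_inv.
Qed.

(** Invariance of t^2 h leaves t o inv asymptotic to t or to - t. Nearby points are not fixed, and
    this selects the second; the resulting value -1 is the source of u = -1. *)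
Lemma inv_chart_ramified p a : inv p = p -> dom S a p -> exists k : X -> C,
  [/\ continuous_at p k, k p = -1 & \forall q \near p,
    coord S a (inv q) - coord S a (inv p) = (coord S a q - coord S a p) * k q].
Proof.
move=> ip ap; pose t q := coord S a q - coord S a p.
have r2 : ramif p = 2 by rewrite /ramification ip eqxx.
have [h [hh h0 hE]] := G_expand ap; rewrite r2 in hE.
have hEi := inv_near (_ : nbhs (inv p) _); rewrite ip in hEi.
have {}hEi : \forall q \near p, t q ^+ 2 * h q = t (inv q) ^+ 2 * h (inv q).
  apply: filterS (filterI hE (hEi _ hE)) => q [e1 e2].
  by rewrite [LHS](esym e1) [RHS](esym e2) /G F_inv.
have ci : continuous_at p inv by exact: inv_continuous.
have [L [B pB hL]] := hol_lipschitz ap hh.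
have iB := inv_near (_ : nbhs (inv p) B); rewrite ip in iB; have {}iB := iB pB.
have idom := inv_near (_ : nbhs (inv p) (dom S a)); rewrite ip in idom.
have {}idom := idom (near_dom ap).
have nh0 : 0 < normc (h p) by rewrite normc_gt0.
have e0 : 0 < normc (h p) / 2 by rewrite divr_gt0.
have /continuousCP/(_ _ e0) ch := hol_continuous hh.
have ich := inv_near (_ : nbhs (inv p) (fun q => normc (h p - h q) < normc (h p) / 2)).
rewrite ip in ich; have {}ich := ich ch.
(* [(t - t')(t + t') h = t'^2 (h' - h)], where [t'] and [h'] are the pullbacks
   of [t] and [h]; as [t <> t'] and [h] is Lipschitz, [t + t' = O(t'^2)]. *)
have key : \forall q \near p, q != p ->
    normc ((t q)^-1 * t (inv q) + 1) <= 3 * `|L| / (normc (h p) / 2) * normc (t q).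
  have un : \forall q \near p, q != p -> inv q <> q by exact: near_unramified.
  apply: filterS (filterI un (filterI (filterI hEi (filterI pB iB))
    (filterI (filterI (near_dom ap) idom) (filterI ch ich)))).
  move=> q [uq [[e [Bq Biq]] [[aq aiq] [hq hiq]]]] qp.
  have tq : t q != 0.
    by rewrite subr_eq0; apply: contra_neq qp => e'; exact: (coord_inj aq ap e').
  have tti : t q - t (inv q) != 0.
    rewrite /t opprB addrA subrK subr_eq0; apply/eqP => e'.
    exact: (uq qp (esym (coord_inj aq aiq e'))).
  have n2 : normc (h p) / 2 < normc (h q).
    by have := normc_triangle (h q) (h p - h q); rewrite subrKC; lra.
  have n2i : normc (h p) / 2 < normc (h (inv q)).
    by have := normc_triangle (h (inv q)) (h p - h (inv q)); rewrite subrKC; lra.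
  have n3 : normc (h q) < 3 * (normc (h p) / 2).
    by have := normc_triangle (h p) (h q - h p); rewrite subrKC (normc_dist (h q)); lra.
  have E1 : (t q - t (inv q)) * ((t q + t (inv q)) * h q)
      = t (inv q) ^+ 2 * (h (inv q) - h q) by rewrite mulrBr -e; ring.
  set T := normc (t q); set T' := normc (t (inv q)).
  have T0 : 0 < T by rewrite normc_gt0.
  have N1 : normc (t q + t (inv q)) * normc (h q) <= T' ^+ 2 * `|L|.
    have d0 : 0 < normc (t q - t (inv q)) by rewrite normc_gt0.
    rewrite -(ler_pM2l d0) -!normc_mul E1 normc_mul.
    have -> : normc (t (inv q) ^+ 2) = T' ^+ 2 by rewrite !expr2 normc_mul.
    rewrite mulrCA; apply: ler_wpM2l; first by rewrite sqr_ge0.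
    apply: le_trans (hL _ _ Biq Bq) _.
    rewrite mulrC (normc_dist (coord S a (inv q))).
    rewrite (_ : t q - t (inv q) = coord S a q - coord S a (inv q)); last by rewrite /t; ring.
    by apply: ler_wpM2l; [exact: normc_ge0|exact: ler_norm].
  (* |h| lies between 1/2 and 3/2 of |h(p)| at q and at inv q, whence the ratio 3. *)
  have N2 : T' ^+ 2 <= 3 * T ^+ 2.
    have := congr1 normc e; rewrite !expr2 !normc_mul -/T -/T' => e'.
    have : T' * T' * (normc (h p) / 2) <= 3 * (T * T) * (normc (h p) / 2).
      have : T' * T' * (normc (h p) / 2) <= T' * T' * normc (h (inv q)).
        by apply: ler_wpM2l; [rewrite mulr_ge0 ?normc_ge0|exact: ltW].
      rewrite -e'.
      have : T * T * normc (h q) <= T * T * (3 * (normc (h p) / 2)).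
        by apply: ler_wpM2l; [rewrite mulr_ge0 ?normc_ge0|exact: ltW].
      lra.
    by rewrite ler_pM2r.
  have -> : (t q)^-1 * t (inv q) + 1 = (t q)^-1 * (t q + t (inv q)) by field.
  rewrite normc_mul normc_inv -/T mulrC ler_pdivrMr // mulrAC -mulrA mulrAC.
  rewrite ler_pdivlMr //.
  have : normc (t q + t (inv q)) * (normc (h p) / 2)
      <= normc (t q + t (inv q)) * normc (h q).
    by apply: ler_wpM2l; [exact: normc_ge0|exact: ltW].
  have : T' ^+ 2 * `|L| <= 3 * T ^+ 2 * `|L| by apply: ler_wpM2r.
  lra.
pose k q := if q == p then -1 else (t q)^-1 * t (inv q).
have kp : k p = -1 by rewrite /k eqxx.
have ht : hol t p by apply: hol_sub; [exact: hol_coord ap|exact: hol_cst].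
exists k; split=> [|//|].
  apply/continuousCP => e e1.
  pose M := 3 * `|L| / (normc (h p) / 2).
  have M0 : 0 <= M by rewrite divr_ge0 ?mulr_ge0 // ltW.
  have e2 : 0 < e / (M + 1) by rewrite divr_gt0 // ltr_wpDl.
  have /continuousCP/(_ _ e2) ct := hol_continuous ht.
  apply: filterS (filterI key ct) => q [hk tq]; rewrite kp /k.
  have [_|qp] := eqVneq q p; first by rewrite subrr ComplexField.Normc.normc0.
  rewrite normc_dist opprK; apply: le_lt_trans (hk qp) _.
  move: tq; rewrite {1}/t subrr sub0r normc_opp ltr_pdivlMr ?ltr_wpDl // -/M.
  have := normc_ge0 (t q); nra.
apply: (@filterS _ (nbhs p) _ (dom S a) _ _ (near_dom ap)) => q aq.
rewrite ip -/(t (inv q)) -/(t q) /k; have [->|qp] := eqVneq q p.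
  by rewrite ip /t subrr mul0r.
have tq : t q != 0.
  by rewrite subr_eq0; apply: contra_neq qp => e'; exact: (coord_inj aq ap e').
by rewrite mulVKf.
Qed.

(** At an unramified point [G] is the coordinate times a unit, both at p and at inv p; k is the
    quotient of the two units. *)
Lemma inv_chart p a b : dom S a p -> dom S b (inv p) -> exists k : X -> C,
  [/\ continuous_at p k, k p != 0 & \forall q \near p,
    coord S b (inv q) - coord S b (inv p) = (coord S a q - coord S a p) * k q].
Proof.
move=> ap bp; have [ip|ip] := eqVneq (inv p) p.
  have [k [kc k1 kE]] := inv_chart_ramified ip ap.
  have aip : dom S a (inv p) by rewrite ip.
  have [l [hl l0 lE]] := chart_change bp aip.
  exists (fun q => k q * l (inv q)); split.
  - apply: continuous_mulC; first exact: kc.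
    apply: (@continuous_comp _ _ _ inv l); first exact: inv_continuous.
    exact: hol_continuous hl.
  - by rewrite mulf_neq0 // ?k1 ?oppr_eq0 ?oner_eq0 // ip.
  apply: filterS (filterI kE (inv_near lE)) => q [e ->].
  by rewrite e mulrA.
have r1 : ramif p = 1 by rewrite /ramification (negPf ip) add0r.
have [h [hh h0 hE]] := G_expand ap; have [l [cl l0 lE]] := G_expand_inv bp.
exists (fun q => h q * (l (inv q))^-1); split.
- apply: continuous_mulC; first exact: hol_continuous hh.
  exact: (@continuous_invC R X p (l \o inv) l0 cl).
- by rewrite mulf_neq0 // invr_eq0.
apply: filterS (filterI (continuous_neq0 cl l0) (filterI hE lE)) => q [/= lq [e1 e2]].
rewrite mulrA -[X in X * h q]expr1z -{1}r1 -e1 e2 r1 expr1z mulfK //.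
Qed.

End HyperellipticInvolution.

Section OrderSums.
Variables (R : realType) (X : topologicalType) (S : compactRiemannSurface R X).
Local Notation C := (Cplx R).
Local Notation hol := (holomorphic_at S).
Local Notation ord := (has_order S).

Lemma ord_add_dominant f g p n : ord f p n -> ordge S g p (n + 1) ->
  ord (fun q => f q + g q) p n.
Proof.
move=> /ordP[h [hh h0 hE]] [k hk kE]; apply/ordP.
exists (fun q => h q + lcoord S p q * k q); split.
- exact: hol_add hh (hol_mul (hol_lcoord S p) hk).
- by rewrite lcoordpp mul0r addr0.
apply: filterS (filterI (lcoord_neq0 S p) (filterI hE kE)) => q [nz [-> ->]].
by rewrite expfzDr // expr1z; ring.
Qed.

Lemma ord_mul0 f g p n : ord f p n -> ord g p 0 -> ord (fun q => f q * g q) p n.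
Proof. by move=> hf hg; have := ord_mul hf hg; rewrite addr0. Qed.

Lemma ord_cst (c : C) p : c != 0 -> ord (fun=> c) p 0.
Proof. by move=> c0; apply: hol_ord; [exact: hol_cst|exact: c0]. Qed.

Lemma ord_big (I : Type) (r : seq I) (f : I -> X -> C) (n : I -> int) p :
  (forall i, ord (f i) p (n i)) ->
  ord (fun q => \prod_(i <- r) f i q) p (\sum_(i <- r) n i).
Proof.
move=> hf; elim: r => [|i r IH].
  rewrite [X in ord _ p X]big_nil.
  apply: (@ord_eq _ _ _ (fun=> 1)); last exact: ord_cst (oner_neq0 C).
  by apply: (@filterE _ p^') => q; rewrite big_nil.
rewrite [X in ord _ p X]big_cons; apply: ord_eq (ord_mul (hf i) IH).
by apply: (@filterE _ p^') => q; rewrite big_cons.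
Qed.

End OrderSums.

(** * The degree-two function with poles P and P~ *)

Section DegreeTwoFunction.
Variables (R : realType) (X : topologicalType) (S : compactRiemannSurface R X).
Local Notation C := (Cplx R).
Local Notation normc := (@ComplexField.Normc.normc R).
Local Notation hol := (holomorphic_at S).
Local Notation ord := (has_order S).

Variables (inv : X -> X) (F : X -> one_point_compactification C).
Hypothesis hF : holomorphic_to_P1 S F.
Hypothesis hd : degree_two S F.
Hypothesis hfib : forall p, fibre_divisor S F (F p)
  (fun r => point_divisor p r + point_divisor (inv p) r)%N.
Variable P : X.
Hypothesis hP : inv P <> P.

Local Notation ramif := (ramification inv).
Let G (c : one_point_compactification C) (q : X) : C := P1_coord c (F q).

(** F followed by a coordinate change of the projective line sending F(P) to infinity, which treats
    finite and infinite F(P) alike. At the poles the conventional value is 0. *)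
Definition xfun (q : X) : C := (G (F P) q)^-1.
Local Notation x := xfun.

Definition is_pole (q : X) : bool := (q == P) || (q == inv P).
Local Notation pole := is_pole.

Let hinvK := invK hF hfib.
Let hF_inv := F_inv hfib.

Lemma pole_inv q : pole (inv q) = pole q.
Proof.
rewrite /is_pole -{1}(hinvK P) !(inj_eq (can_inj hinvK)).
by rewrite orbC.
Qed.

Lemma F_pole q : pole q <-> F q = F P.
Proof.
split=> [/orP[/eqP ->//|/eqP ->]|]; first by rewrite hF_inv.
by move=> /(F_fibre hF hfib)[->|->]; rewrite /is_pole eqxx ?orbT.
Qed.

Lemma xfun_inv q : x (inv q) = x q.
Proof. by rewrite /x /G hF_inv. Qed.

Lemma ramif_pole p : pole p -> ramif p = 1.
Proof.
have h : ramif P = 1 by rewrite /ramification; case: eqP => //; rewrite add0r.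
by move=> /orP[] /eqP -> //; rewrite (ramif_inv hF hfib).
Qed.

Lemma xfun_ord_pole p : pole p -> ord x p (-1).
Proof.
move=> hp; have := ord_inv (@G_ord _ _ _ _ _ hfib p); rewrite ramif_pole //.
by move: hp => /F_pole ->.
Qed.

(** Near q, x - x(q) is the centred coordinate [G (F q)] times a unit v. The cases are those of F(P)
    and F(q) being finite or infinite. *)
Lemma xfun_hol_ord q : ~~ pole q -> hol x q /\ ord (fun r => x r - x q) q (ramif q).
Proof.
move=> nq; have FqP : F q <> F P by move=> /F_pole e; rewrite e in nq.
have gh : hol (G (F q)) q by exact: G_hol.
have go : ord (G (F q)) q (ramif q) by exact: G_ord.
have gq : G (F q) q = 0 by exact: P1_coord_self.
suff [v [hv v0 xE]] : exists v : X -> C, [/\ hol v q, v q != 0 &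
    \forall r \near q, x r = x q + G (F q) r * v r].
  split.
    apply: hol_eq (hol_add (hol_cst S (x q) q) (hol_mul gh hv)).
    by apply: filterS xE => r ->.
  apply: ord_eq (ord_mul0 go (hol_ord hv v0)).
  by apply: near_dnbhs; apply: filterS xE => r ->; rewrite addrAC subrr add0r.
move: FqP; case FP: (F P) => [c0|]; case Fq: (F q) => [w|] // FqP.
- have wc : w - c0 != 0 by rewrite subr_eq0; apply: contra_notN FqP => /eqP ->.
  rewrite Fq in gh gq go.
  have hu : hol (fun r => G (Some w) r + (w - c0)) q.
    exact: hol_add gh (hol_cst S _ q).
  have u0 : G (Some w) q + (w - c0) != 0 by rewrite gq add0r.
  exists (fun r => - ((w - c0)^-1 * (G (Some w) r + (w - c0))^-1)); split.
  + apply: hol_eq (hol_mul (hol_cst S (- (w - c0)^-1) q) (hol_inv hu u0)).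
    by apply: (@filterE _ (nbhs q)) => r; rewrite mulNr.
  + by rewrite oppr_eq0 mulf_neq0 // invr_eq0.
  have un := continuous_neq0 (hol_continuous hu) u0.
  apply: filterS (filterI un (F_near_Some hF Fq ltr01)) => r [+ [v Fr _]].
  rewrite /x /G FP Fq Fr /= => nz; move: nz; rewrite addrA subrK => nz.
  by field; rewrite nz wc.
- rewrite Fq in gh gq go.
  have hu : hol (fun r => 1 - c0 * G None r) q.
    exact: hol_sub (hol_cst S _ q) (hol_mul (hol_cst S _ q) gh).
  have u0 : 1 - c0 * G None q != 0 by rewrite gq mulr0 subr0 oner_eq0.
  exists (fun r => (1 - c0 * G None r)^-1); split; [exact: hol_inv hu u0|by rewrite invr_eq0|].
  have M0 : 0 < normc c0 + 1 by rewrite ltr_wpDl // normc_ge0.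
  apply: filterS (F_near_None hF hfib Fq M0) => r hr.
  rewrite /x /G FP Fq /= invr0 add0r; case Fr: (F r) => [v|] /=; last first.
    by rewrite invr0 mul0r.
  have hv := hr _ Fr.
  have v0 : v != 0.
    by apply: contraTneq hv => ->; rewrite ComplexField.Normc.normc0 -leNgt ltW.
  have vc : v - c0 != 0.
    by rewrite subr_eq0; apply: contraTneq hv => ->; rewrite -leNgt lerDl.
  by field; rewrite vc v0.
exists (fun=> 1); split; [exact: hol_cst|by rewrite oner_eq0|].
apply: filterS (F_near_Some hF Fq ltr01) => r [v Fr _].
by rewrite /x /G FP Fq Fr /= !invrK; ring.
Qed.

Lemma xfun_inj p q : ~~ pole p -> ~~ pole q -> x p = x q -> p = q \/ p = inv q.
Proof.
move=> np nq e; apply: (F_fibre hF hfib).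
have FpP : F p <> F P by move=> /F_pole e'; rewrite e' in np.
have FqP : F q <> F P by move=> /F_pole e'; rewrite e' in nq.
move: FpP FqP e; rewrite /x /G.
case: (F P) => [c0|]; case: (F p) => [v|]; case: (F q) => [w|] //= h1 h2.
- by move=> /invr_inj/addIr ->.
- move=> /eqP; rewrite invr0 invr_eq0 subr_eq0 => /eqP e; by rewrite e in h1.
- move=> /eqP; rewrite invr0 eq_sym invr_eq0 subr_eq0 => /eqP e; by rewrite e in h2.
by move=> /invr_inj/invr_inj ->.
Qed.

Lemma xfun_surj (e : C) : exists2 p, ~~ pole p & x p = e.
Proof.
have F_surj c : exists p, F p = c.
  have [p [q h]] := hd c; exists p; have [_] := h p.
  by rewrite /point_divisor eqxx; apply: contraPP => np; move=> /(_ np).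
suff [c cP ce] : exists2 c, c <> F P & (P1_coord (F P) c)^-1 = e.
  have [p Fp] := F_surj c; exists p; last by rewrite /x /G Fp.
  by apply/negP => /F_pole; rewrite Fp.
case: (F P) => [c0|]; last by exists (Some e) => //=; rewrite invrK.
have [->|e0] := eqVneq e 0; first by exists None => //=; rewrite invr0.
exists (Some (e^-1 + c0)); last by rewrite /= addrK invrK.
by move=> [/eqP]; rewrite -subr_eq0 addrK invr_eq0 (negPf e0).
Qed.

Lemma xfun_sub_ord_pole (e : C) p : pole p -> ord (fun r => x r - e) p (-1).
Proof.
move=> hp; apply: ord_add_dominant; first exact: xfun_ord_pole.
by apply: hol_ordge; exact: hol_cst.
Qed.

Lemma xfun_sub_ord (e : C) p : ~~ pole p ->
  ord (fun r => x r - e) p (ramif p * (x p == e)%:Z).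
Proof.
move=> np; have [hx ox] := xfun_hol_ord np.
have [<-|xe] := eqVneq (x p) e; first by rewrite mulr1.
rewrite mulr0; apply: (@hol_ord _ _ _ (fun r => x r - e)).
  exact: hol_sub hx (hol_cst S _ p).
by rewrite subr_eq0.
Qed.

(** The divisor of x - x(q), for q not a pole. *)
Definition fibre_order (q p : X) : int :=
  (p == q)%:Z + (p == inv q)%:Z - (p == P)%:Z - (p == inv P)%:Z.
Local Notation eord := fibre_order.

Lemma xfun_eord q p : ~~ pole q -> ord (fun r => x r - x q) p (eord q p).
Proof.
move=> nq; have [hp|np] := boolP (pole p).
  have pq : p != q by apply: contraNneq nq => <-.
  have piq : p != inv q by apply: contraNneq nq => e; rewrite -pole_inv -e.
  have -> : eord q p = -1; last exact: xfun_sub_ord_pole.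
  rewrite /fibre_order (negPf pq) (negPf piq) addr0 add0r.
  have PP : P != inv P by rewrite eq_sym; apply/eqP.
  by move: hp => /orP[] /eqP ->; rewrite eqxx ?(negPf PP) // eq_sym (negPf PP).
have -> : eord q p = ramif p * (x p == x q)%:Z; last exact: xfun_sub_ord.
move: (np); rewrite /is_pole negb_or => /andP[/negPf pP /negPf piP].
rewrite /fibre_order pP piP !subr0 /ramification.
have [->|pq] := eqVneq p q; first by rewrite eqxx mulr1 addrC eq_sym.
have [pE|piq] := eqVneq p (inv q).
  by rewrite pE in pq *; rewrite xfun_inv eqxx hinvK eq_sym (negPf pq) mulr1.
have -> : (x p == x q) = false; last by rewrite mulr0.
by apply/eqP => /(xfun_inj np nq)[] e; [move: pq|move: piq]; rewrite e eqxx.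
Qed.

Lemma poly_xfun_ord (r : {poly C}) : r != 0 -> exists rs : seq C,
  [/\ r = lead_coef r *: \prod_(z <- rs) ('X - z%:P),
    forall p, pole p -> ord (fun q => r.[x q]) p (- (size rs)%:Z) &
    forall p, ~~ pole p -> ord (fun q => r.[x q]) p (ramif p * (count_mem (x p) rs)%:Z)].
Proof.
move=> r0; have [rs rE] := closed_field_poly_normal r; exists rs; split=> //.
  move=> p hp.
  have o1 : ord (fun q => \prod_(z <- rs) (x q - z)) p (\sum_(z <- rs) -1).
    by apply: ord_big => z; exact: xfun_sub_ord_pole.
  have o2 := ord_mul0 o1 (@ord_cst _ _ S (lead_coef r) p _).
  rewrite (_ : - _ = \sum_(z <- rs) (-1 : int)); last first.
    by rewrite sumrN big_const_seq count_predT iter_addr_0 natz.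
  apply: ord_eq (o2 _); last by rewrite lead_coef_eq0.
  apply: (@filterE _ p^') => q; rewrite {2}rE hornerZ horner_prod mulrC; congr (_ * _).
  by apply: eq_bigr => z _; rewrite hornerXsubC.
move=> p np.
have o1 : ord (fun q => \prod_(z <- rs) (x q - z)) p
    (\sum_(z <- rs) (ramif p * (x p == z)%:Z)).
  by apply: ord_big => z; exact: xfun_sub_ord.
have o2 := ord_mul0 o1 (@ord_cst _ _ S (lead_coef r) p _).
rewrite (_ : _ * _ = \sum_(z <- rs) (ramif p * (x p == z)%:Z)); last first.
  rewrite -mulr_sumr; congr (_ * _); rewrite -sum1_count big_mkcond /=.
  rewrite (big_morph Posz PoszD (erefl 0%:Z)); apply: eq_bigr => z _.
  by rewrite eq_sym; case: eqP.
apply: ord_eq (o2 _); last by rewrite lead_coef_eq0.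
apply: (@filterE _ p^') => q; rewrite {2}rE hornerZ horner_prod mulrC; congr (_ * _).
by apply: eq_bigr => z _; rewrite hornerXsubC.
Qed.

End DegreeTwoFunction.

(** * Sections of the spin bundle *)

Section Sections.
Variables (R : realType) (X : topologicalType) (S : compactRiemannSurface R X).
Local Notation C := (Cplx R).
Local Notation hol := (holomorphic_at S).
Local Notation ord := (has_order S).

(** A function regular at p in the sense of [ordge] may have any value at p. This is the value of
    its holomorphic extension, with default 0 if there is none. *)
Definition regular_value (f : X -> C) (p : X) : C := xget 0
  [set v | exists h : X -> C, [/\ hol h p, \forall q \near p^', f q = h q & h p = v]].

Lemma regular_valueE f h p : hol h p -> (\forall q \near p^', f q = h q) ->
  regular_value f p = h p.
Proof.
move=> hh fh; rewrite /regular_value; case: xgetP => [v _ [k [hk fk <-]]|/(_ (h p))].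
  apply: (continuous_dnbhs_eq S (hol_continuous hk) (hol_continuous hh)).
  by apply: filterS (filterI fh fk) => q [<- <-].
by case; exists h.
Qed.

Variable L : cocycle R X.
Hypothesis hL : holomorphic_line_bundle S L.
Hypothesis H0 : forall s : patch L -> X -> C, holomorphic_section S s ->
  forall i p, patch_dom i p -> s i p = 0.

Lemma near_patch (i : patch L) p : patch_dom i p -> \forall q \near p, patch_dom i q.
Proof.
by move=> ip; apply: open_nbhs_nbhs; split; [have [h _ _ _] := hL; exact: h|exact: ip].
Qed.

Lemma patch_ex p : exists i : patch L, patch_dom i p.
Proof. by have [_ h _ _] := hL; exact: h. Qed.

(** The hypothesis H^0 = 0 concerns honest holomorphic sections, so the values of s are first
    corrected by [regular_value]. Hence the conclusion is only about punctured neighbourhoods. *)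
Lemma regular_section_eq0 (s : patch L -> X -> C) : compatible s ->
  (forall i p, patch_dom i p -> ordge S (s i) p 0) ->
  forall i p, patch_dom i p -> \forall q \near p^', s i q = 0.
Proof.
move=> cs reg.
have regE i p : patch_dom i p -> exists2 h : X -> C, hol h p &
    \forall q \near p^', s i q = h q.
  move=> /reg[h hh hE]; exists h; first exact: hh.
  by apply: filterS hE => q ->; rewrite expr0z mul1r.
pose s' i p := regular_value (s i) p.
have near_s' i p (h : X -> C) : hol h p -> (\forall q \near p^', s i q = h q) ->
    \forall q \near p, s' i q = h q.
  move=> hh sh; have sn : \forall q \near p, q != p -> \forall r \near q, s i r = h r.
    exact: (dnbhs_near S sh).
  apply: filterS (filterI sn (hol_near hh)) => q [hq hhq].
  have [->|qp] := eqVneq q p; first exact: regular_valueE.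
  by apply: regular_valueE hhq _; apply: near_dnbhs; exact: hq.
have hs' : holomorphic_section S s'.
  split=> [i j p ip jp|i p ip].
    have [h hh sh] := regE _ _ ip; have [k hk sk] := regE _ _ jp.
    have [_ _ /(_ i j p ip jp)[ht _] _] := hL.
    rewrite /s' (regular_valueE hk sk).
    rewrite (regular_valueE (hol_mul ht hk)) //.
    apply: filterS (filterI sk (near_dnbhs (filterI (near_patch ip) (near_patch jp)))).
    by move=> q [<- [iq jq]]; exact: cs.
  have [h hh sh] := regE _ _ ip.
  by apply: (hol_eq _ hh); apply: filterS (near_s' i p h hh sh) => q ->.
move=> i p ip; have [h hh sh] := regE _ _ ip.
apply: filterS (filterI sh (near_dnbhs (filterI (near_s' i p h hh sh) (near_patch ip)))).
by move=> q [-> [<- iq]]; exact: (H0 hs' iq).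
Qed.

Definition has_divisor (s : patch L -> X -> C) (n : X -> int) :=
  compatible s /\ forall i p, patch_dom i p -> ord (s i) p (n p).

Lemma has_divisor_mul f s m n : (forall p, ord f p (m p)) -> has_divisor s n ->
  has_divisor (fun i q => f q * s i q) (fun p => m p + n p).
Proof.
move=> fm [cs sn]; split=> [i j p ip jp|i p ip].
  by rewrite (cs i j p ip jp) mulrCA.
exact: ord_mul (fm p) (sn i p ip).
Qed.

Lemma has_divisor_pole s n : has_divisor s n -> X -> exists p, n p < 0.
Proof.
move=> [cs sn] p0; apply: contrapT => hn.
have ge0 p : 0 <= n p by rewrite leNgt; apply/negP => np; apply: hn; exists p.
have reg i p : patch_dom i p -> ordge S (s i) p 0.
  by move=> ip; exact: ordge_le (ge0 p) (ord_ordge (sn i p ip)).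
have [i ip] := patch_ex p0.
have z := regular_section_eq0 cs reg ip.
have [q _ [h1 h2]] := dnbhs_ex S (filterI z (ord_neq0 (sn i p0 ip))).
by rewrite h1 eqxx in h2.
Qed.

(** The ratio c of the leading coefficients at Q makes s - c s' regular there, hence zero: the two
    sections are proportional. *)
Lemma has_divisor_uniq s s' n n' Q : has_divisor s n -> has_divisor s' n' -> n Q = -1 -> n' Q = -1 ->
  (forall p, p != Q -> 0 <= n p /\ 0 <= n' p) -> n = n'.
Proof.
move=> [cs sn] [cs' sn'] nQ nQ' ge0.
have [i0 iQ] := patch_ex Q.
have /ordP[h [hh h0 hE]] := sn _ _ iQ; have /ordP[k [hk k0 kE]] := sn' _ _ iQ.
rewrite nQ in hE; rewrite nQ' in kE.
pose c := h Q / k Q.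
have c0 : c != 0 by rewrite mulf_neq0 // invr_eq0.
pose t i q := s i q - c * s' i q.
have ct : compatible t.
  by move=> i j p ip jp; have e := cs i j p ip jp; have e' := cs' i j p ip jp; rewrite /t e e'; ring.
have tQ0 : ordge S (t i0) Q 0.
  have [l hl lE] := hol_division (chart_atP S Q) (hol_sub hh (hol_mul (hol_cst S c Q) hk)).
  exists l; first exact: hl.
  apply: filterS (filterI (lcoord_neq0 S Q) (filterI hE (filterI kE (near_dnbhs lE)))).
  move=> q [nz [e1 [e2 e3]]]; rewrite /t e1 e2 mulrCA -mulrBr e3 /c divfK // subrr add0r.
  by rewrite -lcoordE expr0z mul1r exprN1 mulKf.
have reg i p : patch_dom i p -> ordge S (t i) p 0.
  move=> ip; have [pQ|pQ] := eqVneq p Q; last first.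
    have [g1 g2] := ge0 p pQ.
    apply: ordge_sub; first exact: ordge_le g1 (ord_ordge (sn i p ip)).
    have := ordge_mul (hol_ordge (hol_cst S c p)) (ordge_le g2 (ord_ordge (sn' i p ip))).
    by rewrite addr0.
  rewrite pQ in ip *.
  have [_ _ /(_ i i0 Q ip iQ)[ht _] _] := hL.
  have := ordge_mul (hol_ordge ht) tQ0; rewrite addr0; apply: ordge_eq.
  apply: near_dnbhs; apply: filterS (filterI (near_patch ip) (near_patch iQ)) => q [iq jq].
  by rewrite -ct.
apply/funext => p; have [i ip] := patch_ex p.
have z := regular_section_eq0 ct reg ip.
apply: (ord_uniq (sn i p ip)).
have := ord_mul0 (sn' i p ip) (@ord_cst R X S c p c0); apply: ord_eq.
by apply: filterS z => q /eqP; rewrite subr_eq0 mulrC => /eqP ->.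
Qed.

Lemma regular_function_cst f s n Q : has_divisor s n -> n Q = -1 ->
  (forall p, p != Q -> 0 <= n p) -> (forall p, ordge S f p 0) ->
  exists c : C, forall p, \forall q \near p^', f q = c.
Proof.
move=> sn nQ ge0 fr; have [h hh hE] := fr Q; exists (h Q) => p.
pose s' (i : patch L) q := (f q - h Q) * s i q.
have cs' : compatible s'.
  by have [cs _] := sn; move=> i j r ir jr; rewrite /s' (cs i j r ir jr) mulrCA.
have fr' r : ordge S (fun q => f q - h Q) r 0.
  by apply: ordge_sub; [exact: fr|exact: hol_ordge (hol_cst S _ r)].
have [_ so] := sn.
have reg i r : patch_dom i r -> ordge S (s' i) r 0.
  move=> ir; have [rQ|rQ] := eqVneq r Q; last first.
    have := ordge_mul (fr' r) (ordge_le (ge0 r rQ) (ord_ordge (so i r ir))).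
    by rewrite addr0.
  rewrite rQ in ir *.
  have [l hl lE] := hol_division (chart_atP S Q) hh.
  have f1 : ordge S (fun q => f q - h Q) Q 1.
    exists l; first exact: hl.
    apply: filterS (filterI hE (near_dnbhs lE)) => q [-> ->].
    by rewrite expr0z mul1r -lcoordE expr1z addrAC subrr add0r.
  have := ordge_mul f1 (ord_ordge (so i Q ir)); by rewrite nQ subrr.
have [i ip] := patch_ex p.
have z := regular_section_eq0 cs' reg ip.
apply: filterS (filterI z (ord_neq0 (so i p ip))) => q [/eqP].
by rewrite mulf_eq0 subr_eq0 => /orP[/eqP ->//|/eqP ->]; rewrite eqxx.
Qed.

(** The condition at Q records that the pole is exactly simple; regularity elsewhere is contained in
    D being a natural number. *)
Lemma zero_divisorP Q (D : X -> nat) : zero_divisor S L Q D <->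
  exists2 s, has_divisor s (fun p => (D p)%:Z - (p == Q)%:Z) & D Q = 0%N.
Proof.
split=> [[s [[cs _] sQ _] sD]|[s [cs so] DQ]].
  exists s; first by split=> // i p ip; have := sD p i ip; rewrite /point_divisor.
  have [i iQ] := patch_ex Q.
  have := ord_uniq (sQ i iQ) (sD Q i iQ); rewrite /point_divisor eqxx; lia.
have so' p i : patch_dom i p -> ord (s i) p ((D p)%:Z - (point_divisor Q p)%:Z).
  by move=> ip; have := so i p ip.
exists s; last by move=> p i ip; exact: so'.
split.
- by split=> // i p ip; left; eexists; exact: so ip.
- by move=> i iQ; have := so i Q iQ; rewrite DQ eqxx sub0r.
move=> p n pQ sn; have [i ip] := patch_ex p.
have -> : n = (D p)%:Z - (p == Q)%:Z by exact: ord_uniq (sn i ip) (so i p ip).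
by case: eqP => // _; rewrite subr0.
Qed.

Lemma zero_divisor_uniq Q D D' : zero_divisor S L Q D -> zero_divisor S L Q D' -> D = D'.
Proof.
move=> /zero_divisorP[s sD DQ] /zero_divisorP[s' sD' DQ'].
have E : (fun p => (D p)%:Z - (p == Q)%:Z) = (fun p => (D' p)%:Z - (p == Q)%:Z).
  apply: (@has_divisor_uniq s s' _ _ Q sD sD'); rewrite ?DQ ?DQ' ?eqxx ?sub0r //.
  by move=> p /negPf ->; rewrite !subr0.
by apply/funext => p; have := congr1 (fun f => f p) E; rewrite /= => /addIr [].
Qed.

Lemma zero_setE Q D : zero_divisor S L Q D -> zero_set S L Q = [set p | (0 < D p)%N].
Proof.
move=> zD; apply/seteqP; split=> p /=; last by exists D.
by move=> [D' zD'] Dp; rewrite (zero_divisor_uniq zD zD').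
Qed.

End Sections.

(** * The divisor of sigma at P~ *)

Section ConjugateSection.
Variables (R : realType) (X : topologicalType) (S : compactRiemannSurface R X).
Local Notation C := (Cplx R).
Local Notation hol := (holomorphic_at S).
Local Notation ord := (has_order S).

Variables (inv : X -> X) (F : X -> one_point_compactification C).
Hypothesis hF : holomorphic_to_P1 S F.
Hypothesis hd : degree_two S F.
Hypothesis hfib : forall p, fibre_divisor S F (F p)
  (fun r => point_divisor p r + point_divisor (inv p) r)%N.
Variable P : X.
Hypothesis hP : inv P <> P.

Variable L : cocycle R X.
Hypothesis hL : holomorphic_line_bundle S L.
Hypothesis H0 : forall s : patch L -> X -> C, holomorphic_section S s ->
  forall i p, patch_dom i p -> s i p = 0.
Hypothesis hK : isomorphic S (tensor L L) (canonical_bundle S).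

Variables (s0 : patch L -> X -> C) (D : X -> nat).
Hypothesis hs0 : has_divisor S s0 (fun p => (D p)%:Z - (p == P)%:Z).
Hypothesis DP : D P = 0%N.
Hypothesis DiP : D (inv P) = 0%N.
Variable A : seq X.
Hypothesis uA : uniq A.
Hypothesis DA : forall p, p \notin A -> D p = 0%N.

Local Notation ramif := (ramification inv).
Local Notation x := (xfun F P).
Local Notation pole := (is_pole inv P).
Local Notation eord := (fibre_order inv P).
Let hinvK := invK hF hfib.
Let iC := inv_chart hF hfib.
Let ic := inv_continuous hF hfib.

Let n (p : X) : int := (D p)%:Z - (p == P)%:Z.

Let n_ge0 p : p != P -> 0 <= n p.
Proof. by move=> /negPf pP; rewrite /n pP subr0. Qed.
Let nP : n P = -1. Proof. by rewrite /n DP eqxx sub0r. Qed.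
Let niP : n (inv P) = 0.
Proof. by rewrite /n DiP; case: eqP. Qed.

(** Subtracting a multiple of a power of x lowers the order of the pole at P. Once it is gone,
    invariance gives regularity at P~ too, and the function is constant. *)
Lemma invariant_polynomial (N : nat) (f : X -> C) : (forall p, f (inv p) = f p) ->
  (forall p, ~~ pole p -> ordge S f p 0) -> ordge S f P (- N%:Z) ->
  exists r : {poly C}, forall p, \forall q \near p^', f q = r.[x q].
Proof.
elim: N f => [|N IH] f finv freg fP.
  have freg' p : ordge S f p 0.
    have [hp|] := boolP (pole p); last exact: freg.
    move: hp => /orP[] /eqP ->; first exact: fP.
    have fP' : ordge S f (inv (inv P)) 0 by rewrite hinvK.
    apply: ordge_eq (ordge_comp iC ic fP').
    by apply: (@filterE _ (inv P)^') => q; exact: finv.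
  have [c hc] := regular_function_cst hL H0 hs0 nP n_ge0 freg'.
  by exists c%:P => p; apply: filterS (hc p) => q ->; rewrite hornerC.
have poleP : pole P by rewrite /is_pole eqxx.
have /ordP[k [hk k0 kE]] := xfun_ord_pole hF hfib hP poleP.
have [h hh hE] := fP.
pose c := h P / k P ^+ N.+1.
have hm : hol (fun q => h q - c * k q ^+ N.+1) P.
  exact: hol_sub hh (hol_mul (hol_cst S c P) (hol_expn N.+1 hk)).
have [l hl lE] := hol_division (chart_atP S P) hm.
have [|p np||r hr] := IH (fun q => f q - c * x q ^+ N.+1).
- by move=> p; rewrite finv (xfun_inv hfib).
- apply: ordge_sub; first exact: freg.
  have [hx _] := xfun_hol_ord hF hfib np.
  exact: hol_ordge (hol_mul (hol_cst S c p) (hol_expn N.+1 hx)).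
- exists l; first exact: hl.
  apply: filterS (filterI (lcoord_neq0 S P) (filterI hE (filterI kE (near_dnbhs lE)))).
  move=> q [nz [-> [-> e]]].
  have -> : (lcoord S P q ^ (-1) * k q) ^+ N.+1 = lcoord S P q ^ (- N.+1%:Z) * k q ^+ N.+1.
    by rewrite exprMn exprN1 exprVn -exprnN.
  rewrite mulrCA -mulrBr e /c divfK ?expf_neq0 // subrr add0r -lcoordE mulrA; congr (_ * _).
  rewrite -{2}[lcoord S P q]expr1z -expfzDr //; congr (_ ^ _).
  by rewrite -addn1 PoszD opprD -addrA addNr addr0.
exists (r + c *: ('X ^+ N.+1)) => p; apply: filterS (hr p) => q e.
by rewrite hornerD hornerZ hornerXn -e subrK.
Qed.

(** The order of dx at p, each of the two poles of x being simple. *)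
Let dord (p : X) : int := if pole p then -2 else ramif p - 1.

Let dord_inv p : dord (inv p) = dord p.
Proof. by rewrite /dord (pole_inv hF hfib) (ramif_inv hF hfib). Qed.

Lemma near_not_pole p : \forall q \near p^', ~~ pole q.
Proof.
have nn r : \forall q \near p^', q != r.
  have [->|pr] := eqVneq p r; first exact: dnbhs_neq.
  exact: near_dnbhs (near_neq S pr).
by apply: filterS (filterI (nn P) (nn (inv P))) => q [h1 h2]; rewrite /is_pole negb_or h1.
Qed.

Lemma ord_dx a p : dom S a p -> ord (dchart a x) p (dord p).
Proof.
move=> ap; rewrite /dord; have [hp|np] := boolP (pole p).
  exact: (ord_dchart ap (xfun_ord_pole hF hfib hP hp)).
have [hx ox] := xfun_hol_ord hF hfib np.
have r0 : ramif p != 0 by rewrite /ramification; lia.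
apply: ord_eq (ord_dchart ap ox r0).
apply: near_dnbhs; apply: filterS (filterI (near_dom ap) (hol_near hx)) => q [aq hq].
have [k [kc kq kE]] := cdiff_caratheodory aq (nbhs_singleton hq).
rewrite kq; apply: (dchartP aq kc); apply: filterS kE => r ->; ring.
Qed.

Lemma differential_quotient : exists y : X -> C,
  forall p, ord y p (n p + n p - dord p).
Proof.
have [phi [phiO phiE]] := hK.
have /choice[pc hpc] := patch_ex hL.
pose yl (a : chart S) (i : patch L) q := phi a (i, i) q * s0 i q ^+ 2 / dchart a x q.
(* A chart and a patch are chosen anew at each q. Off the poles of x the value is independent of
   them, as sigma^2 and dx acquire the same transition factor; near p it is thus given by a single
   chart and patch. *)
exists (fun q => yl (chart_at S q) (pc q) q) => p.
have ap := chart_atP S p; have ip := hpc p; set a := chart_at S p in ap; set i := pc p in ip.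
have [cs so] := hs0.
have [h1 h2] := phiO a (i, i) p ap (conj ip ip).
have o1 : ord (fun q => s0 i q ^+ 2) p (n p + n p).
  by apply: ord_eq (ord_mul (so i p ip) (so i p ip)); apply: (@filterE _ p^') => q; rewrite expr2.
have := ord_mul (ord_mul (hol_ord h1 h2) o1) (ord_inv (ord_dx ap)); rewrite add0r.
apply: ord_eq.
apply: filterS (filterI (near_not_pole p) (near_dnbhs (filterI (near_dom ap) (near_patch hL ip)))).
move=> q [nq [aq iq]].
have bq := chart_atP S q; have jq := hpc q; set b := chart_at S q in bq *; set j := pc q in jq *.
have [hx _] := xfun_hol_ord hF hfib nq.
rewrite /yl (dchart_chain bq aq (nbhs_singleton hx)) (cs j i q jq iq).
have e := phiE a b (i, i) (j, j) q aq bq (conj iq iq) (conj jq jq).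
move: e; rewrite /=; set T := (_^`())%classic _ => e.
have [_ _ /(_ j i q jq iq)[_ tji] _] := hL.
have [_ phib] := phiO b (j, j) q bq (conj jq jq).
have T0 : T != 0.
  apply/eqP => T0; move: e; rewrite T0 mul0r => /eqP.
  by rewrite !mulf_eq0 (negPf phib) (negPf tji).
rewrite exprMn [phi b _ q * _]mulrA (_ : phi b (j, j) q * trans j i q ^+ 2 = T * phi a (i, i) q).
  by rewrite invfM -[T * _ * _]mulrA [RHS]mulrACA divff // mul1r.
by rewrite -e expr2.
Qed.

Lemma conjugate_quotient : exists u : X -> C,
  [/\ forall p, u (inv p) = (u p)^-1,
      forall p, ord u p ((n (inv p) - n p) *+ 2) &
      forall p, inv p = p -> ordge S (fun q => u q + 1) p 1].
Proof.
have [y oy] := differential_quotient.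
exists (fun q => y (inv q) / y q); split.
- by move=> p; rewrite hinvK invf_div.
- move=> p; have := ord_mul (ord_comp iC ic (oy (inv p))) (ord_inv (oy p)).
  rewrite dord_inv (_ : _ + _ = (n (inv p) - n p) *+ 2) //.
  by rewrite mulr2n; ring.
move=> p ip.
have r2 : ramif p = 2 by rewrite /ramification ip eqxx.
have np : ~~ pole p.
  by apply/negP => hp; have := ramif_pole hF hfib hP hp; rewrite r2.
pose m := n p + n p - dord p.
have /ordP[h [hh h0 hE]] := oy p; rewrite -/m in hE.
have ap := chart_atP S p.
have hpi : hol h (inv p) by rewrite ip.
have hhi := hol_comp iC ic hpi.
have hc : hol (coord S (chart_at S p)) (inv p) by rewrite ip; exact: hol_coord.
have [l hl lE] := hol_division ap (hol_comp iC ic hc).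
have lE' : \forall q \near p, lcoord S p (inv q) = lcoord S p q * l q.
  by apply: filterS lE => q; rewrite /= ip !lcoordE => ->; rewrite addrAC subrr add0r.
have lp : l p = -1.
  have [k [kc <- kE]] := inv_chart_ramified hF hfib ip ap.
  apply: (continuous_dnbhs_eq S (hol_continuous hl) kc).
  apply: filterS (filterI (lcoord_neq0 S p) (near_dnbhs (filterI lE' kE))) => q [nz [e1 e2]].
  by rewrite ip in e2; apply: (mulfI nz); rewrite -e1; exact: e2.
have l0 : l p != 0 by rewrite lp oppr_eq0 oner_eq0.
have hE' : \forall q \near p^', y (inv q) = lcoord S p (inv q) ^ m * h (inv q).
  have hEi : \forall q \near (inv p)^', y q = lcoord S p q ^ m * h q by rewrite ip; exact: hE.
  exact: (phi_dnbhs iC ic hEi).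
pose v q := l q ^ m * (h (inv q) * (h q)^-1).
have hv : hol v p by exact: hol_mul (hol_exprz m hl l0) (hol_mul hhi (hol_inv hh h0)).
have vp : v p = -1.
  rewrite /v ip divff // mulr1 lp.
  have N1 : (-1 : C) != 0 by rewrite oppr_eq0 oner_eq0.
  (* Here dx has a simple zero, so m = 2 n(p) - 1 is odd, and the value (-1)^m is -1. *)
  rewrite (_ : m = n p + n p + -1); last by rewrite /m /dord (negPf np) r2.
  by rewrite (expfzDr (n p + n p) (-1) N1) (expfzDr (n p) (n p) N1) -expfzMl mulrNN mulr1 exp1rz mul1r exprN1 invrN1.
have [w hw wE] := hol_division ap (hol_add hv (hol_cst S 1 p)).
exists w; first exact: hw.
apply: filterS (filterI (lcoord_neq0 S p) (filterI hE (filterI hE' (near_dnbhs (filterI lE' wE))))).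
move=> q [nz [e1 [e2 [e3 e4]]]].
rewrite expr1z lcoordE; move: e4; rewrite vp addNr add0r => <-.
rewrite e1 e2 e3 expfzMl /v invfM; congr (_ + _).
move: (lcoord S p q ^ m) (expfz_neq0 m nz) (l q ^ m) (h (inv q)) (h q)^-1 => c1 c10 c2 c3 c4.
by field.
Qed.

(** The exponents carry the multiplicities of A_P: the zeros form A_P + inv A_P, and P and P~ are
    poles of order d. *)
Let Nfun (q : X) : C := \prod_(k <- A) (x q - x k) ^+ D k.
Let d : nat := \sum_(k <- A) D k.

Let sum_point (r : X) : \sum_(k <- A) ((r == k)%:Z *+ D k) = (D r)%:Z.
Proof.
have [rA|rA] := boolP (r \in A); last first.
  rewrite (DA rA) big_seq big1 // => k kA; case: eqP => [rk|_]; last by rewrite mul0rn.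
  by move: rA; rewrite rk kA.
rewrite (bigD1_seq r) //= eqxx big1 ?addr0 ?natz //.
by move=> k /negPf; rewrite eq_sym => ->; rewrite mul0rn.
Qed.

Let ord_Nfun p : ord Nfun p
  ((D p)%:Z + (D (inv p))%:Z - ((p == P)%:Z + (p == inv P)%:Z) * d%:Z).
Proof.
have ok k : ord (fun q => (x q - x k) ^+ D k) p (eord k p *+ D k).
  have [hk|nk] := boolP (pole k); last first.
    exact: ord_expn (@xfun_eord R X S inv F hF hfib P hP k p nk).
  have -> : D k = 0%N by move: hk => /orP[] /eqP ->.
  by rewrite mulr0n; exact: (@ord_cst R X S 1 p (oner_neq0 _)).
have := ord_big A ok; congr ord.
under eq_bigr do rewrite /fibre_order !mulrnDl !mulNrn -addrA -opprD.
rewrite big_split big_split /= sum_point; congr (_ + _ + _).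
  rewrite -sum_point; apply: eq_bigr => k _; congr ((nat_of_bool _)%:Z *+ _).
  by apply/eqP/eqP => [->|<-]; rewrite hinvK.
rewrite sumrN; congr (- _).
rewrite /d (big_morph Posz PoszD (erefl 0%:Z)) mulr_sumr; apply: eq_bigr => k _.
by rewrite -mulrnDl -mulr_natr natz.
Qed.

Let Nfun_inv p : Nfun (inv p) = Nfun p.
Proof. by apply: eq_bigr => k _; rewrite (xfun_inv hfib). Qed.

Let n_not_pole p : ~~ pole p -> n p = D p /\ n (inv p) = D (inv p).
Proof.
rewrite /is_pole negb_or => /andP[/negPf p1 /negPf p2]; rewrite /n p1 !subr0; split=> //.
rewrite (_ : (inv p == P) = false) ?subr0 //.
by apply/eqP => e; move: p2; rewrite -e hinvK eqxx.
Qed.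

Lemma poly_sqrt (r : {poly C}) (rs : seq C) :
  r = lead_coef r *: \prod_(z <- rs) ('X - z%:P) ->
  (forall z, ~~ odd (count_mem z rs)) -> exists t : {poly C}, t ^+ 2 = r.
Proof.
move=> rE even.
exists (sqrtC (lead_coef r) *: \prod_(z <- undup rs) ('X - z%:P) ^+ (count_mem z rs)./2).
rewrite exprZn sqrtCK {2}rE; congr (_ *: _).
rewrite -(prodr_undup_exp_count rs xpredT) -prodrXl; apply: eq_bigr => z _.
by rewrite -exprM muln2 even_halfK.
Qed.

Theorem conjugate_section : exists s : patch L -> X -> C,
  has_divisor S s (fun p => (D (inv p))%:Z - (p == inv P)%:Z).
Proof.
have [u [uinv ou u1]] := conjugate_quotient.
pose N2 q := Nfun q * Nfun q.
pose T q := - (N2 q * (u q)^-1) + (N2 q *+ 2 - N2 q * u q).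
pose o p := (D p)%:Z + (D (inv p))%:Z - ((p == P)%:Z + (p == inv P)%:Z) * d%:Z.
have oN2 p : ord N2 p (o p + o p) by have h := ord_mul (@ord_Nfun p) (@ord_Nfun p); exact: h.
have oN2' p : ordge S (fun q => N2 q *+ 2) p (o p + o p).
  apply: ordge_eq (ordge_add (ord_ordge (oN2 p)) (ord_ordge (oN2 p))).
  by apply: (@filterE _ p^') => q; rewrite mulr2n.
have oui p : ord (fun q => (u q)^-1) p (- ((n (inv p) - n p) *+ 2)) by exact: ord_inv (ou p).
have oNu p : ord (fun q => N2 q * u q) p (o p + o p + (n (inv p) - n p) *+ 2).
  exact: ord_mul (oN2 p) (ou p).
have oNui p : ord (fun q => - (N2 q * (u q)^-1)) p (o p + o p - (n (inv p) - n p) *+ 2).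
  have N10 : (-1 : C) != 0 by rewrite oppr_eq0 oner_eq0.
  have := ord_mul0 (ord_mul (oN2 p) (oui p)) (@ord_cst R X S _ p N10).
  by apply: ord_eq; apply: (@filterE _ p^') => q; rewrite mulrN1.
have oPole p : ~~ pole p -> o p = (D p)%:Z + (D (inv p))%:Z.
  by rewrite /is_pole negb_or /o => /andP[/negPf -> /negPf ->]; lia.
(* Writing D' for D o inv, N^2 has order 2 (D + D') here, while u has order 2 (D' - D): N^2
   compensates every pole of u and of 1/u. *)
have Treg p : ~~ pole p -> ordge S T p 0.
  move=> np; have [e1 e2] := n_not_pole np; have e3 := oPole p np.
  apply: ordge_add; last apply: ordge_sub.
  - by apply: ordge_le (ord_ordge (oNui p)); rewrite e1 e2 e3; lia.
  - by apply: ordge_le (oN2' p); rewrite e3; lia.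
  - by apply: ordge_le (ord_ordge (oNu p)); rewrite e1 e2 e3; lia.
have oP : o P = - d%:Z.
  have PiP : (P == inv P) = false by apply/eqP => e; apply: hP.
  by rewrite /o DP DiP eqxx PiP; lia.
(* u has a double zero at P, so N^2 / u alone reaches the pole order 2 d + 2. This exact order also
   shows that the polynomial is not zero. *)
have oT : ord T P (- (d.*2.+2)%:Z).
  have e : - (d.*2.+2)%:Z = o P + o P - (n (inv P) - n P) *+ 2 by rewrite oP niP nP; lia.
  rewrite e; apply: ord_add_dominant; first exact: oNui.
  apply: ordge_sub.
  - by apply: ordge_le (oN2' P); rewrite niP nP; lia.
  - by apply: ordge_le (ord_ordge (oNu P)); rewrite niP nP; lia.
have Tinv p : T (inv p) = T p.
  by rewrite /T /N2 !Nfun_inv uinv invrK; ring.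
have [r hr] := invariant_polynomial Tinv Treg (ord_ordge oT).
have r0 : r != 0.
  apply/eqP => r0; have [q _ [h1 h2]] := dnbhs_ex S (filterI (hr P) (ord_neq0 oT)).
  by move: h2; rewrite h1 r0 horner0 eqxx.
have [rs [rE rpole rnp]] := poly_xfun_ord hF hfib hP r0.
pose v q := Nfun q * (1 - u q).
have vT p : \forall q \near p^', v q * v q = - (T q * u q).
  apply: filterS (ord_neq0 (ou p)) => q uq; rewrite /v /T /N2.
  by move: (u q) uq (Nfun q) => a a0 b; field.
(* Only a lower bound, since the order of 1 - u is unknown where u takes the value 1; [ord_sqrt]
   will make it exact. *)
have v_ge p : exists m, ordge S v p m.
  pose m := Num.min 0 ((n (inv p) - n p) *+ 2).
  exists (o p + m); apply: ordge_mul; first exact: (ord_ordge (@ord_Nfun p)).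
  apply: ordge_sub.
    by apply: ordge_le (hol_ordge (hol_cst S 1 p)); rewrite /m ge_min lexx.
  by apply: ordge_le (ord_ordge (ou p)); rewrite /m ge_min lexx orbT.
have even_roots z : ~~ odd (count_mem z rs).
  have [p np pz] := xfun_surj hF hd hfib P z.
  have oTp : ord T p (ramif p * (count_mem z rs)%:Z).
    by apply: ord_eq (_ : ord (fun q => r.[x q]) p _); [apply: filterS (hr p) => q ->|rewrite -pz; exact: rnp].
  have N10 : (-1 : C) != 0 by rewrite oppr_eq0 oner_eq0.
  have ov : ord (fun q => v q * v q) p
      (ramif p * (count_mem z rs)%:Z + (n (inv p) - n p) *+ 2).
    have := ord_mul0 (ord_mul oTp (ou p)) (@ord_cst R X S _ p N10).
    by apply: ord_eq; apply: filterS (vT p) => q ->; rewrite mulrN1.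
  have [m vm] := v_ge p; have [k _ kE] := ord_sqrt vm ov.
  (* At an ordinary point T has order [count_mem z rs], and both v^2 and u have even order. *)
  have [ip|ip] := eqVneq (inv p) p; last first.
    by move: kE; rewrite /ramification (negPf ip) add0r mul1r; lia.
  (* At a Weierstrass point evenness of the order is not enough, as the multiplicity of the root is
     doubled. Since 1 - u = 2 - (u + 1) is a unit, v^2 has order 4 D(p), and the multiplicity is 2
     D(p). *)
  have o1u : ord (fun q => 1 - u q) p 0.
    have two : (2 : C) != 0 by rewrite pnatr_eq0.
    have z0 : ordge S (fun=> 0 : C) p 1.
      exists (fun=> 0); first exact: hol_cst.
      by apply: (@filterE _ p^') => q; rewrite mulr0.
    have := ord_add_dominant (@ord_cst R X S _ p two) (ordge_sub z0 (u1 p ip)).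
    by apply: ord_eq; apply: (@filterE _ p^') => q; ring.
  have := ord_uniq ov (ord_mul (ord_mul (@ord_Nfun p) o1u) (ord_mul (@ord_Nfun p) o1u)).
  by rewrite -/(o p) oPole // /ramification ip eqxx; lia.
have [t tE] := poly_sqrt rE even_roots.
have t0 : t != 0 by apply: contraNneq r0 => t0; rewrite -tE t0 expr0n.
have [ts [_ tpole tnp]] := poly_xfun_ord hF hfib hP t0.
have t_ord p : exists m, ord (fun q => t.[x q]) p m.
  have [hp|np] := boolP (pole p); first by eexists; exact: tpole hp.
  by eexists; exact: tnp np.
pose psi q := v q * (t.[x q])^-1.
have opsi p : ord psi p (n (inv p) - n p).
  have [m tm] := t_ord p; have [m' vm'] := v_ge p.
  have psi_ge := ordge_mul vm' (ord_ordge (ord_inv tm)).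
  have N10 : (-1 : C) != 0 by rewrite oppr_eq0 oner_eq0.
  (* psi^2 = -u, so psi has half the order of u, namely the difference of the two divisors. *)
  have psi2 : ord (fun q => psi q * psi q) p ((n (inv p) - n p) *+ 2).
    have := ord_mul0 (ou p) (@ord_cst R X S _ p N10).
    apply: ord_eq; apply: filterS (filterI (vT p) (filterI (hr p) (ord_neq0 tm))) => q.
    move=> [e1 [e2 nz]]; rewrite /psi mulrACA e1 -invfM -expr2 -horner_exp tE -e2 mulrN1.
    by rewrite mulNr [T q * _]mulrC mulfK // e2 -tE horner_exp expf_neq0.
  have [k pk kE] := ord_sqrt psi_ge psi2.
  by rewrite (_ : n (inv p) - n p = k) //; lia.
exists (fun i q => psi q * s0 i q).
have [cs so] := has_divisor_mul opsi hs0; split=> // i p ip.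
have := so i p ip; rewrite -/(n p) subrK /n.
rewrite (_ : (inv p == P) = (p == inv P)) //.
by apply/eqP/eqP => [<-|->]; rewrite hinvK.
Qed.

End ConjugateSection.

Lemma card_seq_set (T : eqType) (s : seq T) : uniq s -> ([set p | p \in s] #= `I_(size s))%card.
Proof.
elim: s => [_|a s IH /= /andP[as' us]].
  by rewrite (_ : [set p | p \in [::]] = set0) ?II0 //; apply/seteqP; split.
apply/eq_cardSP; exists a; first by rewrite /= inE eqxx.
rewrite (_ : _ `\ a = [set p | p \in s]); first exact: IH.
apply/seteqP; split=> p /=.
  by rewrite inE => -[/orP[/eqP ->//|//]].
by move=> ps; split; [rewrite inE ps orbT|move=> pa; move: as'; rewrite -pa ps].
Qed.

(** * Division by x - x(P_k) and the orbit of P *)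

Section SpinOrbit.
Variables (R : realType) (X : topologicalType) (S : compactRiemannSurface R X).
Local Notation C := (Cplx R).

Variables (inv : X -> X) (F : X -> one_point_compactification C).
Hypothesis hF : holomorphic_to_P1 S F.
Hypothesis hd : degree_two S F.
Hypothesis hfib : forall p, fibre_divisor S F (F p)
  (fun r => point_divisor p r + point_divisor (inv p) r)%N.
Variable L : cocycle R X.
Hypothesis hL : holomorphic_line_bundle S L.
Hypothesis H0 : forall s : patch L -> X -> C, holomorphic_section S s ->
  forall i p, patch_dom i p -> s i p = 0.
Hypothesis hK : isomorphic S (tensor L L) (canonical_bundle S).

Let hinvK := invK hF hfib.

(* Multiplying the section of divisor [D - P] by [(z - z(P)) / (z - z(k))]. *)
Lemma divide_section (P k : X) (D : X -> nat) : inv P <> P ->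
  zero_divisor S L P D -> D (inv P) = 0%N -> (0 < D k)%N ->
  D (inv k) = (inv k == k) :> nat /\
  zero_divisor S L (inv k) (fun p => D p + (p == inv P) - (p == k))%N.
Proof.
move=> hP /(zero_divisorP hL)[s hs DP] DiP Dk.
have kP : k != P by apply: contraTneq Dk => ->; rewrite DP.
have kiP : k != inv P by apply: contraTneq Dk => ->; rewrite DiP.
have nk : ~~ is_pole inv P k by rewrite /is_pole negb_or kP.
have ikiP : (inv k == inv P) = false by rewrite (inj_eq (can_inj hinvK)) (negPf kP).
have hs' := has_divisor_mul (fun p => ord_inv (@xfun_eord R X S inv F hF hfib P hP k p nk)) hs.
set n' := (fun p : X => _) in hs'.
have n'E p : n' p = (D p)%:Z + (p == inv P)%:Z - (p == k)%:Z - (p == inv k)%:Z.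
  by rewrite /n' /fibre_order; ring.
(* A pole must exist, and only inv k can carry a negative coefficient. If inv k = k this reads D(k)
   - 2 < 0, whence D(k) = 1; this case is ruled out in [zero_not_fixed]. *)
have [p] := has_divisor_pole hL H0 hs' P; rewrite n'E => np.
have pik : p = inv k.
  apply/eqP; apply: contraTT np => /negPf ->; rewrite -leNgt.
  by case: (p =P k) => [->|_] /=; lia.
have Dik : D (inv k) = (inv k == k) :> nat.
  move: np; rewrite pik eqxx ikiP; case: (inv k =P k) => [->|_] /=; lia.
split=> //; apply/(zero_divisorP hL); eexists; last first.
  by rewrite Dik ikiP addn0 subnn.
(* The truncated subtraction is harmless because D(k) > 0. *)
have -> : (fun p => (D p + (p == inv P) - (p == k))%N%:Z - (p == inv k)%:Z) = n'.
  apply/funext => q; rewrite n'E; case: (q =P k) => [->|_]; last by rewrite subn0 PoszD subr0.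
  by rewrite -subzn ?PoszD; [ring|lia].
exact: hs'.
Qed.

Section FixedPoint.
Variables (P : X) (D : X -> nat).
Hypothesis hP : inv P <> P.
Hypothesis zD : zero_divisor S L P D.
Hypothesis DiP : D (inv P) = 0%N.
Variable A : seq X.
Hypothesis uA : uniq A.
Hypothesis AE : forall p, (p \in A) = (0 < D p)%N.

Let DP : D P = 0%N.
Proof. by have /(zero_divisorP hL)[] := zD. Qed.

Let hPi : inv (inv P) <> inv P.
Proof. by rewrite hinvK => e; exact: (hP (esym e)). Qed.

Lemma conjugate_zero_divisor : zero_divisor S L (inv P) (D \o inv).
Proof.
have /(zero_divisorP hL)[s hs _] := zD.
have DA p : p \notin A -> D p = 0%N by rewrite AE -eqn0Ngt => /eqP.
have [s' hs'] := conjugate_section hF hd hfib hP hL H0 hK hs DP DiP uA DA.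
by apply/(zero_divisorP hL); exists s' => //=; rewrite hinvK.
Qed.

Lemma zero_divisor_conj k : (0 < D k)%N ->
  zero_divisor S L (inv k) (fun p => D p + (p == inv P) - (p == k))%N.
Proof. by move=> Dk; have [] := divide_section hP zD DiP Dk. Qed.

Lemma zero_divisor_at k : (0 < D k)%N ->
  zero_divisor S L k (fun p => D (inv p) + (p == P) - (p == inv k))%N.
Proof.
move=> Dk.
have Dii : (D \o inv) (inv (inv P)) = 0%N by rewrite /= !hinvK.
have Dik : (0 < (D \o inv) (inv k))%N by rewrite /= hinvK.
by have [_] := divide_section hPi conjugate_zero_divisor Dii Dik; rewrite !hinvK.
Qed.

Lemma zero_not_fixed k : (0 < D k)%N -> inv k <> k.
Proof.
move=> Dk ik; have z1 := zero_divisor_conj Dk; rewrite ik in z1.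
(* At P the first divisor has coefficient 0 and the second has coefficient 1. *)
have := congr1 (fun f => f P) (zero_divisor_uniq hL H0 z1 (zero_divisor_at Dk)).
rewrite /= DP DiP eqxx ik.
have -> : (P == inv P) = false by apply/eqP => e; exact: (hP (esym e)).
by have -> : (P == k) = false; [apply/eqP => e; move: Dk; rewrite -e DP|].
Qed.

Lemma zero_conj0 k : (0 < D k)%N -> D (inv k) = 0%N.
Proof.
move=> Dk; have [-> _] := divide_section hP zD DiP Dk.
by case: eqP => // /(zero_not_fixed Dk).
Qed.

Definition orbit_set : set X :=
  [set P; inv P] `|` [set p | (0 < D p)%N] `|` [set p | (0 < D (inv p))%N].

Lemma orbit_setE : (1 < size A)%N -> S_set S L P = orbit_set.
Proof.
move=> A2; apply/seteqP; split.
  apply: smallest_sub => [|p ->]; last by left; left; left.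
  move=> q [[[->|->]|Dq]|Dq] p /=.
  - by rewrite (zero_setE hL H0 zD) => Dp; left; right.
  - by rewrite (zero_setE hL H0 conjugate_zero_divisor) => Dp; right.
  - rewrite (zero_setE hL H0 (zero_divisor_at Dq)) /= => h.
    case: (ltnP 0 (D (inv p))) => [?|Dp]; first by right.
    by left; left; left; apply/eqP; move: h; case: eqP => //; lia.
  have := zero_setE hL H0 (zero_divisor_conj Dq); rewrite hinvK => -> /= h.
  case: (ltnP 0 (D p)) => [?|Dp]; first by left; right.
  by left; left; right; apply/eqP; move: h; case: eqP => //; lia.
move=> p Mp N [closedN PN].
have NP : N P by exact: PN.
have ND k : (0 < D k)%N -> N k.
  by move=> Dk; apply: (closedN P NP); rewrite (zero_setE hL H0 zD).
have NiD k : (0 < D k)%N -> N (inv k).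
  move=> Dk.
  (* A_k contains every conjugate zero except inv k, so inv k is reached from another zero j; here g
     >= 2 is used. *)
  have [j Aj jk] : exists2 j, j \in A & j != k.
    case: (A) uA A2 => [//|a [//|b s]] /= /andP[+ _] _; rewrite inE negb_or => /andP[ab _].
    have [ak|ak] := eqVneq a k; last by exists a; rewrite ?inE ?eqxx.
    by exists b; rewrite ?inE ?eqxx ?orbT // -ak eq_sym.
  have Dj : (0 < D j)%N by rewrite -AE.
  apply: (closedN j (ND j Dj)); rewrite (zero_setE hL H0 (zero_divisor_at Dj)) /= hinvK.
  by rewrite (inj_eq (can_inj hinvK)) [k == j]eq_sym (negPf jk); lia.
case: Mp => [[[->|->]|Dp]|Dp] //; last 2 first.
- exact: ND.
- by have := NiD _ Dp; rewrite hinvK.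
(* The point inv P is reached last, from inv k, whose divisor is A_P + inv P - k. *)
have [k Ak] : exists k, k \in A by case: (A) A2 => [//|a s] _; exists a; rewrite inE eqxx.
have Dk : (0 < D k)%N by rewrite -AE.
apply: (closedN (inv k) (NiD k Dk)); rewrite (zero_setE hL H0 (zero_divisor_conj Dk)) /=.
have -> : (inv P == k) = false; last by rewrite eqxx; lia.
by apply/eqP => e; move: Dk; rewrite -e DiP.
Qed.

Lemma orbit_set_card : (orbit_set #= `I_(2 * size A + 2))%card.
Proof.
pose s := [:: P, inv P & A ++ map inv A].
have -> : orbit_set = [set p | p \in s].
  have mi p : (p \in map inv A) = (0 < D (inv p))%N.
    by rewrite -AE -{1}(hinvK p) (mem_map (can_inj hinvK)).
  apply/seteqP; split=> p /=; rewrite !inE mem_cat mi AE.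
    by move=> [[[->|->]|->]|->]; rewrite ?eqxx ?orbT.
  by move=> /orP[/eqP ->|/orP[/eqP ->|/orP[]]]; [left; left; left|left; left; right|left; right|right].
rewrite (_ : (2 * size A + 2)%N = size s); last by rewrite /= size_cat size_map; lia.
apply: card_seq_set.
have ui : uniq (map inv A) by rewrite (map_inj_uniq (can_inj hinvK)).
have mi p : (inv p \in map inv A) = (p \in A) by rewrite mem_map //; exact: can_inj hinvK.
have mi' p : (p \in map inv A) = (inv p \in A) by rewrite -mi hinvK.
rewrite /s /= !inE !mem_cat cat_uniq uA ui !mi' hinvK !AE DP DiP /= orbF andbT.
rewrite (_ : (P == inv P) = false) /=; last by apply/eqP => e; exact: (hP (esym e)).
(* The list has no repetition because A_P and inv A_P are disjoint, by [zero_conj0]. *)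
apply/hasPn => k; rewrite mi' AE => Dik; rewrite /= AE.
by have := zero_conj0 Dik; rewrite hinvK => ->.
Qed.

End FixedPoint.
End SpinOrbit.

Local Close Scope ring_scope.

Theorem corollary2 (R : realType) (X : topologicalType)
    (Sigma : compactRiemannSurface R X) (g : nat) (inv : X -> X)
    (xi : cocycle R X) (P : X)
    (hg : has_genus Sigma g) (g_ge2 : (2 <= g)%N)
    (hinv : hyperelliptic_involution Sigma inv)
    (hxi : nonsingular_even_spin_bundle Sigma xi)
    (hP : inv P <> P)
    (hdeg : eps_degree Sigma xi P g)
    (hPt : ~ zero_set Sigma xi P (inv P)) :
  (S_set Sigma xi P #= `I_(2 * g + 2))%card /\
  (forall Pk : 'I_g -> X,
     zero_divisor Sigma xi P (fun Q => (\sum_(k < g) point_divisor (Pk k) Q)%N) ->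
     S_set Sigma xi P =
       [set P; inv P] `|` [set Q | exists k, Q = Pk k \/ Q = inv (Pk k)]).
Proof.
have [F [hF hd hfib]] := hinv; have [hL hK H0] := hxi.
(* The existence of a section with its divisor is read off the cardinality: without one, [zero_set]
   would be empty, against g >= 2. *)
have [D zD] : exists D, zero_divisor Sigma xi P D.
  apply: contrapT => nD; have := card_fset_set hdeg.
  have -> : zero_set Sigma xi P = set0.
    by apply/seteqP; split=> // p [D zD _]; apply: nD; exists D.
  by rewrite fset_set0 finmap.cardfs0 => e; move: g_ge2; rewrite -e.
have ZE := zero_setE hL H0 zD.
have DiP : D (inv P) = 0%N by apply/eqP; rewrite eqn0Ngt; apply/negP => h; apply: hPt; rewrite ZE.
have fin : finite_set [set p | (0 < D p)%N] by apply/finite_setP; exists g; rewrite -ZE.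
(* The support of A_P as a list without repetition; its length g comes from the epsilon-degree. *)
pose A := finmap.enum_fset (fset_set [set p | (0 < D p)%N]).
have sA : size A = g by apply: card_fset_set; rewrite -ZE.
have uA : uniq A by exact: finmap.fset_uniq.
have AE p : (p \in A) = (0 < D p)%N.
  transitivity (p \in [set p | (0 < D p)%N]); first exact: (in_fset_set fin p).
  by apply/idP/idP; rewrite inE.
have A2 : (1 < size A)%N by rewrite sA.
have SE := orbit_setE hF hd hfib hL H0 hK hP zD DiP uA AE A2.
split.
  rewrite SE -sA; exact: (orbit_set_card hF hd hfib hL H0 hK hP zD DiP uA AE).
move=> Pk zPk; rewrite SE.
have DE := zero_divisor_uniq hL H0 zD zPk.
have Dpos p : (0 < D p)%N <-> exists k, p = Pk k.
  rewrite DE; split=> [|[k ->]]; last by rewrite (bigD1 k) //= /point_divisor eqxx.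
  move=> h; apply: contrapT => nk; move: h; rewrite big1 // => k _.
  by rewrite /point_divisor; case: eqP => // e; case: nk; exists k.
have ik := invK hF hfib.
apply/seteqP; split=> p.
  move=> [[?|/Dpos[k pk]]|/Dpos[k pk]]; [by left|by right; exists k; left|].
  by right; exists k; right; rewrite -pk ik.
move=> [?|[k [->|->]]]; first by left; left.
  by left; right; apply/Dpos; exists k.
by right => /=; rewrite ik; apply/Dpos; exists k.
Qed.
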